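(* Let $\mu$ be a Markov measure on $X=\{0,1\}^{\mathbb N}$ determined by a pair $(\lambda,(P^{(n)})_{n\ge1})$ such that $(X,\mu,T)$ is a nonsingular one-sided Markov shift, and let $(\widetilde X,\widetilde\mu,\widetilde T)$ be its natural extension. (i) If $\sum_{u=0}^1\lambda(u)P^{(1)}_{u,v}=\lambda(v)$ for $v=0,1$ and $\sum_{u=0}^1\sum_{n=1}^\infty(P^{(n)}_{u,0}-P^{(1)}_{u,0})^2<\infty$, then $(\widetilde X,\widetilde\mu,\widetilde T)$ is isomorphic (as a nonsingular system) to the measure preserving two-sided shift on the probability space $(\widetilde X,\widetilde\nu)$, where $\widetilde\nu$ is the stationary two-sided Markov measure determined by $\lambda$ and the constant sequence of transition matrices $P^{(1)}$. (ii) If $(\widetilde X,\widetilde\mu,\widetilde T)$ is conservative and the set $\mathcal L$ contains a good non-zero point, then the Maharam extension of $(\widetilde X,\widetilde\mu,\widetilde T)$ is a weakly mixing $K$-automorphism. In particular, $(\widetilde X,\widetilde\mu,\widetilde T)$ is of type $III_1$.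
   Context: Markov measure: $\mu(\{x_1=a_1,\dots,x_k=a_k\})=\lambda(a_1)P^{(1)}_{a_1,a_2}\cdots P^{(k-1)}_{a_{k-1},a_k}$, where $\lambda$ is a probability on $\{0,1\}$ and the $P^{(n)}$ are stochastic $2\times2$ matrices. It is non-degenerate if $\lambda(a)>0$, $P^{(n)}_{a,b}>0$ for all $a,b,n$. A nonsingular one-sided Markov shift is $(X,\mu,T)$ with $(Tx)_n=x_{n+1}$, $\mu$ a non-degenerate non-atomic Markov measure, and $\mu\circ T^{-1}\sim\mu$. Natural extension: $\widetilde T$ is the two-sided shift on $\widetilde X=\{0,1\}^{\mathbb Z}$ with $\widetilde\mu(\{x_i=a_i,-n\le i\le n\})=\big(\prod_{-n<i\le1}Q_{a_{i-1},a_i}\big)\lambda(a_1)\prod_{1\le i<n}P^{(i)}_{a_i,a_{i+1}}$, where $Q_{i,j}=\frac{\lambda(i)P^{(1)}_{i,j}}{\lambda(0)P^{(1)}_{0,j}+\lambda(1)P^{(1)}_{1,j}}$. The set $\mathcal L$: let $\mu_J$ be the image of $\mu$ under $x\mapsto(x_1,x_3,x_5,\dots)$; it is the Markov measure on $X$ determined by $(\lambda,(P^{(2n-1)}P^{(2n)})_{n\ge1})$. For $x\in X$ and $n>0$ put $$r_n^{(x)}=\frac{P^{(2n-1)}_{x_n,1}P^{(2n)}_{1,x_{n+1}}}{P^{(2n-1)}_{x_n,0}P^{(2n)}_{0,x_{n+1}}},$$ and let $\mathcal L^{(x)}\subset[0,+\infty)$ be the set of limit points of $(r_n^{(x)})_{n\ge1}$.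 There is a closed set $\mathcal L\subset[0,+\infty)$ with $\mathcal L^{(x)}=\mathcal L$ for $\mu_J$-a.e. $x$. A point $\alpha\in\mathcal L^{(x)}$ is good if there are $n_1<n_2<\cdots$ with $\lim_jr^{(x)}_{n_j}=\alpha$ and $\sum_{j>0}(\alpha-r^{(x)}_{n_j})^2=+\infty$. ''$\mathcal L$ contains a good non-zero point'' means that there is $\alpha\in\mathcal L$, $\alpha\ne0$, which is a good point of $\mathcal L^{(x)}$ for $\mu_J$-a.e. $x$. For an invertible nonsingular transformation $R$ of a $\sigma$-finite standard space $(Y,\mathfrak C,\nu)$: conservative means that for each $A$ with $\nu(A)>0$ there is $n>0$ with $\nu(R^{-n}A\cap A)>0$. Put $\omega_{R,\nu}=d(\nu\circ R)/d\nu$. The Maharam extension is $(y,t)\mapsto(Ry,\omega_{R,\nu}(y)t)$ on $(Y\times\mathbb R^*_+,\nu\times\kappa)$, where $\kappa\sim$ Lebesgue and $\kappa(aB)=a^{-1}\kappa(B)$. $R$ is of type $III_1$ if its Maharam extension is ergodic. $R$ is a $K$-automorphism if there is a sub-$\sigma$-algebra $\mathfrak F\subset\mathfrak C$ on which $\nu$ is $\sigma$-finite with $R^{-1}\mathfrak F\subset\mathfrak F$, $\omega_{R,\nu}$ $\mathfrak F$-measurable, $\bigvee_{n>0}R^n\mathfrak F=\mathfrak C$ and $\bigcap_{n>0}R^{-n}\mathfrak F$ trivial (mod $\nu$). $R$ is weakly mixing if $R\times S$ is ergodic for every ergodic probability preserving $S$. An isomorphism of nonsingular systems is an invertible measurable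 map (mod null sets) intertwining the transformations and carrying the measure to an equivalent one. *)

(* Defs.v *)
From HB Require Import structures.
From mathcomp Require Import all_boot all_order all_algebra.
From mathcomp Require Import all_classical all_reals all_analysis.

Set Implicit Arguments.
Unset Strict Implicit.
Unset Printing Implicit Defensive.

Import Order.TTheory GRing.Theory Num.Theory numFieldNormedType.Exports.

Local Open Scope classical_set_scope.
Local Open Scope ring_scope.

Section nonsingular_dynamics.
Context {d : measure_display} {Y : measurableType d} {R : realType}.
Implicit Types (nu : set Y -> \bar R) (f : Y -> Y).

Definition equivalent_measures nu1 nu2 := nu1 `<< nu2 /\ nu2 `<< nu1.

Definition automorphism f :=
  measurable_fun setT f /\
  exists g : Y -> Y, [/\ cancel f g, cancel g f & measurable_fun setT g].

Definition nonsingular_automorphism nu f :=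
  automorphism f /\ equivalent_measures (pushforward nu f) nu.

Definition measure_preserving nu f :=
  measurable_fun setT f /\
  forall A, measurable A -> nu (f @^-1` A) = nu A.

Definition ergodic nu f :=
  forall A, measurable A -> f @^-1` A = A -> nu A = 0%E \/ nu (~` A) = 0%E.

Definition conservative nu f :=
  forall A, measurable A -> (0 < nu A)%E ->
    exists2 n, (0 < n)%N & (0 < nu ((iter n f @^-1` A) `&` A))%E.

(* [omega] is an everywhere finite and positive version of the Radon-Nikodym
   derivative d(nu o f)/d nu, where (nu o f)(A) = nu (f A). *)
Definition rn_cocycle nu f (omega : Y -> R) :=
  [/\ measurable_fun setT omega, (forall y, 0 < omega y) &
      forall A, measurable A ->
        nu (f @` A) = (\int[nu]_(y in A) (omega y)%:E)%E].

Definition K_automorphism nu f :=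
  nonsingular_automorphism nu f /\
  exists F : set (set Y),
    [/\ sigma_algebra setT F, F `<=` measurable &
        exists A : nat -> set Y,
          (forall i, F (A i) /\ (nu (A i) < +oo)%E) /\
          \bigcup_i A i = setT] /\
    [/\ (forall A, F A -> F (f @^-1` A)),
        (exists2 omega, rn_cocycle nu f omega &
           forall B, measurable B -> F (omega @^-1` B)),
        <<s \bigcup_(n in [set n | (0 < n)%N]) [set iter n f @` A | A in F] >>
          = measurable &
        forall A,
          (forall n, (0 < n)%N -> exists2 B, F B & A = iter n f @^-1` B) ->
          nu A = 0%E \/ nu (~` A) = 0%E].

End nonsingular_dynamics.

(* By the Lusin-Souslin and Kuratowski theorems this is the same as being
   Borel isomorphic to a Borel subset of the line. *)
Definition standard_borel (R : realType) d (Y : measurableType d) :=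
  exists f : Y -> measurableTypeR R,
    [/\ measurable_fun setT f, injective f &
        forall A, measurable A -> measurable (f @` A)].

Definition weakly_mixing (R : realType) d (Y : measurableType d)
    (nu : set Y -> \bar R) (f : Y -> Y) :=
  forall (d' : measure_display) (Z : measurableType d')
    (p : probability Z R) (s : Z -> Z),
    standard_borel R Z -> automorphism s -> measure_preserving p s ->
    ergodic p s ->
    ergodic (nu \x p)%E (fun w : Y * Z => (f w.1, s w.2)).

Definition isomorphic (R : realType) d1 (Y1 : measurableType d1)
    d2 (Y2 : measurableType d2)
    (nu1 : set Y1 -> \bar R) (f1 : Y1 -> Y1)
    (nu2 : set Y2 -> \bar R) (f2 : Y2 -> Y2) :=
  exists (phi : Y1 -> Y2) (psi : Y2 -> Y1),
    [/\ measurable_fun setT phi, measurable_fun setT psi,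
        {ae nu1, forall y, psi (phi y) = y} &
        {ae nu2, forall z, phi (psi z) = z}] /\
    {ae nu1, forall y, phi (f1 y) = f2 (phi y)} /\
    equivalent_measures (pushforward nu1 phi) nu2.

Section maharam.
Context {d : measure_display} {Y : measurableType d} {R : realType}.

(* The fibre, the group of positive reals, is represented by the line with a
   measure giving mass zero to the nonpositive half-line. The conditions say
   that kappa is a positive multiple of t^-2 dt on `]0, +oo[. *)
Definition maharam_fibre_measure (kappa : set (measurableTypeR R) -> \bar R) :=
  [/\ kappa [set t : R | t <= 0] = 0%E,
      (forall B, measurable B -> B `<=` [set t : R | 0 < t] ->
         kappa B = 0%E <-> lebesgue_measure B = 0%E) &
      forall (a : R) B, 0 < a -> measurable B -> B `<=` [set t : R | 0 < t] ->
        kappa [set a * t | t in B] = ((a^-1)%:E * kappa B)%E].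

Definition maharam_map (f : Y -> Y) (omega : Y -> R)
    (w : Y * measurableTypeR R) : Y * measurableTypeR R :=
  (f w.1, omega w.1 * w.2).

(* The Maharam extension is only determined up to a null set (the choice of a
   version of the derivative) and a multiplicative constant (the choice of
   kappa); [C] is required for all choices. *)
Definition maharam_extension_is
    (C : (set (Y * measurableTypeR R) -> \bar R) ->
         (Y * measurableTypeR R -> Y * measurableTypeR R) -> Prop)
    (nu : set Y -> \bar R) (f : Y -> Y) :=
  nonsingular_automorphism nu f /\
  forall (omega : Y -> R)
    (kappa : {sigma_finite_measure set (measurableTypeR R) -> \bar R}),
    rn_cocycle nu f omega -> maharam_fibre_measure kappa ->
    C (nu \x kappa)%E (maharam_map f omega).

Definition type_III1 (nu : set Y -> \bar R) (f : Y -> Y) :=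
  maharam_extension_is ergodic nu f.

End maharam.

HB.instance Definition _ (n : nat) := isPointed.Build 'I_n.+1 ord0.

Definition coordinate_sets (I : Type) : set (set (I -> 'I_2)) :=
  [set A | exists i a, A = [set x | x i = a]].

Definition path_space (I : Type) :
    measurableType (sigma_display (@coordinate_sets I)) :=
  g_sigma_algebraType (@coordinate_sets I).

Section markov.
Context {R : realType}.

(* One-sided sequences and sequences of matrices are indexed from 0:
   [x n], [P n] stand for x_(n+1), P^(n+1). Two-sided sequences are indexed
   by [int] without any offset. *)
Implicit Types (lambda : 'I_2 -> R) (P : nat -> 'M[R]_2).

Definition X1 := path_space nat.
Definition X2 := path_space int.

Definition shift1 (x : X1) : X1 := fun n => x n.+1.
Definition shift2 (x : X2) : X2 := fun n => x (n + 1).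

Definition stochastic (M : 'M[R]_2) :=
  (forall a b, 0 <= M a b) /\ (forall a, \sum_b M a b = 1).

Definition markov_measure lambda P (mu : set X1 -> \bar R) :=
  forall (n : nat) (a : nat -> 'I_2),
    mu [set x | forall i, (i <= n)%N -> x i = a i] =
    (lambda (a 0%N) * \prod_(i < n) P i (a i) (a i.+1))%:E.

Definition nonatomic d (Y : measurableType d) (nu : set Y -> \bar R) :=
  forall A, measurable A -> (0 < nu A)%E ->
    exists B, [/\ measurable B, B `<=` A & (0 < nu B < nu A)%E].

Definition nonsingular_markov_shift lambda P (mu : set X1 -> \bar R) :=
  [/\ (forall a, 0 < lambda a) /\ \sum_a lambda a = 1,
      (forall n, stochastic (P n)) /\ (forall n a b, 0 < P n a b),
      markov_measure lambda P mu,
      nonatomic mu &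
      equivalent_measures (pushforward mu shift1) mu].

Definition backward_matrix lambda P (i j : 'I_2) : R :=
  lambda i * P 0%N i j / (lambda 0 * P 0%N 0 j + lambda 1 * P 0%N 1 j).

(* The first product is over -n < i <= 1, with i = 1 - k; the second one
   is over 1 <= i < n, with i = k + 1. *)
Definition natural_extension_measure lambda P (tmu : set X2 -> \bar R) :=
  forall (n : nat) (a : int -> 'I_2), (0 < n)%N ->
    tmu [set x | forall i : int, - n%:Z <= i <= n%:Z -> x i = a i] =
    ((\prod_(k < n.+1)
        backward_matrix lambda P (a (- k%:Z)) (a (1 - k%:Z))) *
     lambda (a 1) *
     \prod_(k < n.-1) P k (a k.+1%:Z) (a k.+2%:Z))%:E.

Definition stationary_markov_measure lambda (M : 'M[R]_2)
    (nu : set X2 -> \bar R) :=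
  forall (m : int) (n : nat) (a : int -> 'I_2),
    nu [set x | forall i : int, m <= i <= m + n%:Z -> x i = a i] =
    (lambda (a m) *
     \prod_(k < n) M (a (m + k%:Z)) (a (m + k%:Z + 1)))%:E.

Definition odd_coordinates (x : X1) : X1 := fun n => x n.*2.

(* [ratio P x n] is r_(n+1)^(x); P^(2n+1) and P^(2n+2) are [P n.*2] and
   [P n.*2.+1]. *)
Definition ratio P (x : X1) (n : nat) : R :=
  (P n.*2 (x n) 1 * P n.*2.+1 1 (x n.+1)) /
  (P n.*2 (x n) 0 * P n.*2.+1 0 (x n.+1)).

Definition limit_points (r : nat -> R) : set R := cluster (r @ \oo).

Definition good_point (r : nat -> R) (alpha : R) :=
  limit_points r alpha /\
  exists n : nat -> nat,
    [/\ {homo n : i j / (i < j)%N},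
        r (n j) @[j --> \oo] --> alpha &
        (\sum_(0 <= j <oo) ((alpha - r (n j)) ^+ 2)%:E = +oo)%E].

(* [L] is the almost sure value of the random set of limit points; it is
   determined by [P] and [mu]. *)
Definition ratio_limit_set P (mu : set X1 -> \bar R) (L : set R) :=
  [/\ closed L, L `<=` [set t | 0 <= t] &
      {ae (pushforward mu odd_coordinates : set X1 -> \bar R),
         forall x, limit_points (ratio P x) = L}].

Definition contains_good_nonzero_point P (mu : set X1 -> \bar R)
    (L : set R) :=
  exists alpha : R,
    [/\ L alpha, alpha != 0 &
        {ae (pushforward mu odd_coordinates : set X1 -> \bar R),
           forall x, good_point (ratio P x) alpha}].

End markov.

(* Main.v *)
(* Part (i). By stationarity the backward transitions are those of the stationary
   measure, so on the windows [-n, n] the likelihood ratio of the two measures is a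
   product over k of P^(k) / P^(1). Its second moment, for either measure, is
   bounded by a product of factors 1 + O(sum_u (P^(k)_(u,0) - P^(1)_(u,0))^2),
   hence the measures are equivalent and the identity is an isomorphism.

   Part (ii). Let a_0 with values in [0, 1] be a tail function of the skew product
   (x, t) |-> (T x, t / g x) over the one-sided shift, g = d(mu o T^-1) / d mu.
   Changing one coordinate of x changes a_0 by a rescaling of t by an explicit
   factor rho_j(x).  Averaging over t against a kernel gives a bounded function f
   of (x, t) with f(F_j x, t) = f(x, rho_j(x) t) for the flip F_j of coordinate j,
   and f is smooth in t. Flips of distinct odd coordinates are almost orthogonal:
   the increments of the martingale E(f | x_1, ..., x_k) have a summable square
   norm, whereas a good limit point alpha makes sum_j (rho_j - beta)^2 diverge
   for the limit beta of rho_j. Hence f(x, .) is invariant under beta and has zero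
   logarithmic derivative, so that f depends on x only; then it is invariant under
   flips and constant. So the skew product is exact, and its natural extension, the
   Maharam extension, is a K-automorphism.

   For weak mixing, conservativity yields a set G of finite measure to which almost
   every orbit of the Maharam extension returns.  A set E invariant under a product
   with S is approximated in G by a set depending on the coordinates after time
   - l; pulling it back l times by the first return map makes it depend on the
   future only and does not increase the error. So E is measurable with respect to
   the future, its fibre measures are tail functions, hence constant, and E is a
   product of the whole space with an S-invariant set. *)
From HB Require Import structures.
From mathcomp Require Import all_boot all_order all_algebra.
From mathcomp Require Import all_classical all_reals all_analysis.
From mathcomp Require Import measurable_realfun.
From mathcomp Require Import ring lra zify.
Require Import Defs.
Import Order.TTheory GRing.Theory Num.Theory numFieldNormedType.Exports.
Local Open Scope classical_set_scope.
Local Open Scope ring_scope.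
Set Implicit Arguments.
Unset Strict Implicit.
Unset Printing Implicit Defensive.

(** * Null sets, paths and cylinders *)

(** The obstacle is quantitative. The hypothesis makes only the squares of [rho_j - beta]
    non-summable, and orthogonality of martingale increments controls only squares; so the linear
    term of the average in [rho_j - beta] has to dominate its error uniformly in the point. Averages
    over rays []t, +oo[] are merely Lipschitz in [log t]. The kernel [1 / t - 1 / v] is one
    integration smoother: its Taylor error is quadratic, and its linear coefficient ([avg_slope]) is
    again built from averages, to which Levy's theorem applies. Invariance under [beta] must precede
    this expansion: a flip compares the averages at [r] and at a point near [beta r], and only once
    the values at [r] and [beta r] are identified are the two arguments close. The limit [beta]
    depends on the flipped letter and its two neighbours, so on one of eight triples. By the
    pigeonhole principle some triple carries the divergence, but which one depends on the point; the
    sets of points belonging to a given triple are invariant under flips, so each can be treated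
    alone. *)

Section ae_tools.
Context {d1 d2 : measure_display} {T1 : measurableType d1} {T2 : measurableType d2} {R : realType}.

Lemma ae_pullback (m1 : {measure set T1 -> \bar R}) (m2 : {measure set T2 -> \bar R})
    (f : T1 -> T2) (P : T2 -> Prop) :
  measurable_fun setT f ->
  (forall A, measurable A -> m2 A = 0%E -> m1 (f @^-1` A) = 0%E) ->
  {ae m2, forall y, P y} -> {ae m1, forall x, P (f x)}.
Proof.
move=> mf m12 [N [mN N0 PN]]; exists (f @^-1` N); split.
- by rewrite -[X in measurable X]setTI; exact: mf.
- exact: m12.
- by move=> x /= nP; apply: PN.
Qed.

Lemma ae_xsection (m1 : {measure set T1 -> \bar R})
    (m2 : {sigma_finite_measure set T2 -> \bar R}) (P : T1 * T2 -> Prop) :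
  {ae (m1 \x m2)%E, forall w, P w} ->
  {ae m1, forall x, {ae m2, forall y, P (x, y)}}.
Proof.
move=> [N [mN N0 PN]].
have mF := measurable_fun_xsection m2 mN.
have := (ae_eq_integral_abs m1 measurableT mF).1.
rewrite (_ : integral _ _ _ = 0%E); last first.
  by rewrite -N0; apply: eq_integral => x _ /=; rewrite gee0_abs.
move=> /(_ erefl); apply: filterS => x /= /(_ I) h; exists (xsection N x); split => //.
- exact: measurable_xsection.
- by move=> y /= nP; rewrite /xsection /= inE; exact: PN.
Qed.

Lemma xsection_null (m1 : {measure set T1 -> \bar R})
    (m2 : {sigma_finite_measure set T2 -> \bar R}) (N : set (T1 * T2)) :
  measurable N -> {ae m1, forall x, m2 (xsection N x) = 0%E} ->
  (m1 \x m2)%E N = 0%E.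
Proof.
move=> mN h; rewrite /product_measure1.
rewrite (ae_eq_integral (cst 0%E))// ?integral0//.
  exact: measurable_fun_xsection.
by apply: filterS h => x /= ->.
Qed.

End ae_tools.

Section image_density.
Context {d1 d2 : measure_display} {T1 : measurableType d1} {T2 : measurableType d2}
  {R : realType}.
Variables (m : {measure set T2 -> \bar R}) (phi : T2 -> T1) (h : T2 -> R).

(** The image under [phi] of the measure with density [h]. The side conditions are arguments of the
    definition so that the measure structure can be attached to it. *)
Definition image_density of measurable_fun setT phi & measurable_fun setT h
    & (forall x, 0 <= h x) :=
  fun A => (\int[m]_(x in phi @^-1` A) (h x)%:E)%E.

Hypotheses (mphi : measurable_fun setT phi) (mh : measurable_fun setT h)
  (h0 : forall x, 0 <= h x).
Local Notation dm := (image_density mphi mh h0).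

Let dm0 : dm set0 = 0%E.
Proof. by rewrite /image_density preimage_set0 integral_set0. Qed.

Let dm_ge0 A : (0 <= dm A)%E.
Proof. by apply: integral_ge0 => x _; rewrite lee_fin. Qed.

Let mpre A : measurable A -> measurable (phi @^-1` A).
Proof. by move=> mA; rewrite -[X in measurable X]setTI; exact: mphi. Qed.

Let dm_sigma : semi_sigma_additive dm.
Proof.
move=> F mF tF mUF; rewrite /image_density preimage_bigcup ge0_integral_bigcup//.
- by apply: is_cvg_ereal_nneg_natsum_cond => n _ _; apply: integral_ge0 => x _; rewrite lee_fin.
- by move=> n; exact: mpre.
- by apply: measurable_funTS; exact/measurable_EFinP.
- by move=> x _; rewrite lee_fin.
- apply/trivIsetP => a b _ _ ab; rewrite -preimage_setI.
  by move/trivIsetP : tF => /(_ _ _ _ _ ab) ->//; rewrite preimage_set0.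
Qed.

HB.instance Definition _ := isMeasure.Build _ _ _ dm dm0 dm_ge0 dm_sigma.

End image_density.

Section bool_ord.
Lemma ord2P (b : 'I_2) : b = 0 \/ b = 1.
Proof. by case: b => [[|[|]]]// ?; [left|right]; apply/val_inj. Qed.
End bool_ord.

Section paths.
Context {I : eqType}.
Local Notation X := (path_space I).
Implicit Types (x y : X) (J : seq I).

(** The prescribed letters are carried by a whole path instead of a finite word, so that changing
    one of them is an [upd] of [x] and the same cylinders serve one- and two-sided paths. *)
Definition cyl J x : set X := [set y | forall i, i \in J -> y i = x i].
Definition upd x i (b : 'I_2) : X := fun j => if j == i then b else x j.

Lemma measurable_coord i b : measurable ([set x | x i = b] : set X).
Proof. by apply: sub_sigma_algebra; exists i, b. Qed.

Lemma measurable_fun_path d (T : measurableType d) (f : T -> X) :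
  (forall i b, measurable [set t | f t i = b]) -> measurable_fun setT f.
Proof.
move=> h; apply: (@measurability _ _ _ _ _ f (coordinate_sets (I:=I))) => //.
move=> _ [_ [i [b ->]] <-]; rewrite setTI; exact: h.
Qed.

Lemma cyl_nil x : cyl [::] x = setT.
Proof. by apply/seteqP; split. Qed.

Lemma cyl_cons i J x : cyl (i :: J) x = [set y | y i = x i] `&` cyl J x.
Proof.
apply/seteqP; split => y /=.
  move=> h; split; first by apply: h; rewrite mem_head.
  by move=> j jJ; apply: h; rewrite inE jJ orbT.
by move=> [h1 h2] j; rewrite inE => /predU1P[->//|]; exact: h2.
Qed.

Lemma measurable_cyl J x : measurable (cyl J x).
Proof.
elim: J => [|i J ih]; first by rewrite cyl_nil; exact: measurableT.
by rewrite cyl_cons; apply: measurableI => //; exact: measurable_coord.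
Qed.

Lemma cyl_sym J x y : cyl J x y -> cyl J y x.
Proof. by move=> h i /h ->. Qed.

Lemma cyl_eq J x y : cyl J x y -> cyl J y = cyl J x.
Proof.
move=> h; apply/seteqP; split => z hz i iJ; rewrite hz// h//.
Qed.

Lemma cyl_sub J J' x : {subset J <= J'} -> cyl J' x `<=` cyl J x.
Proof. by move=> JJ y h i /JJ; exact: h. Qed.

Lemma upd_same x i b : upd x i b i = b. Proof. by rewrite /upd eqxx. Qed.
Lemma upd_other x i b j : j != i -> upd x i b j = x j.
Proof. by rewrite /upd => /negbTE ->. Qed.

Lemma cyl_split i J x : i \notin J ->
  cyl J x = cyl (i :: J) (upd x i 0) `|` cyl (i :: J) (upd x i 1).
Proof.
move=> iJ; have e b : cyl J (upd x i b) = cyl J x.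
  apply/seteqP; split => y h j jJ; have ji : j != i by apply: contraNneq iJ => <-.
    by rewrite h// upd_other.
  by rewrite h// upd_other.
rewrite !cyl_cons !e !upd_same -setIUl; apply/seteqP; split => [y h|y []//].
by split => //; case: (ord2P (y i)); [left|right].
Qed.

Lemma cyl_split_disj i J x :
  cyl (i :: J) (upd x i 0) `&` cyl (i :: J) (upd x i 1) = set0.
Proof.
rewrite !cyl_cons !upd_same; apply/seteqP; split => // y [[/= -> _] [/= e _]].
by have := congr1 val e.
Qed.

Lemma cyl_mem i J x : i \in J -> cyl (i :: J) x = cyl J x.
Proof.
move=> iJ; rewrite cyl_cons; apply/seteqP; split => [y []//|y h]; split => //=.
exact: h.
Qed.

Section local_to_global.
Context {R : realType}.

(** The coordinates of [J] are removed one at a time: a cylinder is the disjoint union of its two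
    refinements at a new coordinate. The addition is a parameter because both measures and real
    integrals over cylinders are treated this way. *)
Lemma cyl_additive_eq (U : Type) (add : U -> U -> U) (u v : set X -> U) J J' :
  (forall A B, measurable A -> measurable B -> A `&` B = set0 ->
     u (A `|` B) = add (u A) (u B)) ->
  (forall A B, measurable A -> measurable B -> A `&` B = set0 ->
     v (A `|` B) = add (v A) (v B)) ->
  (forall x, u (cyl (J ++ J') x) = v (cyl (J ++ J') x)) ->
  forall x, u (cyl J' x) = v (cyl J' x).
Proof.
move=> uD vD; elim: J => [//|i J ih] h; apply: ih => x.
have [iJ|iJ] := boolP (i \in J ++ J').
  by rewrite -(cyl_mem _ iJ); exact: h.
have m b := measurable_cyl (i :: J ++ J') (upd x i b).
rewrite (cyl_split _ iJ) uD ?vD ?cyl_split_disj//.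
by congr add; exact: h.
Qed.

Lemma measure_additive (m : {measure set X -> \bar R}) A B :
  measurable A -> measurable B -> A `&` B = set0 ->
  m (A `|` B) = (m A + m B)%E.
Proof. by move=> mA mB AB; rewrite measureU. Qed.

(** Agreement on the windows passes to all cylinders by additivity, and the cylinders together with
    the empty set are stable under intersection and generate. *)
Lemma path_measure_unique (m1 m2 : {measure set X -> \bar R}) (W : nat -> seq I) :
  (m2 setT < +oo)%E ->
  (forall J, exists k, {subset J <= W k}) ->
  (forall k x, m1 (cyl (W k) x) = m2 (cyl (W k) x)) ->
  forall A, measurable A -> m1 A = m2 A.
Proof.
move=> fin WJ h.
have hJ J x : m1 (cyl J x) = m2 (cyl J x).
  have [k kJ] := WJ J.
  apply: (@cyl_additive_eq _ adde m1 m2 (W k)) => [A B|A B|{}x]; [exact: measure_additive..|].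
  have -> : cyl (W k ++ J) x = cyl (W k) x.
    apply/seteqP; split; apply: cyl_sub => i; rewrite mem_cat; first by move=> ->.
    by move=> /orP[//|/kJ].
  exact: h.
move=> A mA.
pose G : set (set X) := [set B | B = set0 \/ exists J x, B = cyl J x].
apply: (@measure_unique _ _ _ G (fun=> setT)) => //.
- apply/seteqP; split.
    apply: smallest_sub; first exact: smallest_sigma_algebra.
    move=> _ [i [b ->]]; apply: sub_sigma_algebra; right.
    exists [:: i], (fun=> b); rewrite cyl_cons cyl_nil setIT//.
  apply: smallest_sub; first exact: (@sigma_algebra_measurable _ X).
  move=> _ [->|[J [x ->]]]; first exact: measurable0.
  exact: measurable_cyl.
- move=> B1 B2 [->|[J [x ->]]]; first by left; rewrite set0I.
  move=> [->|[J' [x' ->]]]; first by left; rewrite setI0.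
  have [[y [yx yx']]|ne] := pselect (exists y, cyl J x y /\ cyl J' x' y).
    right; exists (J ++ J'), y; apply/seteqP; split => z.
      move=> [zx zx'] i; rewrite mem_cat => /orP[iJ|iJ].
        by rewrite zx// yx.
      by rewrite zx'// yx'.
    move=> h1; split => i iJ; first by rewrite h1 ?mem_cat ?iJ// yx.
    by rewrite h1 ?mem_cat ?iJ ?orbT// yx'.
  by left; apply/seteqP; split => // z [zx zx']; apply: ne; exists z.
- by move=> _; right; exists [::], (fun=> 0); rewrite cyl_nil.
- by apply/seteqP; split => // x _; exists 0.
- by move=> B [->|[J [x ->]]]; rewrite ?measure0// hJ.
- by move=> _; rewrite -(cyl_nil (fun=> 0)) hJ cyl_nil.
Qed.

End local_to_global.

(** Fixing the letter at [i] leaves a set that depends on the remaining coordinates only. *)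
Lemma measurable_window J (A : set X) :
  (forall x y, cyl J x y -> A x -> A y) -> measurable A.
Proof.
elim: J A => [|i J ih] A h.
  have [[x Ax]|nA] := pselect (exists x, A x).
    have -> : A = setT by apply/seteqP; split => // y _; apply: (h x).
    exact: measurableT.
  have -> : A = set0 by apply/seteqP; split => // y Ay; apply: nA; exists y.
  exact: measurable0.
pose Ab b := [set x | A (upd x i b)].
have mAb b : measurable (Ab b).
  apply: ih => x y xy /=; apply: h => j; rewrite inE /upd.
  by case: eqP => //= _; exact: xy.
have -> : A = ([set x | x i = 0] `&` Ab 0) `|` ([set x | x i = 1] `&` Ab 1).
  have e x b : x i = b -> upd x i b = x.
    by move=> xb; apply/funext => j; rewrite /upd; case: eqP => // ->.
  apply/seteqP; split => x.
    move=> Ax; case: (ord2P (x i)) => xb; [left|right]; split => //;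
    by rewrite /Ab /= e.
  by move=> [[/= xb]|[/= xb]]; rewrite /Ab /= e.
by apply: measurableU; apply: measurableI => //; exact: measurable_coord.
Qed.

Lemma measurable_fun_window J d (T : measurableType d) (h : X -> T) :
  (forall x y, cyl J x y -> h x = h y) -> measurable_fun setT h.
Proof.
move=> hh _ B mB; rewrite setTI; apply: (@measurable_window J) => x y xy /=.
by rewrite (hh _ _ xy).
Qed.

End paths.

Lemma lte_fine_dist (R : realType) (a b : \bar R) (c : R) :
  a \is a fin_num -> b \is a fin_num -> `|fine a - fine b| < c -> (a - b < c%:E)%E.
Proof.
move: a b => [a| |] [b| |]//= _ _ h; rewrite -EFinB lte_fin.
exact: le_lt_trans (ler_norm _) h.
Qed.

(** * Approximation by an increasing sequence of algebras *)

Section approximation.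
Context {d : measure_display} {T : measurableType d} {R : realType}.
Variables (m : {measure set T -> \bar R}) (fin : (m setT < +oo)%E).
Variable Alg : nat -> set (set T).
Hypotheses (AlgM : forall j A, Alg j A -> measurable A)
  (Alg0 : forall j, Alg j set0)
  (AlgC : forall j A, Alg j A -> Alg j (~` A))
  (AlgU : forall j A B, Alg j A -> Alg j B -> Alg j (A `|` B))
  (AlgS : forall j k A, (j <= k)%N -> Alg j A -> Alg k A)
  (gen : measurable `<=` <<s \bigcup_j Alg j >>).

(** The sets that can be approximated form a sigma-algebra containing every [Alg j]. A countable
    union is first truncated; the finite part is then approximated within a single algebra, because
    the [Alg j] increase. *)
Lemma measure_approximation A (e : R) : measurable A -> 0 < e ->
  exists j B, Alg j B /\ (m ((A `\` B) `|` (B `\` A)) < e%:E)%E.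
Proof.
pose D (A B : set T) := (A `\` B) `|` (B `\` A).
have mD A' B' : measurable A' -> measurable B' -> measurable (D A' B').
  by move=> *; apply: measurableU; exact: measurableD.
have finm A' : measurable A' -> m A' \is a fin_num.
  move=> mA; rewrite ge0_fin_numE//; apply: le_lt_trans fin.
  by apply: le_measure; rewrite ?inE//; exact: measurableT.
have lem A' B' : measurable A' -> measurable B' -> A' `<=` B' -> (m A' <= m B')%E.
  by move=> *; apply: le_measure; rewrite ?inE.
pose C := [set A | measurable A /\ forall e : R, 0 < e ->
  exists j B, Alg j B /\ (m (D A B) < e%:E)%E].
suff H : measurable `<=` C by move=> /H[_]; exact.
apply: subset_trans gen _; apply: smallest_sub; last first.
  move=> A' [j _ Aj]; split; first exact: AlgM Aj.
  move=> e' e0; exists j, A'; split => //; rewrite /D setDv setU0 measure0 lte_fin//.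
split.
- split; first exact: measurable0.
  move=> e' e0; exists 0%N, set0; split => //.
  by rewrite /D setDv setU0 measure0 lte_fin.
- move=> A' [mA h]; rewrite setTD; split; first exact: measurableC.
  move=> e' /h[j [B [AB le]]]; exists j, (~` B); split; first exact: AlgC.
  rewrite (_ : D _ _ = D A' B)//; rewrite /D !setDE !setCK.
  by rewrite setUC [in X in X `|` _]setIC [in X in _ `|` X]setIC.
- move=> F FC; have mF n : measurable (F n) by have [] := FC n.
  have mUF : measurable (\bigcup_n F n) by exact: bigcup_measurable.
  split => // e' e0.
  pose S n := \bigcup_(i < n) F i.
  have mS n : measurable (S n) by apply: bigcup_measurable => *.
  have cvS : m \o S @ \oo --> m (\bigcup_n F n).
    rewrite (_ : \bigcup_n F n = \bigcup_n S n).
      apply: nondecreasing_cvg_mu => //; first exact: bigcup_measurable.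
      move=> a b ab; apply/subsetPset => x [i ia Fi]; exists i => //=.
      exact: leq_trans ab.
    apply/seteqP; split => x.
      by move=> [i _ Fi]; exists i.+1 => //; exists i => /=.
    by move=> [n _ [i _ Fi]]; exists i.
  have [n Hn] : exists n, (m (\bigcup_n F n `\` S n) < (e' / 2)%:E)%E.
    have e20 : 0 < e' / 2 by rewrite divr_gt0.
    have /fine_cvgP[_ /cvgrPdist_lt/(_ _ e20)[n _ /(_ n (leqnn n))]] :
        m \o S @ \oo --> (fine (m (\bigcup_n F n)))%:E by rewrite fineK// finm.
    move=> /= hn; exists n; rewrite measureD//; last by rewrite -ge0_fin_numE// finm.
    rewrite (_ : _ `&` S n = S n); last first.
      by rewrite setIC; apply/setIidPl => x [i _ Fi]; exists i.
    exact: lte_fine_dist (finm _ mUF) (finm _ (mS n)) hn.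
  have [j [B [AB le]]] : exists j B, Alg j B /\ (m (D (S n) B) < (e' / 2)%:E)%E.
    have : forall e : R, 0 < e -> exists j B, Alg j B /\ (m (D (S n) B) < e%:E)%E.
      elim: n {Hn} => [|n ih] e1 e10.
        exists 0%N, set0; split => //; rewrite /S /D.
        rewrite (_ : \bigcup_(i < 0) F i = set0); last by apply/seteqP; split => // x [].
        by rewrite setDv setU0 measure0 lte_fin.
      have e2 : 0 < e1 / 2 by rewrite divr_gt0.
      have [j [B [AB le]]] := ih _ e2.
      have [_ /(_ _ e2)[j' [B' [AB' le']]]] := FC n.
      exists (maxn j j'), (B `|` B'); split.
        apply: AlgU; first exact: (AlgS (leq_maxl _ _) AB).
        exact: (AlgS (leq_maxr _ _) AB').
      have mB := AlgM AB; have mB' := AlgM AB'.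
      have SS : S n.+1 = S n `|` F n.
        apply/seteqP; split => x.
          move=> [i /=]; rewrite ltnS leq_eqVlt => /predU1P[->|ii] Fi; first by right.
          by left; exists i.
        by move=> [[i ii Fi]|Fn]; [exists i => //=; exact: ltnW|exists n => /=].
      apply: (@le_lt_trans _ _ (m (D (S n) B `|` D (F n) B'))).
        apply: lem; rewrite ?SS; [apply: (mD) => //; exact: measurableU| |].
          by apply: measurableU; exact: mD.
        move=> x [[[?|?] /not_orP[? ?]]|[[?|?] /not_orP[? ?]]].
        - by left; left.
        - by right; left.
        - by left; right.
        - by right; right.
      apply: (le_lt_trans (measureU2 _ _ _)); [exact: mD..|].
      by rewrite [e1]splitr EFinD; exact: lteD.
    by apply; rewrite divr_gt0.
  exists j, B; split => //; have mB := AlgM AB.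
  apply: (@le_lt_trans _ _ (m ((\bigcup_n F n `\` S n) `|` D (S n) B))).
    apply: lem; [exact: mD|apply: measurableU; [exact: measurableD|exact: mD]|].
    move=> x [[Fx nB]|[Bx nF]].
      have [Sx|nS] := pselect (S n x); first by right; left.
      by left.
    right; right; split => // -[i _ Fi]; apply: nF; by exists i.
  apply: (le_lt_trans (measureU2 _ _ _)); [exact: measurableD|exact: mD|].
  by rewrite [e']splitr EFinD; exact: lteD.
Qed.

End approximation.

(** * Averages over cylinders *)

Section bounded_measurable.
Context {d : measure_display} {T : measurableType d} {R : realType}.
Implicit Types g h : T -> R.

Definition bounded_mfun g := measurable_fun setT g /\ exists M, forall x, `|g x| <= M.

Lemma bounded_mfun_cst c : bounded_mfun (fun=> c).
Proof. by split; [exact: measurable_cst|exists `|c|]. Qed.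

Lemma bounded_mfunD g h : bounded_mfun g -> bounded_mfun h -> bounded_mfun (fun x => g x + h x).
Proof.
move=> [mg [M gM]] [mh [N hN]]; split; first exact: measurable_funD.
by exists (M + N) => x; apply: le_trans (ler_normD _ _) _; exact: lerD.
Qed.

Lemma bounded_mfunM g h : bounded_mfun g -> bounded_mfun h -> bounded_mfun (fun x => g x * h x).
Proof.
move=> [mg [M gM]] [mh [N hN]]; split; first exact: measurable_funM.
by exists (M * N) => x; rewrite normrM; exact: ler_pM.
Qed.

Lemma bounded_mfunN g : bounded_mfun g -> bounded_mfun (fun x => - g x).
Proof.
move=> [mg [M gM]]; split; first exact: measurable_funN.
by exists M => x; rewrite normrN.
Qed.

Lemma bounded_mfunB g h : bounded_mfun g -> bounded_mfun h -> bounded_mfun (fun x => g x - h x).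
Proof. by move=> bg bh; apply: bounded_mfunD => //; exact: bounded_mfunN. Qed.

Lemma bounded_mfunX2 g : bounded_mfun g -> bounded_mfun (fun x => g x ^+ 2).
Proof. by move=> bg; under eq_fun do rewrite expr2; exact: bounded_mfunM. Qed.

Lemma bounded_mfun01 g : measurable_fun setT g -> (forall x, 0 <= g x <= 1) -> bounded_mfun g.
Proof.
move=> mg h; split => //; exists 1 => x.
by have /andP[? ?] := h x; rewrite ger0_norm.
Qed.

Variable m : probability T R.

Lemma bounded_mfun_integrable g D : bounded_mfun g -> measurable D ->
  m.-integrable D (EFin \o g).
Proof.
move=> [mg [M gM]] mD; apply: measurable_bounded_integrable => //.
- by rewrite (le_lt_trans (probability_le1 _ mD))// ltry.
- exact: measurable_funTS.
- exists `|M|; split => // x xM y _ /=; apply: le_trans (gM y) _.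
  exact: le_trans (ler_norm M) (ltW xM).
Qed.

Lemma RintD g h D : bounded_mfun g -> bounded_mfun h -> measurable D ->
  \int[m]_(x in D) (g x + h x) = \int[m]_(x in D) g x + \int[m]_(x in D) h x.
Proof. by move=> bg bh mD; rewrite RintegralD//; exact: bounded_mfun_integrable. Qed.

Lemma RintB g h D : bounded_mfun g -> bounded_mfun h -> measurable D ->
  \int[m]_(x in D) (g x - h x) = \int[m]_(x in D) g x - \int[m]_(x in D) h x.
Proof. by move=> bg bh mD; rewrite RintegralB//; exact: bounded_mfun_integrable. Qed.

Lemma RintZ c g D : bounded_mfun g -> measurable D ->
  \int[m]_(x in D) (c * g x) = c * \int[m]_(x in D) g x.
Proof. by move=> bg mD; rewrite RintegralZl//; exact: bounded_mfun_integrable. Qed.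

Lemma le_Rint g h D : bounded_mfun g -> bounded_mfun h -> measurable D ->
  (forall x, D x -> g x <= h x) ->
  \int[m]_(x in D) g x <= \int[m]_(x in D) h x.
Proof. by move=> bg bh mD gh; apply: le_Rintegral => //; exact: bounded_mfun_integrable. Qed.

Lemma Rint_cst c D : measurable D -> \int[m]_(x in D) c = c * fine (m D).
Proof. by move=> mD; rewrite Rintegral_cst. Qed.

Lemma RintU g A B : bounded_mfun g -> measurable A -> measurable B -> A `&` B = set0 ->
  \int[m]_(x in A `|` B) g x = \int[m]_(x in A) g x + \int[m]_(x in B) g x.
Proof.
move=> bg mA mB AB; rewrite Rintegral_setU//; last exact/disj_set2P.
by apply: bounded_mfun_integrable => //; exact: measurableU.
Qed.

Lemma EFin_Rint g D : bounded_mfun g -> measurable D ->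
  (\int[m]_(x in D) (g x)%:E)%E = (\int[m]_(x in D) g x)%:E.
Proof.
move=> bg mD; rewrite fineK//; apply: integrable_fin_num => //.
exact: bounded_mfun_integrable.
Qed.

End bounded_measurable.

Section filtration.
Context {R : realType}.
Variable mu : probability X1 R.
Local Notation X := X1.
Implicit Types (x y : X) (g h : X -> R) (k j : nat).

Definition icyl k x : set X := cyl (iota 0 k.+1) x.

Lemma icylP k x y : icyl k x y <-> forall i, (i <= k)%N -> y i = x i.
Proof.
by split => h i; [move=> ik; apply: h|rewrite mem_iota => /andP[_ ?]; exact: h];
  rewrite ?mem_iota//.
Qed.

Lemma measurable_icyl k x : measurable (icyl k x).
Proof. exact: measurable_cyl. Qed.

Hypothesis mu_pos : forall k x, (0 < mu (icyl k x))%E.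

Lemma fine_icyl_gt0 k x : 0 < fine (mu (icyl k x)).
Proof.
rewrite fine_gt0// mu_pos /= (le_lt_trans (probability_le1 _ (measurable_icyl k x)))//.
exact: ltry.
Qed.

(** The conditional expectation given the coordinates [0, ..., k]. As all cylinders have positive
    measure, this version is defined at every point and is exactly a function of the window. *)
Definition cyl_avg k g x : R := (\int[mu]_(y in icyl k x) g y) / fine (mu (icyl k x)).

Lemma cyl_avg_icyl k g x y : icyl k x y -> cyl_avg k g x = cyl_avg k g y.
Proof. by move=> xy; rewrite /cyl_avg /icyl (cyl_eq xy). Qed.

Lemma icyl_le j k x : (j <= k)%N -> icyl k x `<=` icyl j x.
Proof. by move=> jk; apply: cyl_sub => i; rewrite !mem_iota; lia. Qed.

Lemma cyl_avgD k g h x : bounded_mfun g -> bounded_mfun h ->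
  cyl_avg k (fun x => g x + h x) x = cyl_avg k g x + cyl_avg k h x.
Proof. by move=> bg bh; rewrite /cyl_avg RintD ?mulrDl//; exact: measurable_icyl. Qed.

Lemma cyl_avgB k g h x : bounded_mfun g -> bounded_mfun h ->
  cyl_avg k (fun x => g x - h x) x = cyl_avg k g x - cyl_avg k h x.
Proof. by move=> bg bh; rewrite /cyl_avg RintB ?mulrBl//; exact: measurable_icyl. Qed.

Lemma cyl_avgZ k c g x : bounded_mfun g -> cyl_avg k (fun x => c * g x) x = c * cyl_avg k g x.
Proof. by move=> bg; rewrite /cyl_avg RintZ ?mulrA//; exact: measurable_icyl. Qed.

Lemma cyl_avg_cst k c x : cyl_avg k (fun=> c) x = c.
Proof.
rewrite /cyl_avg Rint_cst ?mulfK// ?gt_eqF ?fine_icyl_gt0//; exact: measurable_icyl.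
Qed.

Lemma cyl_avg_le k g h x : bounded_mfun g -> bounded_mfun h -> (forall y, g y <= h y) ->
  cyl_avg k g x <= cyl_avg k h x.
Proof.
move=> bg bh gh; rewrite /cyl_avg ler_pM2r ?invr_gt0 ?fine_icyl_gt0//.
by apply: le_Rint => //; exact: measurable_icyl.
Qed.

Lemma cyl_avg_bound k g x M : bounded_mfun g -> (forall y, `|g y| <= M) -> `|cyl_avg k g x| <= M.
Proof.
move=> bg gM; rewrite ler_norml; apply/andP; split.
  rewrite -(cyl_avg_cst k (- M) x); apply: cyl_avg_le => //; first exact: bounded_mfun_cst.
  by move=> y; have := gM y; rewrite ler_norml => /andP[].
rewrite -(cyl_avg_cst k M x); apply: cyl_avg_le => //; first exact: bounded_mfun_cst.
by move=> y; have := gM y; rewrite ler_norml => /andP[].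
Qed.

Lemma cyl_avg_dist k g h x M : bounded_mfun g -> bounded_mfun h ->
  (forall y, `|g y - h y| <= M) -> `|cyl_avg k g x - cyl_avg k h x| <= M.
Proof. by move=> bg bh gh; rewrite -cyl_avgB//; apply: cyl_avg_bound => //; exact: bounded_mfunB. Qed.

Lemma bounded_mfun_cyl_avg k g : bounded_mfun g -> bounded_mfun (cyl_avg k g).
Proof.
move=> bg; split.
  by apply: (@measurable_fun_window _ (iota 0 k.+1)) => x y /cyl_avg_icyl.
by have [_ [M gM]] := bg; exists M => x; exact: cyl_avg_bound.
Qed.

Lemma cyl_avg_window k g x : (forall y, icyl k x y -> g y = g x) -> cyl_avg k g x = g x.
Proof.
move=> h; rewrite -[RHS](cyl_avg_cst k (g x) x) /cyl_avg; congr (_ / _).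
by apply: eq_Rintegral => y; rewrite inE; exact: h.
Qed.

Lemma Rint_icyl_eq k g h : bounded_mfun g -> bounded_mfun h ->
  (forall x, \int[mu]_(y in icyl k x) g y = \int[mu]_(y in icyl k x) h y) ->
  \int[mu]_x g x = \int[mu]_x h x.
Proof.
move=> bg bh gh.
pose u (A : set X) := \int[mu]_(y in A) g y.
pose v (A : set X) := \int[mu]_(y in A) h y.
rewrite -(cyl_nil (fun=> 0 : 'I_2)).
apply: (@cyl_additive_eq nat R +%R u v (iota 0 k.+1) [::]) => [A B|A B|x].
- by move=> *; rewrite /u RintU.
- by move=> *; rewrite /v RintU.
- by rewrite cats0; exact: gh.
Qed.

Lemma Rint_mul_cyl_avg k g h : bounded_mfun g -> bounded_mfun h ->
  (forall x y, icyl k x y -> h x = h y) ->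
  \int[mu]_x (h x * cyl_avg k g x) = \int[mu]_x (h x * g x).
Proof.
move=> bg bh hw; apply: (@Rint_icyl_eq k).
- by apply: bounded_mfunM => //; exact: bounded_mfun_cyl_avg.
- exact: bounded_mfunM.
move=> x; have mC := measurable_icyl k x.
rewrite (_ : Rintegral _ _ _ = \int[mu]_(y in icyl k x) (h x * cyl_avg k g x)); last first.
  by apply: eq_Rintegral => y; rewrite inE => xy; rewrite -(hw _ _ xy) -(cyl_avg_icyl _ xy).
rewrite Rint_cst// -mulrA /cyl_avg mulfVK ?gt_eqF ?fine_icyl_gt0// -RintZ//.
by apply: eq_Rintegral => y; rewrite inE => xy; rewrite (hw _ _ xy).
Qed.

(** Orthogonality of martingale increments: the mixed term is evaluated by conditioning on the
    smaller window. *)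
Lemma Rint_cyl_avg_sub j k g : bounded_mfun g -> (j <= k)%N ->
  \int[mu]_x ((cyl_avg k g x - cyl_avg j g x) ^+ 2) =
  \int[mu]_x (cyl_avg k g x ^+ 2) - \int[mu]_x (cyl_avg j g x ^+ 2).
Proof.
move=> bg jk; have bj := bounded_mfun_cyl_avg j bg; have bk := bounded_mfun_cyl_avg k bg.
have e1 : \int[mu]_x (cyl_avg j g x * cyl_avg k g x) = \int[mu]_x (cyl_avg j g x ^+ 2).
  rewrite Rint_mul_cyl_avg//; last first.
    by move=> x y xy; apply: cyl_avg_icyl; exact: icyl_le xy.
  by rewrite -(@Rint_mul_cyl_avg j)// => x y; exact: cyl_avg_icyl.
transitivity (\int[mu]_x ((cyl_avg k g x ^+ 2 + cyl_avg j g x ^+ 2) - 2 * (cyl_avg j g x * cyl_avg k g x))).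
  by apply: eq_Rintegral => x _; ring.
have b1 := bounded_mfunX2 bk; have b2 := bounded_mfunX2 bj; have b3 := bounded_mfunM bj bk.
rewrite RintB// ?RintD// ?RintZ//; last 2 first.
- exact: bounded_mfunD.
- by apply: bounded_mfunM => //; exact: bounded_mfun_cst.
by rewrite e1; ring.
Qed.

Lemma Rint_cyl_avg_mono j k g : bounded_mfun g -> (j <= k)%N ->
  \int[mu]_x (cyl_avg j g x ^+ 2) <= \int[mu]_x (cyl_avg k g x ^+ 2).
Proof.
move=> bg jk; rewrite -subr_ge0 -Rint_cyl_avg_sub//; apply: Rintegral_ge0 => x _.
exact: sqr_ge0.
Qed.

(* Doob's maximal inequality: decompose according to the first cylinder on
   which the average exceeds [e]. *)
Lemma cyl_avg_maximal (U : set X) (e : R) : measurable U -> 0 < e ->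
  (e%:E * mu [set x | exists k, (e < cyl_avg k \1_U x)%R] <= mu U)%E.
Proof.
move=> mU e0.
have bU : bounded_mfun (\1_U : X -> R).
  apply: bounded_mfun01; first exact: measurable_indic.
  by move=> x; rewrite indicE; case: (_ \in _); rewrite ?lexx ler01.
pose S k := [set x | e < cyl_avg k \1_U x /\ forall i, (i < k)%N -> cyl_avg i \1_U x <= e].
have wS k x y : icyl k x y -> S k x -> S k y.
  move=> xy [h1 h2]; split; first by rewrite -(cyl_avg_icyl _ xy).
  move=> i ik; rewrite -(cyl_avg_icyl _ (icyl_le (ltnW ik) xy)); exact: h2.
have mS k : measurable (S k) by apply: (@measurable_window _ (iota 0 k.+1)) => x y; exact: wS.
have -> : [set x | exists k, e < cyl_avg k \1_U x] = \bigcup_k S k.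
  apply/seteqP; split => x; last by move=> [k _ [? _]]; exists k.
  move=> ex; have ex' : exists k, e < cyl_avg k \1_U x by [].
  exists (ex_minn ex') => //; case: ex_minnP => k hk hmin; split => // i ik.
  by rewrite leNgt; apply/negP => /hmin; rewrite leqNgt ik.
have tS : trivIset setT S.
  apply: ltn_trivIset => n k nk; apply/seteqP; split => // x [[h1 _] [_ h2]].
  by have := h2 _ nk; rewrite leNgt h1.
have key k : (e%:E * mu (S k) <= mu (S k `&` U))%E.
  have bS : bounded_mfun (\1_(S k) : X -> R).
    apply: bounded_mfun01; first exact: measurable_indic.
    by move=> x; rewrite indicE; case: (_ \in _); rewrite ?lexx ler01.
  rewrite -(@fineK _ (mu (S k))) ?fin_num_measure//.
  rewrite -(@fineK _ (mu (S k `&` U))) ?fin_num_measure//; last exact: measurableI.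
  rewrite -EFinM lee_fin.
  have I1 (A : set X) : measurable A -> fine (mu A) = \int[mu]_x \1_A x.
    by move=> mA; rewrite /Rintegral integral_indic// setIT.
  rewrite !I1//; last exact: measurableI.
  rewrite indicI -(@Rint_mul_cyl_avg k)//; last first.
    move=> x y xy; rewrite !indicE; congr (nat_of_bool _)%:R.
    by apply/idP/idP; rewrite !inE; apply: wS => //; exact: cyl_sym.
  rewrite -RintZ//; apply: le_Rint => //.
  - by apply: bounded_mfunM => //; exact: bounded_mfun_cst.
  - by apply: bounded_mfunM => //; exact: bounded_mfun_cyl_avg.
  - move=> x _; rewrite indicE; case: (boolP (x \in S k)) => [|_]; last by rewrite mulr0 mul0r.
    by rewrite inE mul1r mulr1 => -[/ltW].
have mUS : measurable (\bigcup_k S k) by exact: bigcup_measurable.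
have sums (F : nat -> set X) : (forall k, measurable (F k)) -> trivIset setT F ->
    mu (\bigcup_k F k) = (\sum_(k <oo) mu (F k))%E.
  by move=> mF tF; rewrite measure_bigcup//; apply: eq_eseriesl => k; rewrite in_setT.
rewrite sums// -nneseriesZl//.
apply: (@le_trans _ _ (\sum_(k <oo) mu (S k `&` U))%E).
  by apply: lee_nneseries => // k _; rewrite mule_ge0// lee_fin ltW.
rewrite -(sums (fun k => S k `&` U)).
- by apply: le_measure; rewrite ?inE//; [apply: bigcup_measurable => k _; exact: measurableI|move=> x [k _ []]].
- by move=> k; exact: measurableI.
- exact: trivIset_setIr.
Qed.

End filtration.

(** * Integration against image measures with densities *)

Section change_of_variables.
Context {d1 d2 : measure_display} {T1 : measurableType d1} {T2 : measurableType d2} {R : realType}.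
Import HBNNSimple.

(** Image measures ([h = 1]) and densities ([phi = id]) are special cases, and both occur below. All
    integrands are nonnegative, so simple functions and monotone convergence suffice. *)
Lemma integral_density (m1 : {measure set T1 -> \bar R}) (m2 : {measure set T2 -> \bar R})
    (phi : T2 -> T1) (h : T2 -> R) (f : T1 -> \bar R) :
  measurable_fun setT phi -> measurable_fun setT h -> (forall x, 0 <= h x) ->
  (forall A, measurable A ->
     m1 A = \int[m2]_(x in phi @^-1` A) (h x)%:E)%E ->
  measurable_fun setT f -> (forall x, 0 <= f x)%E ->
  (\int[m1]_x f x = \int[m2]_x (f (phi x) * (h x)%:E))%E.
Proof.
move=> mphi mh h0 m12 mf f0.
have mE : measurable_fun setT (EFin \o h) by exact/measurable_EFinP.
have mphiA A : measurable A -> measurable (phi @^-1` A).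
  by move=> mA; rewrite -[X in measurable X]setTI; exact: mphi.
pose f_ := nnsfun_approx measurableT mf.
have simple (s : {nnsfun T1 >-> R}) :
    (\int[m1]_x (s x)%:E = \int[m2]_x ((s (phi x))%:E * (h x)%:E))%E.
  have mI r : measurable (s @^-1` [set r]) by exact: measurable_funPTI.
  transitivity (\sum_(r \in range s) \int[m1]_x (r * \1_(s @^-1` [set r]) x)%:E)%E.
    rewrite -ge0_integral_fsum//; last 2 first.
    - by move=> r; apply/measurable_EFinP; exact: measurable_funM.
    - by move=> r x _; exact: nnfun_muleindic_ge0.
    by apply: eq_integral => x _; rewrite fimfunE -fsumEFin.
  transitivity (\sum_(r \in range s)
      \int[m2]_x ((r * \1_(s @^-1` [set r]) (phi x))%:E * (h x)%:E))%E; last first.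
    rewrite -ge0_integral_fsum//; last 2 first.
    - move=> r; apply: emeasurable_funM => //; apply/measurable_EFinP.
      by apply: measurable_funM => //; apply: measurableT_comp => //; exact: measurable_indic.
    - by move=> r x _; rewrite mule_ge0 ?lee_fin//; exact: nnfun_muleindic_ge0.
    apply: eq_integral => x _; rewrite -ge0_mule_fsuml; last first.
      by move=> r; exact: nnfun_muleindic_ge0.
    by rewrite fsumEFin // -(fimfunE _ (phi x)).
  apply: eq_fsbigr => r; rewrite inE => -[t _ sr].
  have r0 : (0 <= r)%R by rewrite -sr.
  under eq_integral do rewrite EFinM.
  under [RHS]eq_integral do rewrite EFinM -muleA.
  rewrite [LHS]ge0_integralZl//; last first.
    by apply/measurable_EFinP; exact: measurable_indic.
  rewrite [RHS]ge0_integralZl//; last 2 first.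
  - apply: emeasurable_funM => //; apply/measurable_EFinP.
    by apply: measurableT_comp => //; exact: measurable_indic.
  - by move=> x _; rewrite mule_ge0 ?lee_fin.
  congr (_ * _)%E; rewrite integral_indic// setIT m12//.
  rewrite integral_mkcond; apply: eq_integral => x _.
  rewrite patchE indicE /=; case: (boolP (_ \in _)) => hx.
    by rewrite (_ : phi x \in _) ?mul1e//; move: hx; rewrite !inE.
  by rewrite (_ : phi x \in _ = false) ?mul0e//; apply: contraNF hx; rewrite !inE.
transitivity (limn (fun n => \int[m1]_x (f_ n x)%:E))%E.
  rewrite -monotone_convergence//.
  - by apply: eq_integral => x _; apply/esym/cvg_lim => //; exact: cvg_nnsfun_approx.
  - by move=> n; apply/measurable_EFinP.
  - by move=> n x _; rewrite lee_fin.
  - by move=> x _ a b ab; rewrite lee_fin; exact/lefP/nd_nnsfun_approx.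
under eq_fun do rewrite simple.
rewrite -monotone_convergence//.
- apply: eq_integral => x _; apply/cvg_lim => //.
  by apply: cvgeZr => //; exact: cvg_nnsfun_approx.
- move=> n; apply: emeasurable_funM => //; apply/measurable_EFinP.
  exact: measurableT_comp.
- by move=> n x _; rewrite mule_ge0 ?lee_fin.
- move=> x _ a b ab; rewrite lee_wpmul2r ?lee_fin//.
  exact/lefP/nd_nnsfun_approx.
Qed.

End change_of_variables.

Lemma cvg_dist_leP (R : realType) (u : nat -> R) (l : R) :
  u @ \oo --> l <->
  forall e : R, 0 < e -> exists K, forall k, (K <= k)%N -> `|u k - l| <= e.
Proof.
split => [/cvgrPdist_le h e e0|h].
  by have [K _ hK] := h _ e0; exists K => k Kk; rewrite distrC; exact: hK.
apply/cvgrPdist_le => e e0; have [K hK] := h _ e0; exists K => // k Kk /=.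
by rewrite distrC; exact: hK.
Qed.

(** * Levy's upward convergence theorem *)

Section levy.
Context {R : realType}.
Variable mu : probability X1 R.
Local Notation X := X1.
Implicit Types (x y : X) (g h : X -> R) (k j : nat).
Hypothesis mu_pos : forall k x, (0 < mu (icyl k x))%E.
Local Notation E := (cyl_avg mu).

Lemma bounded_mfun_indic (U : set X) : measurable U -> bounded_mfun (\1_U : X -> R).
Proof.
move=> mU; apply: bounded_mfun01; first exact: measurable_indic.
by move=> x; rewrite indicE; case: (_ \in _); rewrite ?lexx ler01.
Qed.

Definition iset j : set (set X) := [set A | forall x y, icyl j x y -> A x -> A y].

Lemma measurable_iset j A : iset j A -> measurable A.
Proof. by move=> h; apply: (@measurable_window _ (iota 0 j.+1)). Qed.

Lemma icyl_approximation A (e : R) : measurable A -> 0 < e ->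
  exists j B, iset j B /\ (mu ((A `\` B) `|` (B `\` A)) < e%:E)%E.
Proof.
apply: measure_approximation.
- by rewrite (le_lt_trans (probability_le1 mu measurableT))// ltry.
- exact: measurable_iset.
- by move=> j x y _.
- by move=> j B hB x y xy nB By; apply: nB; apply: hB By; exact: cyl_sym.
- by move=> j B C hB hC x y xy [/(hB _ _ xy)|/(hC _ _ xy)]; [left|right].
- by move=> j k B jk hB x y xy; apply: hB; exact: icyl_le xy.
- apply: smallest_sub; first exact: smallest_sigma_algebra.
  move=> _ [i [b ->]]; apply: sub_sigma_algebra; exists i => // x y /icylP xy /= <-.
  exact: xy.
Qed.

(** [U] is replaced by a set [V n] depending on a window, whose averages are eventually equal to its
    indicator. The maximal inequality bounds the set where some average of the error set [D n]
    exceeds [e]. *)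
Lemma levy_set (U : set X) : measurable U ->
  {ae mu, forall x, E k \1_U x @[k --> \oo] --> (\1_U x : R)}.
Proof.
move=> mU.
suff H : forall i : nat, {ae mu, forall x, exists K, forall k, (K <= k)%N ->
    `|E k \1_U x - \1_U x| <= 2 * i.+1%:R^-1}.
  have /ae_foralln := H; apply: filterS => x hx.
  apply/cvgrPdist_le => e e0.
  have [i ie] : exists i, 2 * i.+1%:R^-1 <= e.
    have e2 : 0 < e / 2 by rewrite divr_gt0.
    have [i _ /(_ i (leqnn i)) /= hi] := near_infty_natSinv_lt (PosNum e2).
    by exists i; rewrite -ler_pdivlMl// mulrC; apply: ltW.
  have [K hK] := hx i; exists K => // k /= Kk; rewrite distrC.
  exact: le_trans (hK _ Kk) ie.
move=> i; set e : R := i.+1%:R^-1.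
have e0 : 0 < e by rewrite invr_gt0.
have dn0 n : 0 < e * n.+1%:R^-1 by rewrite mulr_gt0.
(* The error [e / (n + 1)] absorbs the factor [1 / e] of the maximal inequality, so that [M n] has
   measure at most [1 / (n + 1)]. *)
have /choice[j /choice[V hV]] n := icyl_approximation mU (dn0 n).
pose D n := (U `\` V n) `|` (V n `\` U).
have mV n : measurable (V n) by apply: measurable_iset (hV n).1.
have mD n : measurable (D n) by apply: measurableU; exact: measurableD.
pose M n := [set x | exists k, e < E k \1_(D n) x].
have mM n : measurable (M n).
  have -> : M n = \bigcup_k [set x | e < E k \1_(D n) x].
    by apply/seteqP; split => x [k]; [exists k|move=> _ ?; exists k].
  apply: bigcup_measurable => k _; apply: (@measurable_iset k) => x y xy /=.
  by rewrite (cyl_avg_icyl mu _ xy).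
have leM n : (mu (M n `|` D n) <= ((1 + e) * n.+1%:R^-1)%:E)%E.
  have h1 := cyl_avg_maximal mu_pos (mD n) e0.
  have h2 : (mu (D n) <= (e * n.+1%:R^-1)%:E)%E by apply: ltW; exact: (hV n).2.
  apply: (le_trans (measureU2 _ _ _)) => //.
  rewrite mulrDl mul1r EFinD; apply: leeD => //.
  rewrite -(@lee_pmul2l _ e%:E) ?lte_fin// -EFinM.
  exact: le_trans h1 h2.
exists (\bigcap_n (M n `|` D n)).
have mI : measurable (\bigcap_n (M n `|` D n)).
  by apply: bigcap_measurable => // n _; exact: measurableU.
split => //.
  apply/eqP; rewrite eq_le measure_ge0 andbT; apply/lee_addgt0Pr => t t0; rewrite add0e.
  have [n hn] : exists n : nat, (1 + e) * n.+1%:R^-1 <= t.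
    have t2 : 0 < t / (1 + e) by rewrite divr_gt0// ltr_wpDl.
    have [n _ /(_ n (leqnn n)) /= hn] := near_infty_natSinv_lt (PosNum t2).
    by exists n; rewrite mulrC -ler_pdivlMr ?ltr_wpDl//; apply: ltW.
  apply: (@le_trans _ _ (mu (M n `|` D n))); last first.
    by apply: le_trans (leM n) _; rewrite lee_fin.
  by apply: le_measure; rewrite ?inE//; [exact: measurableU|exact: bigcap_inf].
move=> x nx n _; apply: contrapT => /not_orP[nM nD]; apply: nx => /=.
exists (j n) => k jk.
have bU := bounded_mfun_indic mU; have bV := bounded_mfun_indic (mV n); have bD := bounded_mfun_indic (mD n).
have UVD y : `|\1_U y - \1_(V n) y| <= (\1_(D n) y : R).
  rewrite !indicE; have [Uy|Uy] := boolP (y \in U); have [Vy|Vy] := boolP (y \in V n).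
  - by rewrite subrr normr0.
  - rewrite subr0 normr1 (_ : (y \in D n))//; apply/mem_set; left.
    by move: Uy Vy; rewrite inE notin_setE.
  - rewrite sub0r normrN1 (_ : (y \in D n))//; apply/mem_set; right.
    by move: Uy Vy; rewrite inE notin_setE.
  - by rewrite subrr normr0.
have E1 : `|E k \1_U x - E k \1_(V n) x| <= E k \1_(D n) x.
  rewrite -cyl_avgB// ler_norml; apply/andP; split.
    rewrite -mulN1r -cyl_avgZ//; apply: cyl_avg_le => //.
    - by apply: bounded_mfunM => //; exact: bounded_mfun_cst.
    - exact: bounded_mfunB.
    - by move=> y; rewrite mulN1r; have := UVD y; rewrite ler_norml => /andP[].
  apply: cyl_avg_le => //; first exact: bounded_mfunB.
  by move=> y; have := UVD y; rewrite ler_norml => /andP[].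
have E2 : E k \1_(V n) x = \1_(V n) x.
  apply: cyl_avg_window => // y /(icyl_le jk) xy; rewrite !indicE; congr (nat_of_bool _)%:R.
  by apply/idP/idP; rewrite !inE; apply: (hV n).1 => //; exact: cyl_sym.
have E3 : `|\1_(V n) x - \1_U x| = 0 :> R.
  apply/eqP; rewrite eq_le normr_ge0 andbT distrC; apply: le_trans (UVD x) _.
  by rewrite indicE memNset.
rewrite -(subrK (\1_(V n) x) (E k \1_U x)) -addrA; apply: le_trans (ler_normD _ _) _.
rewrite E3 addr0 -E2; apply: le_trans E1 _.
have : E k \1_(D n) x <= e by rewrite leNgt; apply/negP => ?; apply: nM; exists k.
by move=> /le_trans; apply; rewrite ler_peMl ?ltW// ltr1n.
Qed.

(** The sum is the integer part of [y], capped at [N]. *)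
Lemma count_levels (y : R) N : 0 <= y ->
  ((N%:R <= y -> \sum_(i < N) (((i.+1%:R <= y)%R)%:R : R) = N%:R) *
   (y < N%:R -> y - 1 <= \sum_(i < N) (((i.+1%:R <= y)%R)%:R : R) <= y))%type.
Proof.
move=> y0; elim: N => [|N [ih1 ih2]].
  by rewrite big_ord0; split => // ?; lra.
rewrite big_ord_recr /=; split => h.
  rewrite h ih1 ?natr1//; apply: le_trans h; by rewrite ler_nat.
rewrite [N.+1%:R <= y]leNgt h addr0; have [Ny|yN] := leP N%:R y; last exact: ih2.
rewrite ih1// Ny andbT lerBlDr natr1; exact: ltW.
Qed.

Lemma levy g : measurable_fun setT g -> (forall x, 0 <= g x <= 1) ->
  {ae mu, forall x, E k g x @[k --> \oo] --> g x}.
Proof.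
move=> mg g01.
pose U N i : set X := [set x | i.+1%:R <= N.+1%:R * g x].
have mU N i : measurable (U N i).
  rewrite -[X in measurable X]setTI; apply: (@measurable_fun_ler _ _ _ _ (cst _) (fun x => N.+1%:R * g x)) => //.
  by apply: measurable_funM.
have H : {ae mu, forall x, forall N i, E k \1_(U N i) x @[k --> \oo] --> (\1_(U N i) x : R)}.
  by apply: ae_foralln => N; apply: ae_foralln => i; exact: levy_set.
apply: filterS H => x Hx; apply/cvg_dist_leP => e e0.
have [N Ne] : exists N : nat, N.+1%:R^-1 <= e / 3.
  have e3 : 0 < e / 3 by rewrite divr_gt0.
  have [N _ /(_ N (leqnn N)) /= hN] := near_infty_natSinv_lt (PosNum e3).
  by exists N; apply: ltW.
(* The mean of the indicators of the level sets is uniformly within [1 / (N + 1)] of [g], and the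
   case of sets applies to each of them. *)
pose s y : R := \sum_(i < N.+1) N.+1%:R^-1 * \1_(U N i) y.
have bU i := bounded_mfun_indic (mU N i).
have bcU i : bounded_mfun (fun y : X => N.+1%:R^-1 * \1_(U N i) y : R).
  exact: (bounded_mfunM (bounded_mfun_cst N.+1%:R^-1) (bU i)).
have bs n : bounded_mfun (fun y : X => \sum_(i < n) N.+1%:R^-1 * \1_(U N i) y : R).
  elim: n => [|n ih]; first by under eq_fun do rewrite big_ord0; exact: bounded_mfun_cst.
  by under eq_fun do rewrite big_ord_recr /=; exact: bounded_mfunD.
have bg := bounded_mfun01 mg g01.
have gs y : `|g y - s y| <= N.+1%:R^-1.
  rewrite /s -mulr_sumr.
  have -> : \sum_(i < N.+1) (\1_(U N i) y : R) =
            \sum_(i < N.+1) (((i.+1%:R <= N.+1%:R * g y)%R)%:R : R).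
    apply: eq_bigr => i _; rewrite indicE; congr (nat_of_bool _)%:R.
    by apply/idP/idP; rewrite inE.
  have /andP[g0 g1] := g01 y; have N0 : 0 < N.+1%:R :> R by [].
  have Ng0 : 0 <= N.+1%:R * g y by rewrite mulr_ge0.
  have [c1 c2] := count_levels N.+1 Ng0.
  rewrite -[X in `|X - _|](mulKf (lt0r_neq0 N0)) -mulrBr normrM gtr0_norm ?invr_gt0//.
  rewrite ler_piMr ?invr_ge0// ler_norml.
  have [h|h] := leP N.+1%:R (N.+1%:R * g y).
    have gy1 : g y = 1 by apply/eqP; rewrite eq_le g1 /= -(ler_pM2l N0) mulr1.
    by rewrite c1// gy1 mulr1 subrr lerN10 ler01.
  by have /andP[? ?] := c2 h; lra.
have Es : E k s x @[k --> \oo] --> s x.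
  suff : forall n, E k (fun y : X => \sum_(i < n) N.+1%:R^-1 * \1_(U N i) y) x @[k --> \oo]
           --> (\sum_(i < n) N.+1%:R^-1 * \1_(U N i) x : R) by apply.
  elim => [|n ih].
    rewrite big_ord0 (_ : (fun k => _) = fun=> 0) ?cvg_cst//; first exact: cvg_cst.
    apply/funext => k; rewrite -[RHS](cyl_avg_cst mu_pos k 0 x); congr cyl_avg.
    by apply/funext => y; rewrite big_ord0.
  rewrite big_ord_recr /= (_ : (fun k => _) = fun k =>
    E k (fun y : X => \sum_(i < n) N.+1%:R^-1 * \1_(U N i) y) x + N.+1%:R^-1 * E k \1_(U N n) x).
    by apply: cvgD => //; apply: cvgMl_tmp; exact: Hx.
  apply/funext => k; rewrite -cyl_avgZ// -cyl_avgD//; congr cyl_avg.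
  by apply/funext => y; rewrite big_ord_recr.
have e3 : 0 < e / 3 by rewrite divr_gt0.
have /cvg_dist_leP/(_ _ e3)[K hK] := Es; exists K => k /hK hk.
have h1 : `|E k s x - E k g x| <= N.+1%:R^-1.
  by apply: cyl_avg_dist => //; [exact: bs|move=> y; rewrite distrC; exact: gs].
have h2 := gs x; move: h1 h2 hk Ne; rewrite !ler_norml.
move: (N.+1%:R^-1) (E k s x) (E k g x) (g x) (s x) => t a b c d.
by move=> /andP[? ?] /andP[? ?] /andP[? ?] ?; apply/andP; split; lra.
Qed.

End levy.

(** * Flips of one coordinate *)

Section flips.
Implicit Types x y : X1.

Definition flip_letter (b : 'I_2) : 'I_2 := if b == 0 then 1 else 0.
Definition flip j x : X1 := upd x j (flip_letter (x j)).

Lemma flip_letterK : involutive flip_letter.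
Proof. by move=> b; case: (ord2P b) => ->. Qed.

Lemma flip_same j x : flip j x j = flip_letter (x j). Proof. exact: upd_same. Qed.
Lemma flip_other j x i : i != j -> flip j x i = x i.
Proof. exact: upd_other. Qed.

Lemma flipK j : involutive (flip j).
Proof.
move=> x; apply/funext => i; have [->|ij] := eqVneq i j.
  by rewrite !flip_same flip_letterK.
by rewrite !flip_other.
Qed.

Lemma measurable_flip j : measurable_fun setT (flip j).
Proof.
apply: measurable_fun_path => i b; have [->|ij] := eqVneq i j.
  rewrite (_ : [set _ | _] = [set t : X1 | t j = flip_letter b]); first exact: measurable_coord.
  apply/seteqP; split => t /=; first by rewrite flip_same => <-; rewrite flip_letterK.
  by rewrite flip_same => ->; rewrite flip_letterK.
rewrite (_ : [set _ | _] = [set t : X1 | t i = b]); first exact: measurable_coord.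
by apply/seteqP; split => t /=; rewrite flip_other.
Qed.

Lemma flip_icyl j k x y : (j <= k)%N -> icyl k x y -> icyl k (flip j x) (flip j y).
Proof.
move=> jk /icylP xy; apply/icylP => i ik; have [->|ij] := eqVneq i j.
  by rewrite !flip_same xy.
by rewrite !flip_other// xy.
Qed.

Lemma flip_preimage j k x : (j <= k)%N -> flip j @^-1` icyl k x = icyl k (flip j x).
Proof.
move=> jk; apply/seteqP; split => y /=; last first.
  by move=> /(flip_icyl jk); rewrite flipK.
by move=> /(flip_icyl jk); rewrite flipK.
Qed.

Lemma flip_small i j x : (i < j)%N -> icyl i (flip j x) x.
Proof.
move=> ij; apply/icylP => k ki; rewrite flip_other// neq_ltn.
by rewrite (leq_ltn_trans ki ij).
Qed.

Context {R : realType}.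
Variables (mu : probability X1 R) (J : nat -> X1 -> R).
Hypotheses (mu_pos : forall k x, (0 < mu (icyl k x))%E)
  (J_gt0 : forall j x, 0 < J j x)
  (J_window : forall j x y, icyl j.+1 x y -> J j x = J j y)
  (J_ratio : forall j k x, (j < k)%N ->
     mu (icyl k (flip j x)) = ((J j x)%:E * mu (icyl k x))%E).

Lemma measurable_J j : measurable_fun setT (J j).
Proof. by apply: (@measurable_fun_window _ (iota 0 j.+2)) => x y /J_window. Qed.

Lemma J_flip j x : J j (flip j x) = (J j x)^-1.
Proof.
have h1 := J_ratio (flip j x) (ltnSn j); have h2 := J_ratio x (ltnSn j).
rewrite flipK h2 muleA -EFinM in h1.
have m0 := fine_icyl_gt0 mu_pos j.+1 x.
have : fine (mu (icyl j.+1 x)) = J j (flip j x) * J j x * fine (mu (icyl j.+1 x)).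
  by rewrite -[in RHS]/(fine (J j (flip j x) * J j x)%:E) -fineM ?fin_num_measure -?h1//;
    exact: measurable_icyl.
rewrite -[X in X = _]mul1r => /(mulIf (lt0r_neq0 m0)) => e.
by apply: (mulIf (lt0r_neq0 (J_gt0 j x))); rewrite -e mulVf// lt0r_neq0.
Qed.

(** [J j] is the density of the flip. The two measures are compared on windows long enough for [J j]
    to be constant there; the Jacobians at a point and at its flip are inverse to each other. *)
Lemma flip_integral (j : nat) (h : X1 -> \bar R) : measurable_fun setT h ->
  (forall x, 0 <= h x)%E ->
  (\int[mu]_x (h (flip j x) * (J j x)%:E) = \int[mu]_x h x)%E.
Proof.
move=> mh h0; have mJ := measurable_J j.
have J0 x : 0 <= J j x by exact: ltW.
pose m1 := image_density mu (measurable_flip j) mJ J0.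
rewrite -(@integral_density _ _ _ _ _ m1)//; last exact: measurable_flip.
apply: eq_measure_integral => A mA _.
have WJ (K : seq nat) : exists k, {subset K <= iota 0 (j + k).+2}.
  exists (\max_(i <- K) i) => i iK; rewrite mem_iota /=.
  have : (i <= \max_(i <- K) i)%N by rewrite (big_rem i)//= leq_maxl.
  by lia.
have e k x : m1 (cyl (iota 0 (j + k).+2) x) = mu (cyl (iota 0 (j + k).+2) x).
  rewrite -/(icyl _ _) /m1 /= /image_density flip_preimage; last by lia.
  have jk : (j < (j + k).+1)%N by lia.
  rewrite (eq_integral (cst (J j (flip j x))%:E)); last first.
    move=> y; rewrite inE => /= xy; congr EFin; apply/esym/J_window.
    by apply: icyl_le xy; lia.
  rewrite integral_cst//; last exact: measurable_icyl.
  transitivity ((J j (flip j x))%:E * mu (icyl (j + k).+1 (flip j x)))%E => //.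
  rewrite (J_ratio x jk) muleA -EFinM J_flip mulVf ?mul1e//.
  exact: lt0r_neq0.
apply: (@path_measure_unique _ _ m1 mu _ _ WJ e) => //.
by rewrite (le_lt_trans (probability_le1 mu measurableT))// ltry.
Qed.

(* Chosen so that [w |u - v|^2 <= u^2 + J v^2], hence flips cost summable energy. *)
Definition flip_weight j x := J j x / (1 + J j x).

Lemma measurable_flip_weight j : measurable_fun setT (flip_weight j).
Proof.
by apply: (@measurable_fun_window _ (iota 0 j.+2)) => x y /J_window; rewrite /flip_weight => ->.
Qed.

Lemma flip_weight_ge0 j x : 0 <= flip_weight j x.
Proof. by rewrite divr_ge0 ?addr_ge0 ?ler01// ltW. Qed.

Lemma variation_step j (u : X1 -> R) : bounded_mfun u ->
  (\int[mu]_x (flip_weight j x * (u x - u (flip j x)) ^+ 2)%:E <=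
   (2 * \int[mu]_x (u x ^+ 2))%:E)%E.
Proof.
move=> bu; have mu2 : measurable_fun setT (fun x => (u x ^+ 2)%:E : \bar R).
  by apply/measurable_EFinP; exact: (bounded_mfunX2 bu).1.
have mfl := measurable_flip j; have mJ := measurable_J j.
have mu2f : measurable_fun setT (fun x => (u (flip j x) ^+ 2)%:E * (J j x)%:E : \bar R)%E.
  apply: emeasurable_funM; last exact/measurable_EFinP.
  exact: (measurableT_comp mu2 mfl).
apply: (@le_trans _ _ (\int[mu]_x ((u x ^+ 2)%:E + (u (flip j x) ^+ 2)%:E * (J j x)%:E))%E).
  apply: ge0_le_integral => //.
  - by move=> x _; rewrite lee_fin mulr_ge0 ?flip_weight_ge0 ?sqr_ge0.
  - apply/measurable_EFinP; apply: measurable_funM; first exact: measurable_flip_weight.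
    apply: measurable_funX; apply: measurable_funB; first exact: bu.1.
    exact: (measurableT_comp bu.1 mfl).
  - exact: emeasurable_funD.
  - move=> x _; rewrite -EFinM -EFinD lee_fin /flip_weight.
    have J0 := J_gt0 j x; move: (J j x) J0 (u x) (u (flip j x)) => c c0 a b.
    rewrite mulrAC ler_pdivrMr ?addr_gt0// -subr_ge0.
    (* The identity [(1 + c)(a^2 + c b^2) - c (a - b)^2 = (a + c b)^2] is what the weight was chosen
       for. *)
    rewrite (_ : _ - _ = (a + c * b) ^+ 2); last by ring.
    exact: sqr_ge0.
rewrite ge0_integralD//; last 2 first.
- by move=> x _; rewrite lee_fin sqr_ge0.
- by move=> x _; rewrite -EFinM lee_fin mulr_ge0 ?sqr_ge0// ltW.
rewrite (@flip_integral j (fun x => (u x ^+ 2)%:E))//; last first.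
  by move=> x; rewrite lee_fin sqr_ge0.
by rewrite EFin_Rint//; [rewrite -EFinD lee_fin mulr2n mulrDl mul1r|exact: bounded_mfunX2].
Qed.

(** The average over the window ending at [i < j] does not see the flip, so it can be subtracted;
    the energy of the remaining increment is a difference of energies. *)
Lemma variation (i j k : nat) g : bounded_mfun g -> (i < j)%N -> (i <= k)%N ->
  (\int[mu]_x (flip_weight j x * (cyl_avg mu k g x - cyl_avg mu k g (flip j x)) ^+ 2)%:E <=
   (2 * (\int[mu]_x (cyl_avg mu k g x ^+ 2) - \int[mu]_x (cyl_avg mu i g x ^+ 2)))%:E)%E.
Proof.
move=> bg ij ik; rewrite -Rint_cyl_avg_sub//.
have bu : bounded_mfun (fun x => cyl_avg mu k g x - cyl_avg mu i g x)
    by apply: bounded_mfunB; exact: bounded_mfun_cyl_avg.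
apply: le_trans (variation_step j bu); apply: ge0_le_integral => //.
- by move=> x _; rewrite lee_fin mulr_ge0 ?flip_weight_ge0 ?sqr_ge0.
- apply/measurable_EFinP; apply: measurable_funM; first exact: measurable_flip_weight.
  have m := (bounded_mfun_cyl_avg mu_pos k bg).1; apply: measurable_funX; apply: measurable_funB => //.
  exact: (measurableT_comp m (measurable_flip j)).
- apply/measurable_EFinP; apply: measurable_funM; first exact: measurable_flip_weight.
  apply: measurable_funX; apply: measurable_funB; first exact: bu.1.
  exact: (measurableT_comp bu.1 (measurable_flip j)).
- move=> x _; rewrite lee_fin (cyl_avg_icyl mu g (flip_small x ij)).
  by rewrite opprB addrA subrK.
Qed.

Definition oscillation (kappa : nat -> nat) g n x : R :=
  flip_weight n.*2.+1 x * (cyl_avg mu (kappa n) g x - cyl_avg mu (kappa n) g (flip n.*2.+1 x)) ^+ 2.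

Lemma measurable_oscillation kappa g n : bounded_mfun g ->
  measurable_fun setT (oscillation kappa g n).
Proof.
move=> bg; apply: measurable_funM; first exact: measurable_flip_weight.
have m := (bounded_mfun_cyl_avg mu_pos (kappa n) bg).1.
apply: measurable_funX; apply: measurable_funB => //.
exact: (measurableT_comp m (measurable_flip _)).
Qed.

Lemma oscillation_ge0 kappa g n x : 0 <= oscillation kappa g n x.
Proof. by rewrite mulr_ge0 ?flip_weight_ge0 ?sqr_ge0. Qed.

(** As [kappa n] stays between [2n+1] and [2n+2], the increments from [2n] to [kappa n] do not
    overlap and their energies telescope. Both extreme choices occur: [2n+2] lets the flip act on
    the average by [cyl_avg_flip], and [2n+1] makes the flipped coordinate the last one of the
    window. *)
Lemma variation_sum kappa g : bounded_mfun g ->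
  (forall n, n.*2.+1 <= kappa n <= n.*2.+2)%N ->
  (\sum_(n <oo) \int[mu]_x (oscillation kappa g n x)%:E < +oo)%E.
Proof.
move=> bg hk; have [_ [M gM]] := bg.
apply: (@le_lt_trans _ _ (2 * M ^+ 2)%:E); last exact: ltry.
apply: lime_le.
  by apply: is_cvg_nneseries => n _ _; apply: integral_ge0 => x _; rewrite lee_fin oscillation_ge0.
apply: nearW => N; rewrite big_mkord.
have b2 k : bounded_mfun (fun x => cyl_avg mu k g x ^+ 2) by apply: bounded_mfunX2; exact: bounded_mfun_cyl_avg.
have H : (\sum_(n < N) \int[mu]_x (oscillation kappa g n x)%:E <=
   (2 * \int[mu]_x (cyl_avg mu N.*2 g x ^+ 2))%:E)%E.
  elim: N => [|N ih].
    by rewrite big_ord0 lee_fin mulr_ge0//; apply: Rintegral_ge0 => x _; exact: sqr_ge0.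
  rewrite big_ord_recr /=.
  have /andP[k1 k2] := hk N.
  have v : (N.*2 < N.*2.+1)%N by [].
  have v' : (N.*2 <= kappa N)%N by lia.
  apply: (le_trans (leeD ih (variation bg v v'))).
  rewrite -EFinD lee_fin -mulrDr ler_pM2l// addrC subrK.
  by apply: Rint_cyl_avg_mono => //; rewrite doubleS.
apply: le_trans H _; rewrite lee_fin ler_pM2l//.
apply: (@le_trans _ _ (\int[mu]_x (fun=> M ^+ 2) x)).
  apply: le_Rint => //; first exact: bounded_mfun_cst.
  move=> x _; rewrite -real_normK ?num_real// ler_pXn2r ?nnegrE//.
    exact: cyl_avg_bound.
  exact: le_trans (gM x).
by rewrite Rint_cst// probability_setT mulr1.
Qed.

Lemma variation_ae kappa g : bounded_mfun g ->
  (forall n, n.*2.+1 <= kappa n <= n.*2.+2)%N ->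
  {ae mu, forall x, (\sum_(n <oo) (oscillation kappa g n x)%:E < +oo)%E}.
Proof.
move=> bg hk; have := variation_sum bg hk.
have mo n : measurable_fun setT (fun x => (oscillation kappa g n x)%:E : \bar R).
  by apply/measurable_EFinP; exact: measurable_oscillation.
have o0 n x : (0 <= (oscillation kappa g n x)%:E)%E by rewrite lee_fin oscillation_ge0.
rewrite -integral_nneseries// => fin.
have S0 x : (0 <= \sum_(n <oo) (oscillation kappa g n x)%:E)%E by exact: nneseries_ge0.
have : mu.-integrable setT (fun x => \sum_(n <oo) (oscillation kappa g n x)%:E)%E.
  apply/integrableP; split; first exact: ge0_emeasurable_sum.
  by under eq_integral do rewrite gee0_abs//.
move=> /integrable_ae; move=> /(_ measurableT); apply: filterS => x /(_ I).
by rewrite ge0_fin_numE.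
Qed.

End flips.

(** * Averages along the fibres *)

Section scaling.
Context {R : realType}.
Local Notation L := (@lebesgue_measure R).
Local Notation RR := (measurableTypeR R).

Definition scale (c : R) (x : RR) : RR := c * x.

Lemma measurable_scale (c : R) : measurable_fun setT (scale c).
Proof. exact: measurable_funM. Qed.

Lemma lebesgue_measure_scale (c : R) (A : set RR) : 0 < c -> measurable A ->
  (L (scale c @^-1` A) = (c^-1)%:E * L A)%E.
Proof.
move=> c0 mA.
pose m1 := image_density L (measurable_scale c) (measurable_cst c) (fun=> ltW c0).
have m1E B : measurable B -> m1 B = (c%:E * L (scale c @^-1` B))%E.
  move=> mB; transitivity (\int[L]_(x in scale c @^-1` B) (cst c%:E) x)%E => //.
  rewrite integral_cst//.
  by rewrite -[X in measurable X]setTI; exact: measurable_scale.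
have -> : L A = m1 A.
  apply: lebesgue_measure_unique => // _ [[a b]] /= _ <-.
  apply: etrans (esym (m1E _ (measurable_itv _))).
  rewrite (_ : _ @^-1` _ = `]a / c, b / c]%classic); last first.
    apply/seteqP; split => x /=; rewrite /scale !in_itv/= ltr_pdivrMr// ler_pdivlMr//;
      by rewrite ![x * c]mulrC.
  rewrite !lebesgue_measure_itv/= !lte_fin ltr_pM2r ?invr_gt0//.
  case: ifPn => _; last by rewrite mule0.
  by rewrite -!EFinB -EFinM -mulrBl mulrC divfK ?lt0r_neq0.
by rewrite m1E// muleA -EFinM mulVf ?mul1e// lt0r_neq0.
Qed.

Variable kappa : {sigma_finite_measure set RR -> \bar R}.
Hypothesis hk : maharam_fibre_measure kappa.

Let neg_null : kappa [set t : R | t <= 0] = 0%E. Proof. by case: hk. Qed.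

Lemma measurable_neg : measurable ([set t : R | t <= 0] : set RR).
Proof.
rewrite (_ : [set _ | _] = `]-oo, 0]%classic); first exact: measurable_itv.
by apply/seteqP; split => x /=; rewrite in_itv.
Qed.

Lemma measurable_pos : measurable ([set t : R | 0 < t] : set RR).
Proof.
rewrite (_ : [set _ | _] = `]0, +oo[%classic); first exact: measurable_itv.
by apply/seteqP; split => x /=; rewrite in_itv /= andbT.
Qed.

Lemma kappa_pos_part (A : set RR) : measurable A ->
  kappa A = kappa (A `&` [set t : R | 0 < t]).
Proof.
move=> mA; rewrite -[in LHS](setUIDK A [set t : R | 0 < t]) measureU//; last 3 first.
- exact: measurableI measurable_pos.
- exact: measurableD measurable_pos.
- by apply/seteqP; split => // x [[_ /= ?] [_ /= ?]].
rewrite [X in (_ + X)%E](_ : _ = 0%E) ?adde0//.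
apply/eqP; rewrite eq_le measure_ge0 andbT -[X in (_ <= X)%E]neg_null.
apply: le_measure; rewrite ?inE//; first exact: measurableD measurable_pos.
  exact: measurable_neg.
by move=> x [_ /= /negP]; rewrite -leNgt.
Qed.

Lemma ae_kappa_pos : {ae kappa, forall t, 0 < t}.
Proof.
exists [set t : R | t <= 0]; split => //; first exact: measurable_neg.
by move=> t /= /negP; rewrite -leNgt.
Qed.

Lemma kappa_scale (c : R) (A : set RR) : 0 < c -> measurable A ->
  kappa (scale c @^-1` A) = (c%:E * kappa A)%E.
Proof.
move=> c0 mA; have [_ _ sc] := hk.
have mp : measurable (scale c @^-1` A : set RR).
  by rewrite -[X in measurable X]setTI; exact: measurable_scale.
rewrite kappa_pos_part// [in RHS]kappa_pos_part//.
have ci : 0 < c^-1 by rewrite invr_gt0.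
have mAp : measurable (A `&` [set t : R | 0 < t]) by exact: measurableI measurable_pos.
have := sc c^-1 _ ci mAp (@subIsetr _ _ _).
rewrite invrK => <-; congr (kappa _); apply/seteqP; split => x /=; rewrite /scale.
  move=> [Ax x0]; exists (c * x); first by split => //=; rewrite mulr_gt0.
  by rewrite mulKf ?lt0r_neq0.
by move=> [y [Ay /= y0] <-]; rewrite mulVKf ?lt0r_neq0// mulr_gt0.
Qed.

Lemma kappa_integral_scale (c : R) (f : RR -> \bar R) : 0 < c ->
  measurable_fun setT f -> (forall x, 0 <= f x)%E ->
  (\int[kappa]_x f (scale c x) = c%:E * \int[kappa]_x f x)%E.
Proof.
move=> c0 mf f0.
rewrite (@integral_density _ _ _ _ _ kappa kappa (scale c) (cst c^-1) f)//.
- rewrite -ge0_integralZl//; last 3 first.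
  + by apply: emeasurable_funM => //; apply: measurableT_comp => //; exact: measurable_scale.
  + by move=> x _; rewrite mule_ge0// lee_fin invr_ge0 ltW.
  + by rewrite lee_fin ltW.
  apply: eq_integral => x _; rewrite muleCA -EFinM divff ?mule1// lt0r_neq0//.
- exact: measurable_scale.
- by move=> x; rewrite invr_ge0 ltW.
- move=> A mA; have mp : measurable (scale c @^-1` A : set RR).
    by rewrite -[X in measurable X]setTI; exact: measurable_scale.
  apply/esym; transitivity ((c^-1)%:E * kappa (scale c @^-1` A))%E; first exact: (integral_cst kappa mp (c^-1)%:E).
  by rewrite kappa_scale// muleA -EFinM mulVf ?mul1e// lt0r_neq0.
Qed.

(** Sigma-finiteness cuts the positive half-line into countably many bounded pieces of finite
    [kappa]-measure, and they cannot all be Lebesgue null. This is the starting point for the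
    finiteness of [kappa] on rays. *)
Lemma lebesgue_pos_part_neq0 : exists (B : set RR) (b : R),
  [/\ 0 < b, measurable B, B `<=` `]0, b]%classic, (kappa B < +oo)%E & (0 < L B)%E].
Proof.
have [F FT /all_and2[mF Foo]] := sigma_finiteT kappa.
pose B i n := F i `&` `]0, n.+1%:R]%classic : set RR.
have mB i n : measurable (B i n) by apply: measurableI => //; exact: measurable_itv.
have [[i [n h]]|h] := pselect (exists i n, (0 < L (B i n))%E).
  exists (B i n), n.+1%:R; split => //; first exact: subIsetr.
  apply: le_lt_trans (Foo i); apply: le_measure; rewrite ?inE//; exact: subIsetl.
have B0 i n : L (B i n) = 0%E.
  apply/eqP; rewrite eq_le measure_ge0 andbT leNgt; apply/negP => ?.
  by apply: h; exists i, n.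
have U0 : L (\bigcup_i \bigcup_n B i n) = 0%E.
  apply/negligibleP.
    by apply: bigcup_measurable => i _; exact: bigcup_measurable.
  apply: negligible_bigcup => i; apply: negligible_bigcup => n.
  by apply/negligibleP; [exact: mB|exact: B0].
suff : (L (\bigcup_i \bigcup_n B i n) >= 1%E)%E by rewrite U0 lee_fin ler10.
have -> : 1%E = L `]0, 1]%classic.
  by rewrite lebesgue_measure_itv /= lte_fin ltr01 oppr0 adde0.
apply: le_measure; rewrite ?inE; first exact: measurable_itv.
  by apply: bigcup_measurable => i _; exact: bigcup_measurable.
move=> x x01; have : (\bigcup_i F i) x by rewrite -FT.
by move=> [i _ Fix]; exists i => //; exists 0%N.
Qed.

(** By scaling, one ray suffices. Tonelli is applied to [s^-1 1_B(s t)] for [s] in []0, 1]]: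
    integrating over [t] first gives [kappa B], since scaling by [s] cancels [s^-1]; integrating
    over [s] first gives at least [L(B) / b] for every [t > b], because [s t <= b] forces
    [s^-1 >= t / b]. *)
Lemma kappa_ray_lty (t : R) : 0 < t -> (kappa `]t, +oo[%classic < +oo)%E.
Proof.
move=> t0.
suff [b b0 fb] : exists2 b : R, 0 < b & (kappa `]b, +oo[%classic < +oo)%E.
  have c0 : 0 < t / b by rewrite divr_gt0.
  have := kappa_scale c0 (measurable_itv `]t, +oo[).
  rewrite (_ : _ @^-1` _ = `]b, +oo[%classic); last first.
    apply/seteqP; split => x /=; rewrite /scale !in_itv /= !andbT.
      by rewrite mulrAC ltr_pdivlMr// ltr_pM2l.
    by rewrite mulrAC ltr_pdivlMr// ltr_pM2l.
  move=> e; rewrite ltey; apply/eqP => ky.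
  by move: fb; rewrite e ky gt0_muley ?lte_fin// ltxx.
have [B [b [b0 mB Bb Bfin LB0]]] := lebesgue_pos_part_neq0.
exists b => //.
have mst : measurable_fun setT (fun w : RR * RR => w.1 * w.2 : RR).
  by apply: measurable_funM; [exact: measurable_fst|exact: measurable_snd].
pose f (w : RR * RR) : \bar R := (((w.1 `^ (-1)) * \1_(`]0, 1]%classic : set RR) w.1) * \1_B (w.1 * w.2))%:E.
have mf : measurable_fun setT f.
  apply/measurable_EFinP; apply: measurable_funM; last first.
    by apply: measurableT_comp mst; exact: measurable_indic.
  apply: measurable_funM.
    by apply: (measurableT_comp (measurable_powR _)); exact: measurable_fst.
  by apply: measurableT_comp measurable_fst; apply: measurable_indic; exact: measurable_itv.
have f0 w : (0 <= f w)%E.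
  by rewrite lee_fin !mulr_ge0 ?powR_ge0// indicE ler0n.
have := fubini_tonelli (m1 := L) (m2 := kappa) f mf f0.
have -> : (\int[L]_x \int[kappa]_y f (x, y) = kappa B)%E.
  transitivity (\int[L]_x ((kappa B) * (\1_(`]0, 1]%classic : set RR) x)%:E))%E.
    apply: eq_integral => s _; rewrite /f /= indicE.
    have [|s01] := boolP (s \in _); last first.
      by rewrite mule0 mulr0; under eq_integral do rewrite mul0r; rewrite integral0.
    rewrite inE /= in_itv /= => /andP[s0 s1]; rewrite mulr1 mule1 powR_inv1 ?ltW//.
    under eq_integral do rewrite EFinM.
    have m1 : measurable_fun setT (fun x : RR => (\1_B (s * x) : R)%:E : \bar R).
      apply/measurable_EFinP; apply: measurableT_comp; first exact: measurable_indic.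
      exact: measurable_scale.
    have s'0 : (0 <= (s^-1)%:E)%E by rewrite lee_fin invr_ge0 ltW.
    rewrite ge0_integralZl//.
    rewrite (@kappa_integral_scale s (fun x => (\1_B x)%:E))//; last first.
      by apply/measurable_EFinP; exact: measurable_indic.
    by rewrite muleA -EFinM mulVf ?lt0r_neq0// mul1e integral_indic// setIT.
  have m01 : measurable_fun setT (fun x : RR => (\1_(`]0, 1]%classic : set RR) x : R)%:E : \bar R).
    by apply/measurable_EFinP; apply: measurable_indic; exact: measurable_itv.
  rewrite ge0_integralZl//.
  rewrite integral_indic//.
  transitivity (kappa B * L `]0%R, 1%R]%classic)%E; first by rewrite setIT.
  by rewrite lebesgue_measure_itv /= lte_fin ltr01 oppr0 adde0 mule1.
move=> e.
have LBfin : (L B < +oo)%E.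
  apply: (@le_lt_trans _ _ (L `]0, b]%classic)).
    by apply: le_measure; rewrite ?inE//; exact: measurable_itv.
  by rewrite lebesgue_measure_itv /= lte_fin b0 ltry.
have key : ((fine (L B) / b)%:E * kappa `]b, +oo[%classic <= kappa B)%E.
  have mb : measurable (`]b, +oo[%classic : set RR) by exact: measurable_itv.
  rewrite e; have <- := integral_cst kappa mb (fine (L B) / b)%:E.
  rewrite integral_mkcond; apply: ge0_le_integral => //.
  - move=> x _; rewrite patchE; case: ifP => // _.
    by rewrite lee_fin divr_ge0 ?fine_ge0// ltW.
  - by rewrite -measurable_restrictT.
  - exact: measurable_fun_fubini_tonelli_G.
  - move=> t' _; rewrite patchE; case: ifPn => [|_]; last exact: integral_ge0.
    rewrite inE /= in_itv /= andbT => bt; have tp : 0 < t' := lt_trans b0 bt.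
    have -> : (fine (L B) / b)%:E = ((t' / b)%:E * ((t'^-1)%:E * L B))%E.
      rewrite muleA -EFinM -[in RHS](@fineK _ (L B)) ?ge0_fin_numE// -EFinM.
      by congr EFin; field; rewrite !lt0r_neq0.
    rewrite -(lebesgue_measure_scale tp mB) -[X in L X]setIT -integral_indic//; last first.
      by rewrite -[X in measurable X]setTI; exact: measurable_scale.
    have ms : measurable_fun setT (fun x : RR => (\1_(scale t' @^-1` B) x : R)%:E : \bar R).
      apply/measurable_EFinP; apply: measurable_indic.
      by rewrite -[X in measurable X]setTI; exact: measurable_scale.
    have tb0 : (0 <= (t' / b)%:E)%E by rewrite lee_fin divr_ge0 ?ltW.
    rewrite -ge0_integralZl//.
    apply: ge0_le_integral => //.
    - by move=> x _; rewrite mule_ge0// lee_fin indicE ler0n.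
    - exact: emeasurable_funM.
    - exact: measurable_fun_pair1.
    move=> s _; rewrite /f /= -EFinM lee_fin [in leLHS]indicE.
    have [|_] := boolP (s \in _); last by rewrite mulr0 !mulr_ge0 ?powR_ge0// indicE ler0n.
    rewrite inE /= => Bs; have := Bb _ Bs; rewrite /= in_itv /= => /andP[s0 sb].
    have sp : 0 < s by rewrite pmulr_rgt0 in s0.
    have s1 : s <= 1.
      rewrite -(ler_pM2l tp) mulr1; apply: le_trans sb _; exact: ltW.
    rewrite !indicE (mem_set (_ : `]0, 1]%classic s)); last by rewrite /= in_itv /= sp.
    rewrite [s * t']mulrC (mem_set (_ : B (t' * s)))// !mulr1 powR_inv1; last exact: ltW.
    by rewrite ler_pdivrMr// ler_pdivlMl// mulrC.
have c0 : 0 < fine (L B) / b by rewrite divr_gt0// fine_gt0// LB0.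
rewrite ltey; apply/eqP => ky; move: key; rewrite ky gt0_muley ?lte_fin// leye_eq => /eqP Boo.
by move: Bfin; rewrite Boo ltxx.
Qed.

Definition kappa1 : R := fine (kappa `]1, +oo[%classic).

Lemma kappa_ray (t : R) : 0 < t -> kappa `]t, +oo[%classic = (kappa1 / t)%:E.
Proof.
move=> t0; have := kappa_scale t0 (measurable_itv `]t, +oo[).
rewrite (_ : _ @^-1` _ = `]1, +oo[%classic); last first.
  apply/seteqP; split => x /=; rewrite /scale !in_itv /= !andbT.
    by rewrite -[X in X < _](mulr1 t) ltr_pM2l.
  by rewrite -[X in _ -> X < _](mulr1 t) ltr_pM2l.
have f : kappa `]t, +oo[%classic \is a fin_num by rewrite ge0_fin_numE// kappa_ray_lty.
by move=> e; rewrite /kappa1 e fineM// mulrAC divff ?lt0r_neq0// mul1r fineK.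
Qed.

Lemma kappa1_gt0 : 0 < kappa1.
Proof.
rewrite /kappa1 fine_gt0// kappa_ray_lty// andbT lt0e measure_ge0 andbT.
apply/eqP => k0; have [_ hn _] := hk.
have h : (`]1, +oo[%classic : set RR) `<=` [set t : R | 0 < t].
  by move=> x /=; rewrite in_itv /= andbT => /(lt_trans ltr01).
have := (hn _ (measurable_itv _) h).1 k0.
rewrite lebesgue_measure_itv /= ltry; by rewrite addye.
Qed.

End scaling.

Section fibre_averages.
Context {R : realType}.
Local Notation RR := (measurableTypeR R).
Variable kappa : {sigma_finite_measure set RR -> \bar R}.
Hypothesis hk : maharam_fibre_measure kappa.
Local Notation K1 := (kappa1 kappa).
Implicit Types (alpha k h : RR -> R) (t s rho : R).

Definition ray t : RR -> R := \1_(`]t, +oo[%classic : set RR).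
(* The antiderivative of [ray] with respect to [1 / t]. *)
Definition kern t (v : RR) : R := ray t v * (t^-1 - v `^ (-1)).

Let K1gt0 : 0 < K1. Proof. exact: kappa1_gt0. Qed.

Lemma rayE t v : ray t v = (t < v)%R%:R.
Proof.
rewrite /ray indicE; congr (nat_of_bool _)%:R.
by apply/idP/idP; rewrite inE /= in_itv /= andbT.
Qed.

Lemma ray_le s t v : s <= t -> ray t v <= ray s v.
Proof.
move=> st; rewrite !rayE ler_nat; case: (ltP t v) => //= tv.
by rewrite (le_lt_trans st tv).
Qed.

Lemma measurable_ray t : measurable_fun setT (ray t).
Proof. by apply: measurable_indic; exact: measurable_itv. Qed.

Lemma measurable_kern t : measurable_fun setT (kern t).
Proof.
apply: measurable_funM; first exact: measurable_ray.
by apply: measurable_funB => //; exact: measurable_powR.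
Qed.

Lemma kernE t (v : RR) : 0 < t -> kern t v = if t < v then t^-1 - v^-1 else 0.
Proof.
move=> t0; rewrite /kern rayE; case: ifPn => tv; last by rewrite mul0r.
by rewrite mul1r powR_inv1// ltW// (lt_trans t0).
Qed.

Lemma kern_bound t (v : RR) : 0 < t -> 0 <= kern t v <= t^-1 * ray t v.
Proof.
move=> t0; rewrite kernE// rayE; case: ifPn => tv; last by rewrite mulr0 lexx.
have v0 : 0 < v := lt_trans t0 tv.
rewrite mulr1 subr_ge0 lef_pV2 ?posrE// ltW//=.
by rewrite lerBlDr lerDl invr_ge0 ltW.
Qed.

(** Bounded functions vanishing near the origin; rays have finite [kappa]-measure, whereas [kappa]
    has infinite mass near [0]. *)
Definition dominated k := measurable_fun setT k /\
  exists M t, 0 < t /\ forall v, `|k v| <= M * ray t v.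

Lemma dominated_integrable k : dominated k -> kappa.-integrable setT (EFin \o k).
Proof.
move=> [mk [M [t [t0 kM]]]].
have i : kappa.-integrable setT (fun v => M%:E * (ray t v)%:E)%E.
  apply: integrableZl => //; apply/integrableP; split.
    by apply/measurable_EFinP; exact: measurable_ray.
  under eq_integral do rewrite gee0_abs ?lee_fin ?rayE//.
  under eq_integral do rewrite -rayE.
  rewrite integral_indic ?setIT//; exact: kappa_ray_lty.
apply: le_integrable i => //; first exact/measurable_EFinP.
move=> v _ /=; rewrite lee_fin; apply: le_trans (kM v) _.
exact: ler_norm.
Qed.

Lemma dominatedB k h : dominated k -> dominated h -> dominated (fun v => k v - h v).
Proof.
move=> [mk [M [t [t0 kM]]]] [mh [N [s [s0 hN]]]]; split; first exact: measurable_funB.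
exists (`|M| + `|N|), (Num.min t s); split; first by rewrite lt_min t0 s0.
move=> v; apply: le_trans (ler_normB _ _) _; rewrite mulrDl; apply: lerD.
  apply: le_trans (kM v) _; apply: le_trans (ler_norm _) _; rewrite normrM ler_wpM2l//.
  by rewrite ger0_norm ?rayE// -!rayE; apply: ray_le; rewrite ge_min lexx.
apply: le_trans (hN v) _; apply: le_trans (ler_norm _) _; rewrite normrM ler_wpM2l//.
by rewrite ger0_norm ?rayE// -!rayE; apply: ray_le; rewrite ge_min lexx orbT.
Qed.

Lemma dominatedZ c k : dominated k -> dominated (fun v => c * k v).
Proof.
move=> [mk [M [t [t0 kM]]]]; split; first exact: measurable_funM.
exists (`|c| * M), t; split => // v; rewrite normrM -mulrA ler_wpM2l//.
Qed.

Lemma dominated_ray t : 0 < t -> dominated (ray t).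
Proof.
move=> t0; split; first exact: measurable_ray.
by exists 1, t; split => // v; rewrite mul1r ger0_norm// rayE.
Qed.

Lemma dominated_kern t : 0 < t -> dominated (kern t).
Proof.
move=> t0; split; first exact: measurable_kern.
exists t^-1, t; split => // v; have /andP[h1 h2] := kern_bound v t0.
by rewrite ger0_norm.
Qed.

Lemma Rint_ray t : 0 < t -> \int[kappa]_v ray t v = K1 / t.
Proof.
move=> t0; rewrite /Rintegral integral_indic ?setIT//.
transitivity (fine (kappa `]t, +oo[%classic)) => //.
by rewrite (kappa_ray hk t0).
Qed.

Section one_function.
Variable alpha : RR -> R.
Hypotheses (malpha : measurable_fun setT alpha) (alpha01 : forall v, 0 <= alpha v <= 1).

Lemma dominatedM k : dominated k -> dominated (fun v => alpha v * k v).
Proof.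
move=> [mk [M [t [t0 kM]]]]; split; first exact: measurable_funM.
exists M, t; split => // v; rewrite normrM; apply: le_trans (kM v).
by have /andP[? ?] := alpha01 v; rewrite ler_piMl// ger0_norm.
Qed.

Definition pairing k : R := \int[kappa]_v (alpha v * k v).

Lemma pairingB k h : dominated k -> dominated h ->
  pairing (fun v => k v - h v) = pairing k - pairing h.
Proof.
move=> dk dh; rewrite /pairing -RintegralB//; last 2 first.
- exact/dominated_integrable/dominatedM.
- exact/dominated_integrable/dominatedM.
by apply: eq_Rintegral => v _; rewrite mulrBr.
Qed.

Lemma pairingZ c k : dominated k -> pairing (fun v => c * k v) = c * pairing k.
Proof.
move=> dk; rewrite /pairing -RintegralZl//; last exact/dominated_integrable/dominatedM.
by apply: eq_Rintegral => v _; rewrite mulrCA.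
Qed.

Lemma le_pairing k h : dominated k -> dominated h -> (forall v, k v <= h v) ->
  pairing k <= pairing h.
Proof.
move=> dk dh kh; apply: le_Rintegral => //.
- exact/dominated_integrable/dominatedM.
- exact/dominated_integrable/dominatedM.
by move=> v _; rewrite ler_wpM2l//; have /andP[] := alpha01 v.
Qed.

Lemma pairing_ge0 k : (forall v, 0 <= k v) -> 0 <= pairing k.
Proof.
move=> k0; apply: Rintegral_ge0 => v _; rewrite mulr_ge0//.
by have /andP[] := alpha01 v.
Qed.

Lemma pairing_le k : dominated k -> (forall v, 0 <= k v) -> pairing k <= \int[kappa]_v k v.
Proof.
move=> dk k0; apply: le_Rintegral => //.
- exact/dominated_integrable/dominatedM.
- exact: dominated_integrable.
by move=> v _; rewrite ler_piMl//; have /andP[] := alpha01 v.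
Qed.

(** The powers of [t] make the averages unchanged when [alpha] and [t] are rescaled together. The
    factor 2 in [avg_slope] is the logarithmic derivative of [t ^+ 2]. On a constant [c] the
    averages are [c] and [c / 2], and the slope vanishes. *)
Definition ray_avg t : R := t / K1 * pairing (ray t).
Definition kern_avg t : R := t ^+ 2 / K1 * pairing (kern t).
Definition avg_slope t : R := ray_avg t - 2 * kern_avg t.

Lemma ray_avg01 t : 0 < t -> 0 <= ray_avg t <= 1.
Proof.
move=> t0; have c0 : 0 < t / K1 by rewrite divr_gt0.
have r0 v : 0 <= ray t v by rewrite rayE.
apply/andP; split; first by rewrite /ray_avg mulr_ge0 ?pairing_ge0// ltW.
have := pairing_le (dominated_ray t0) r0; rewrite Rint_ray// => h.
rewrite /ray_avg -ler_pdivlMl//; apply: le_trans h _.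
by rewrite invf_div mulr1.
Qed.

Lemma kern_avg01 t : 0 < t -> 0 <= kern_avg t <= 1.
Proof.
move=> t0; have c0 : 0 < t ^+ 2 / K1 by rewrite divr_gt0// exprn_gt0.
have k0 v : 0 <= kern t v by have /andP[] := kern_bound v t0.
apply/andP; split; first by rewrite /kern_avg mulr_ge0 ?pairing_ge0// ltW.
have h : pairing (kern t) <= t^-1 * (K1 / t).
  rewrite -Rint_ray//; apply: (@le_trans _ _ (pairing (fun v => t^-1 * ray t v))).
    apply: le_pairing; [exact: dominated_kern|apply: dominatedZ; exact: dominated_ray|].
    by move=> v; have /andP[] := kern_bound v t0.
  rewrite pairingZ; last exact: dominated_ray.
  have ti : 0 <= t^-1 by rewrite invr_ge0 ltW.
  rewrite ler_wpM2l//; apply: pairing_le; first exact: dominated_ray.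
  by move=> v; rewrite rayE.
rewrite /kern_avg -ler_pdivlMl//; apply: le_trans h _.
rewrite mulr1 invf_div le_eqVlt; apply/orP; left; apply/eqP; field.
by rewrite lt0r_neq0.
Qed.

(** As a function of [1 / t] the kernel is the positive part of [1 / t - 1 / v], convex with
    derivative [ray t v]. So the remainder is nonnegative and lives on the strip between [s] and
    [t], whose [kappa]-measure is again proportional to [|1 / s - 1 / t|]. *)
Lemma kern_taylor t s (v : RR) : 0 < t -> 0 < s ->
  0 <= kern s v - kern t v - (s^-1 - t^-1) * ray t v <=
  `|s^-1 - t^-1| * (ray (Num.min s t) v - ray (Num.max s t) v).
Proof.
move=> t0 s0; rewrite !kernE// !rayE gt_min gt_max.
have [sv|sv] := ltP s v; have [tv|tv] := ltP t v => /=.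
- by rewrite subrr mulr0 mulr1; apply/andP; split; lra.
- have v0 : 0 < v := lt_trans s0 sv.
  have h1 : v^-1 <= s^-1 by rewrite lef_pV2 ?posrE// ltW.
  have h2 : t^-1 <= v^-1 by rewrite lef_pV2 ?posrE.
  by rewrite ger0_norm ?subr_ge0 ?(le_trans h2)// !mulr0 !subr0 mulr1; apply/andP; split; lra.
- have v0 : 0 < v := lt_trans t0 tv.
  have h1 : v^-1 <= t^-1 by rewrite lef_pV2 ?posrE// ltW.
  have h2 : s^-1 <= v^-1 by rewrite lef_pV2 ?posrE.
  rewrite ler0_norm ?subr_le0 ?(le_trans h2)// !mulr1 !subr0 ?mulr1; apply/andP; split; lra.
- by rewrite !subrr !mulr0 subrr lexx.
Qed.

Lemma pairing_taylor t s : 0 < t -> 0 < s ->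
  0 <= pairing (kern s) - pairing (kern t) - (s^-1 - t^-1) * pairing (ray t) <=
  K1 * (s^-1 - t^-1) ^+ 2.
Proof.
move=> t0 s0; have dk := dominated_kern t0; have ds := dominated_kern s0.
have dr := dominated_ray t0.
have m0 : 0 < Num.min s t by rewrite lt_min s0 t0.
have M0 : 0 < Num.max s t by rewrite lt_max s0.
have dm := dominated_ray m0; have dM := dominated_ray M0.
rewrite -pairingB// -pairingZ// -pairingB//; last 2 first.
- exact: dominatedB.
- exact: dominatedZ.
have kt v := kern_taylor v t0 s0.
apply/andP; split; first by apply: pairing_ge0 => v; have /andP[] := kt v.
pose k v := `|s^-1 - t^-1| * (ray (Num.min s t) v - ray (Num.max s t) v).
have dkk : dominated k by apply: dominatedZ; exact: dominatedB.
apply: (@le_trans _ _ (pairing k)).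
  apply: le_pairing => //; last by move=> v; have /andP[] := kt v.
  by apply: dominatedB; [exact: dominatedB|exact: dominatedZ].
apply: (le_trans (pairing_le dkk _)).
  by move=> v; have /andP[h1 h2] := kt v; exact: le_trans h1 h2.
rewrite /k RintegralZl//; last exact/dominated_integrable/dominatedB.
rewrite RintegralB//; [|exact: dominated_integrable..].
rewrite !Rint_ray// -mulrBr.
rewrite (_ : (Num.min s t)^-1 - (Num.max s t)^-1 = `|s^-1 - t^-1|).
  by rewrite mulrCA -expr2 real_normK ?num_real.
rewrite /Num.min /Num.max; case: ltP => st.
  by rewrite ger0_norm// subr_ge0 lef_pV2 ?posrE// ltW.
by rewrite ler0_norm ?opprB// subr_le0 lef_pV2 ?posrE.
Qed.

(* [avg_slope] is minus the derivative of [kern_avg] in logarithmic time. *)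
Lemma kern_avg_taylor t rho : 0 < t -> 0 < rho ->
  `|kern_avg (rho * t) - kern_avg t + (rho - 1) * avg_slope t| <= 2 * (rho - 1) ^+ 2.
Proof.
move=> t0 r0; have rt0 : 0 < rho * t by rewrite mulr_gt0.
have := pairing_taylor t0 rt0; set e := _ - _ - _ => /andP[e0 e1].
(* Each summand is at most [(rho - 1)^2] in absolute value: the averages lie in [[0, 1]], and the
   prefactor of [e] turns the squared difference of inverses into [(rho - 1)^2]. *)
have E : kern_avg (rho * t) - kern_avg t + (rho - 1) * avg_slope t =
  (rho - 1) ^+ 2 * (kern_avg t - ray_avg t) + (rho * t) ^+ 2 / K1 * e.
  rewrite /avg_slope /ray_avg /kern_avg /e; field; rewrite !lt0r_neq0//.
have h1 : 0 <= (rho * t) ^+ 2 / K1 * e by rewrite mulr_ge0// divr_ge0 ?sqr_ge0// ltW.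
have h2 : (rho * t) ^+ 2 / K1 * e <= (rho - 1) ^+ 2.
  apply: (@le_trans _ _ ((rho * t) ^+ 2 / K1 * (K1 * ((rho * t)^-1 - t^-1) ^+ 2))).
    by rewrite ler_wpM2l// divr_ge0 ?sqr_ge0// ltW.
  rewrite le_eqVlt; apply/orP; left; apply/eqP; field; rewrite !lt0r_neq0//.
have /andP[p0 p1] := ray_avg01 t0; have /andP[f0 f1] := kern_avg01 t0.
have q0 := sqr_ge0 (rho - 1).
rewrite E ler_norml; move: h1 h2 q0 p0 p1 f0 f1.
move: (_ * e) ((rho - 1) ^+ 2) (kern_avg t) (ray_avg t) => z q x y *.
apply/andP; split; nra.
Qed.

Lemma kern_avg_lip t rho : 0 < t -> 0 < rho ->
  `|kern_avg (rho * t) - kern_avg t| <= 2 * `|rho - 1| + 2 * (rho - 1) ^+ 2.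
Proof.
move=> t0 r0; have h := kern_avg_taylor t0 r0.
have /andP[p0 p1] := ray_avg01 t0; have /andP[f0 f1] := kern_avg01 t0.
have p2 : `|avg_slope t| <= 2 by rewrite ler_norml /avg_slope; apply/andP; split; lra.
rewrite -[X in `|X|](addrK ((rho - 1) * avg_slope t)).
apply: le_trans (ler_normB _ _) _; rewrite addrC; apply: lerD => //.
by rewrite normrM mulrC ler_wpM2r.
Qed.

Lemma kern_avg_cst : (forall t, 0 < t -> avg_slope t = 0) -> forall t, 0 < t -> kern_avg t = kern_avg 1.
Proof.
move=> h.
suff key t s : 0 < t -> t < s -> kern_avg s = kern_avg t.
  by move=> t t0; have [t1|t1|->//] := ltgtP t 1; [rewrite (key t 1)|rewrite (key 1 t)].
move=> t0 ts; have s0 := lt_trans t0 ts.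
(* A walk from [t] to [s] in [n + 1] equal steps: with zero slope each step costs a quadratic error,
   so the total is of order [1 / n]. *)
have step (n : nat) : `|kern_avg s - kern_avg t| <= 2 * ((s - t) / t) ^+ 2 / n.+1%:R.
  pose w (i : nat) := t + i%:R * ((s - t) / n.+1%:R).
  have N0 : 0 < n.+1%:R :> R by [].
  have w0 i : t <= w i by rewrite lerDl mulr_ge0// divr_ge0// subr_ge0 ltW.
  have wp i : 0 < w i := lt_le_trans t0 (w0 i).
  have H i : `|kern_avg (w i) - kern_avg t| <= i%:R * (2 * ((s - t) / t / n.+1%:R) ^+ 2).
    elim: i => [|i ih]; first by rewrite /w mul0r addr0 subrr normr0 mul0r.
    rewrite -(subrK (kern_avg (w i)) (kern_avg (w i.+1))) -addrA; apply: le_trans (ler_normD _ _) _.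
    rewrite -natr1 mulrDl mul1r [leRHS]addrC; apply: lerD => //.
    have r0 : 0 < w i.+1 / w i by rewrite divr_gt0.
    have := kern_avg_taylor (wp i) r0; rewrite divfK ?lt0r_neq0// h// mulr0 addr0.
    move=> /le_trans; apply; rewrite ler_pM2l//.
    have -> : w i.+1 / w i - 1 = (s - t) / w i / n.+1%:R.
      have -> : w i.+1 = w i + (s - t) / n.+1%:R.
        by rewrite /w -[i.+1%:R]natr1 mulrDl mul1r addrA.
      by rewrite mulrDl divff ?lt0r_neq0// addrAC subrr add0r mulrAC.
    have d0 : 0 <= s - t by rewrite subr_ge0 ltW.
    have [wi0 t0'] := (ltW (wp i), ltW t0).
    rewrite ler_pXn2r ?nnegrE ?divr_ge0//.
    by rewrite ler_pM2r ?invr_gt0// ler_wpM2l// lef_pV2 ?posrE.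
  have wn : w n.+1 = s by rewrite /w [_ * (_ / _)]mulrC divfK ?lt0r_neq0// addrC subrK.
  have := H n.+1; rewrite wn => /le_trans; apply.
  rewrite le_eqVlt; apply/orP; left; apply/eqP; field.
  by rewrite !lt0r_neq0.
apply/eqP; rewrite -subr_eq0 -normr_le0; apply/ler_addgt0Pr => e e0; rewrite add0r.
set c := 2 * ((s - t) / t) ^+ 2 in step.
have c0 : 0 <= c by rewrite mulr_ge0// sqr_ge0.
have e1 : 0 < e / (c + 1) by rewrite divr_gt0// ltr_wpDl.
have [n _ /(_ n (leqnn n)) /= hn] := near_infty_natSinv_lt (PosNum e1).
apply: le_trans (step n) _; apply: (@le_trans _ _ ((c + 1) * n.+1%:R^-1)).
  by rewrite ler_wpM2r// lerDl.
by rewrite -ler_pdivlMl ?ltr_wpDl// mulrC ltW.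
Qed.

Lemma ray_avg_cst : (forall t, 0 < t -> avg_slope t = 0) -> forall t, 0 < t -> ray_avg t = ray_avg 1.
Proof.
move=> h t t0; have e s : 0 < s -> ray_avg s = 2 * kern_avg s.
  by move=> s0; have /eqP := h s s0; rewrite subr_eq0 => /eqP.
by rewrite !e ?kern_avg_cst.
Qed.

End one_function.

Lemma pairing_scale alpha beta k h rho : 0 < rho ->
  measurable_fun setT alpha -> measurable_fun setT beta ->
  measurable_fun setT k -> measurable_fun setT h ->
  (forall v, 0 <= alpha v) -> (forall v, 0 <= h v) ->
  {ae kappa, forall v, beta v = alpha (scale rho v)} ->
  (forall v, k v = h (scale rho v)) ->
  pairing beta k = rho * pairing alpha h.
Proof.
move=> r0 ma mb mk mh a0 h0 ab kh.
have mah : measurable_fun setT (fun v => (alpha v * h v)%:E : \bar R).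
  by apply/measurable_EFinP; exact: measurable_funM.
rewrite /pairing /Rintegral -[rho]/(fine rho%:E).
rewrite (ae_eq_integral (fun v => (alpha (scale rho v) * h (scale rho v))%:E))//.
- rewrite (kappa_integral_scale hk r0 mah); last by move=> v; rewrite lee_fin mulr_ge0.
  set I := integral _ _ _.
  have : (0 <= I)%E by apply: integral_ge0 => v _; rewrite lee_fin mulr_ge0.
  case: I => [r| |]//= _; by rewrite gt0_muley ?lte_fin//= mulr0.
- by apply/measurable_EFinP; exact: measurable_funM.
- by apply: (measurableT_comp mah); exact: measurable_scale.
- by apply: filterS ab => v -> _; rewrite kh.
Qed.

Lemma ray_avg_scale alpha beta rho t : 0 < rho -> 0 < t ->
  measurable_fun setT alpha -> measurable_fun setT beta ->
  (forall v, 0 <= alpha v) ->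
  {ae kappa, forall v, beta v = alpha (scale rho v)} ->
  ray_avg beta t = ray_avg alpha (rho * t).
Proof.
move=> r0 t0 ma mb a0 ab; rewrite /ray_avg (@pairing_scale alpha beta (ray t) (ray (rho * t)) rho)//.
- by rewrite mulrA; congr (_ * _); rewrite mulrAC [t * _]mulrC.
- exact: measurable_ray.
- exact: measurable_ray.
- by move=> v; rewrite !rayE /scale ltr_pM2l.
Qed.

Lemma kern_avg_scale alpha beta rho t : 0 < rho -> 0 < t ->
  measurable_fun setT alpha -> measurable_fun setT beta ->
  (forall v, 0 <= alpha v) ->
  {ae kappa, forall v, beta v = alpha (scale rho v)} ->
  kern_avg beta t = kern_avg alpha (rho * t).
Proof.
move=> r0 t0 ma mb a0 ab; have rt0 : 0 < rho * t by rewrite mulr_gt0.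
rewrite /kern_avg (@pairing_scale alpha beta (kern t) (fun v => rho * kern (rho * t) v) rho)//.
- rewrite /pairing; under eq_Rintegral do rewrite mulrCA.
  have -> : \int[kappa]_v (rho * (alpha v * kern (rho * t) v)) =
            rho * \int[kappa]_v (alpha v * kern (rho * t) v).
    rewrite /Rintegral -[in RHS]/(fine rho%:E).
    under eq_integral do rewrite EFinM.
    rewrite ge0_integralZl//.
    - set I := integral _ _ _.
      have : (0 <= I)%E.
        apply: integral_ge0 => v _; rewrite lee_fin mulr_ge0//.
        by have /andP[] := kern_bound v rt0.
      case: I => [r| |]//= _; by rewrite gt0_muley ?lte_fin//= mulr0.
    - by apply/measurable_EFinP; apply: measurable_funM => //; exact: measurable_kern.
    - by move=> v _; rewrite lee_fin mulr_ge0//; have /andP[] := kern_bound v rt0.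
    - by rewrite lee_fin ltW.
  by ring.
- exact: measurable_kern.
- by apply: measurable_funM => //; exact: measurable_kern.
- by move=> v; have /andP[? _] := kern_bound v rt0; rewrite mulr_ge0// ltW.
- move=> v; rewrite !kernE// /scale ltr_pM2l//; case: ifPn => _; last by rewrite mulr0.
  by rewrite !invfM mulrBr !mulrA !mulfV ?mul1r// lt0r_neq0.
Qed.

Section measurability.
Context {d : measure_display} {T : measurableType d}.
Variable a : T * RR -> R.
Hypotheses (ma : measurable_fun setT a) (a01 : forall w, 0 <= a w <= 1).

Lemma measurable_pairing k : measurable_fun setT k -> (forall v, 0 <= k v) ->
  measurable_fun setT (fun x => pairing (fun v => a (x, v)) k).
Proof.
move=> mk k0; rewrite /pairing /Rintegral.
apply: (measurableT_comp (fine_measurable measurableT)).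
apply: (measurable_fun_fubini_tonelli_F (fun w : T * RR => (a w * k w.2)%:E)).
  apply/measurable_EFinP; apply: measurable_funM => //.
  exact: (measurableT_comp mk measurable_snd).
by move=> w; rewrite lee_fin mulr_ge0//; have /andP[] := a01 w.
Qed.

Lemma measurable_ray_avg t : measurable_fun setT (fun x => ray_avg (fun v => a (x, v)) t).
Proof.
apply: measurable_funM => //; apply: measurable_pairing; first exact: measurable_ray.
by move=> v; rewrite rayE.
Qed.

Lemma measurable_kern_avg t : 0 < t -> measurable_fun setT (fun x => kern_avg (fun v => a (x, v)) t).
Proof.
move=> t0; apply: measurable_funM => //; apply: measurable_pairing; first exact: measurable_kern.
by move=> v; have /andP[] := kern_bound v t0.
Qed.

End measurability.

(** Beyond [t0] the measures [alpha kappa] and [c kappa] are finite and agree on all rays, which are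
    stable under intersection and generate the Borel sets. *)
Lemma ray_avg_cst_ae alpha (c : R) : measurable_fun setT alpha -> (forall v, 0 <= alpha v <= 1) ->
  0 <= c -> (forall t, 0 < t -> ray_avg alpha t = c) ->
  {ae kappa, forall v, alpha v = c}.
Proof.
move=> ma a01 c0 hc.
have a0 v : 0 <= alpha v by have /andP[] := a01 v.
suff H (n : nat) : {ae kappa, forall v : RR, n.+1%:R^-1 < v -> alpha v = c}.
  have /ae_foralln H' := H; apply: filterS2 H' (ae_kappa_pos hk) => v hv v0.
  have [n _ /(_ n (leqnn n)) /= hn] := near_infty_natSinv_lt (PosNum v0).
  exact: (hv n hn).
set t0 : R := n.+1%:R^-1; have t00 : 0 < t0 by rewrite invr_gt0.
pose D : set RR := `]t0, +oo[%classic.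
have mD : measurable D by exact: measurable_itv.
have mra : measurable_fun setT (fun v => alpha v * ray t0 v).
  by apply: measurable_funM => //; exact: measurable_ray.
have mrc : measurable_fun setT (fun v => c * ray t0 v).
  by apply: measurable_funM => //; exact: measurable_ray.
have ra0 v : 0 <= alpha v * ray t0 v by rewrite mulr_ge0// rayE.
have rc0 v : 0 <= c * ray t0 v by rewrite mulr_ge0// rayE.
have mid : measurable_fun setT (id : RR -> RR) by [].
pose m1 := image_density kappa mid mra ra0.
pose m2 := image_density kappa mid mrc rc0.
have dr := dominated_ray t00.
have E t : m1 `]t, +oo[%classic = m2 `]t, +oo[%classic.
  have mx0 : 0 < Num.max t t0 by rewrite lt_max t00 orbT.
  have rr v : ray t v * ray t0 v = ray (Num.max t t0) v.
    by rewrite !rayE gt_max -natrM mulnb.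
  have dmx := dominated_ray mx0.
  have e1 (b : RR -> R) : (\int[kappa]_(x in `]t, +oo[%classic) (b x * ray t0 x)%:E =
      \int[kappa]_x (b x * ray (Num.max t t0) x)%:E)%E.
    rewrite integral_mkcond; apply: eq_integral => v _.
    rewrite patchE; case: ifPn => hv.
      move: hv; rewrite inE /= in_itv /= andbT => tv.
      by rewrite -rr [ray t v]rayE tv mul1r.
    move: hv; rewrite notin_setE /= in_itv /= andbT => /negP/negbTE tv.
    by rewrite -rr [ray t v]rayE tv mul0r mulr0.
  transitivity (\int[kappa]_x (alpha x * ray (Num.max t t0) x)%:E)%E; first exact: e1.
  transitivity (\int[kappa]_x (c * ray (Num.max t t0) x)%:E)%E; last by rewrite -e1.
  rewrite -[LHS]fineK; last first.
    by apply: integrable_fin_num => //; apply: dominated_integrable; exact: dominatedM.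
  rewrite -[RHS]fineK; last first.
    by apply: integrable_fin_num => //; apply: dominated_integrable; exact: dominatedZ.
  congr EFin; have := hc _ mx0; rewrite /ray_avg /pairing /Rintegral => h.
  rewrite -[RHS]/(\int[kappa]_x (c * ray (Num.max t t0) x)) RintegralZl//; last first.
    exact: dominated_integrable.
  rewrite Rint_ray// -h mulrAC -[RHS]mulrA mulrCA; set z := fine _.
  by rewrite mulrC -!mulrA; field; rewrite !lt0r_neq0.
have m12 A : measurable A -> m1 A = m2 A.
  move=> mA; apply: (@measure_unique _ R RR (@RGenOInfty.G R) (fun i : nat => `](- i%:R), +oo[%classic) _ _ _ _ m1 m2 _ _ A mA) => //.
  - exact: RGenOInfty.measurableE.
  - move=> _ _ [x ->] [y ->]; exists (Num.max x y); apply/seteqP; split => z /=.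
      by rewrite !in_itv /= !andbT gt_max => -[-> ->].
    by rewrite !in_itv /= !andbT gt_max => /andP[].
  - by move=> k; exists (- k%:R).
  - apply/seteqP; split => // x _.
    exists (Num.truncn `|x|).+1 => //=; rewrite in_itv /= andbT ltrNl.
    by apply: le_lt_trans (truncnS_gt _); rewrite -normrN ler_norm.
  - by move=> _ [x ->]; exact: E.
  - move=> k; apply: (@le_lt_trans _ _ (\int[kappa]_x (alpha x * ray t0 x)%:E)%E).
      apply: ge0_subset_integral; [exact: (measurable_itv `]_, +oo[)|exact: measurableT|
        exact/measurable_EFinP|by move=> x _; rewrite lee_fin|exact: subsetT].
    have /integrableP[_] := dominated_integrable (dominatedM ma a01 dr).
    by under eq_integral do rewrite gee0_abs ?lee_fin//.
have I1 : kappa.-integrable setT (EFin \o (fun v => alpha v * ray t0 v)).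
  by apply: dominated_integrable; exact: dominatedM.
have H : ae_eq kappa setT (EFin \o (fun v => alpha v * ray t0 v)) (EFin \o (fun v => c * ray t0 v)).
  apply: integral_ae_eq => //; first exact/measurable_EFinP.
  by move=> A _ mA; exact: m12.
apply: filterS H => v /(_ I) [] + tv; rewrite rayE tv !mulr1//.
Qed.

End fibre_averages.

Section avg_slope_continuity.
Context {R : realType}.
Local Notation RR := (measurableTypeR R).
Variable kappa : {sigma_finite_measure set RR -> \bar R}.
Hypothesis hk : maharam_fibre_measure kappa.
Variable alpha : RR -> R.
Hypotheses (malpha : measurable_fun setT alpha) (alpha01 : forall v, 0 <= alpha v <= 1).
Local Notation K1 := (kappa1 kappa).

Lemma pairing_ray_dist (t s : R) : 0 < t -> 0 < s ->
  `|pairing kappa alpha (ray s) - pairing kappa alpha (ray t)| <= K1 * `|s^-1 - t^-1|.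
Proof.
have key (t' s' : R) : 0 < t' -> t' <= s' ->
    0 <= pairing kappa alpha (ray t') - pairing kappa alpha (ray s') <= K1 * (t'^-1 - s'^-1).
  move=> t0 ts; have s0 := lt_le_trans t0 ts.
  have dt := dominated_ray t0; have ds := dominated_ray s0.
  rewrite -pairingB//; apply/andP; split.
    by apply: pairing_ge0 => // v; rewrite subr_ge0; exact: ray_le.
  apply: (le_trans (pairing_le hk malpha alpha01 (dominatedB dt ds) _)).
    by move=> v; rewrite subr_ge0; exact: ray_le.
  rewrite RintegralB//; [|exact: dominated_integrable..].
  by rewrite !Rint_ray// mulrBr.
move=> t0 s0; have [ts|st] := leP t s.
  have /andP[h1 h2] := key _ _ t0 ts; rewrite distrC ger0_norm//.
  rewrite ler0_norm ?opprB//; by rewrite subr_le0 lef_pV2 ?posrE.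
have /andP[h1 h2] := key _ _ s0 (ltW st); rewrite ger0_norm// ger0_norm//.
by rewrite subr_ge0 lef_pV2 ?posrE// ltW.
Qed.

Lemma ray_avg_lip (t rho : R) : 0 < t -> 0 < rho ->
  `|ray_avg kappa alpha (rho * t) - ray_avg kappa alpha t| <= 2 * `|rho - 1|.
Proof.
move=> t0 r0; have rt0 : 0 < rho * t by rewrite mulr_gt0.
have K0 := kappa1_gt0 hk.
have h := pairing_ray_dist t0 rt0.
have /andP[p0 p1] := ray_avg01 hk malpha alpha01 t0.
have E : ray_avg kappa alpha (rho * t) - ray_avg kappa alpha t =
  (rho - 1) * ray_avg kappa alpha t + rho * t / K1 *
   (pairing kappa alpha (ray (rho * t)) - pairing kappa alpha (ray t)).
  by rewrite /ray_avg; ring.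
rewrite E; apply: le_trans (ler_normD _ _) _.
rewrite [leRHS](_ : _ = `|rho - 1| + `|rho - 1|); last by ring.
apply: lerD.
  by rewrite normrM (ger0_norm p0) ler_piMr.
have c0 : 0 <= rho * t / K1 by rewrite divr_ge0 ?ltW.
rewrite normrM ger0_norm//; apply: (le_trans (ler_wpM2l c0 h)).
rewrite mulrA divfK ?lt0r_neq0// -[X in X * _](gtr0_norm rt0) -normrM.
rewrite (_ : rho * t * _ = 1 - rho); first by rewrite distrC.
by field; rewrite !lt0r_neq0.
Qed.

Lemma avg_slope_lip (t rho : R) : 0 < t -> 0 < rho ->
  `|avg_slope kappa alpha (rho * t) - avg_slope kappa alpha t| <= 6 * `|rho - 1| + 4 * (rho - 1) ^+ 2.
Proof.
move=> t0 r0; have h1 := ray_avg_lip t0 r0; have h2 := kern_avg_lip hk malpha alpha01 t0 r0.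
have -> : avg_slope kappa alpha (rho * t) - avg_slope kappa alpha t =
  (ray_avg kappa alpha (rho * t) - ray_avg kappa alpha t) -
  2 * (kern_avg kappa alpha (rho * t) - kern_avg kappa alpha t) by rewrite /avg_slope; ring.
apply: le_trans (ler_normB _ _) _; rewrite normrM (ger0_norm (ler0n _ 2)).
move: h1 h2; move: (`|ray_avg _ _ _ - _|) (`|kern_avg _ _ _ - _|) (`|rho - 1|) ((rho - 1) ^+ 2).
by move=> a b c d; lra.
Qed.

(** Continuity in [t] reduces the slope to rational times, so that only countably many null sets
    have to be excluded later. *)
Lemma avg_slope_dense : (forall q : rat, 0 < ratr q :> R -> avg_slope kappa alpha (ratr q) = 0) ->
  forall t : R, 0 < t -> avg_slope kappa alpha t = 0.
Proof.
move=> h t t0; apply/eqP; rewrite -normr_le0; apply/ler_addgt0Pr => e e0; rewrite add0r.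
(* [10 = 6 + 4], the constants in [avg_slope_lip]; [d <= 1] bounds the square by [d]. *)
pose d : R := Num.min 1 (e / 10).
have d0 : 0 < d by rewrite lt_min ltr01 divr_gt0.
have d1 : d <= 1 by rewrite ge_min lexx.
have td : t < t * (1 + d) by rewrite ltr_pMr// ltrDl.
have [q] := rat_in_itvoo td; rewrite in_itv /= => /andP[tq qd].
have q0 : 0 < ratr q :> R := lt_trans t0 tq.
have r0 : 0 < t / ratr q by rewrite divr_gt0.
have := avg_slope_lip q0 r0; rewrite divfK ?lt0r_neq0// h// subr0 => /le_trans; apply.
set r := t / ratr q - 1.
have rd : `|r| <= d.
  rewrite /r ler_norml; apply/andP; split.
    suff : 1 - d <= t / ratr q by lra.
    rewrite ler_pdivlMr//; apply: (@le_trans _ _ ((1 - d) * (t * (1 + d)))).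
      by rewrite ler_wpM2l ?subr_ge0// ltW.
    by nra.
  suff : t / ratr q <= 1 by lra.
  by rewrite ler_pdivrMr// mul1r ltW.
have d2 : d <= e / 10 by rewrite ge_min lexx orbT.
have r2 : r ^+ 2 <= d.
  rewrite -real_normK ?num_real//; have := normr_ge0 r; nra.
by move: rd r2 d2; move: (`|r|) (r ^+ 2) => x y; lra.
Qed.

End avg_slope_continuity.

(** * Covariant functions are constant *)

Section series_facts.
Context {R : realType}.

Lemma nneseries_infinite (u : nat -> R) (N : nat) : (forall n, 0 <= u n) ->
  (\sum_(n <oo) (u n)%:E = +oo)%E -> exists2 n, (N <= n)%N & u n != 0.
Proof.
move=> u0 h; apply: contrapT => hn.
have z n : (N <= n)%N -> u n = 0.
  move=> Nn; apply/eqP/negPn/negP => un; apply: hn; exists n => //.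
move: h; rewrite (nneseries_split 0 N)//; last by move=> k _; rewrite lee_fin.
rewrite add0n [X in (_ + X)%E]eseries0 ?adde0//; last by move=> n /= Nn _; rewrite z.
by rewrite sumEFin.
Qed.

Lemma nneseries_compare (u v : nat -> R) (c : R) (N : nat) :
  (forall n, 0 <= u n) -> (forall n, 0 <= v n) -> 0 <= c ->
  (forall n, (N <= n)%N -> u n <= c * v n) ->
  (\sum_(n <oo) (v n)%:E < +oo)%E -> (\sum_(n <oo) (u n)%:E < +oo)%E.
Proof.
move=> u0 v0 c0 uv vfin.
pose w n := if (n < N)%N then u n else 0.
have w0 n : 0 <= w n by rewrite /w; case: ifP.
apply: (@le_lt_trans _ _ (\sum_(n <oo) ((w n)%:E + c%:E * (v n)%:E))%E).
  apply: lee_nneseries => n //; first by move=> _ _; rewrite lee_fin.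
  move=> _; rewrite -EFinM -EFinD lee_fin /w; case: ltnP => h.
    by rewrite lerDl mulr_ge0.
  by rewrite add0r uv.
rewrite nneseriesD//; last 2 first.
- by move=> n _ _; rewrite lee_fin.
- by move=> n _ _; rewrite -EFinM lee_fin mulr_ge0.
rewrite lte_add_pinfty//.
  rewrite (nneseries_split 0 N)//; last by move=> k _; rewrite lee_fin.
  rewrite add0n sumEFin [X in (_ + X)%E]eseries0 ?adde0 ?ltry//.
  by move=> i Ni _; rewrite /w ltnNge Ni.
rewrite nneseriesZl; last by move=> n _; rewrite lee_fin.
by apply: lte_mul_pinfty; rewrite ?lee_fin.
Qed.

Lemma nneseries_to0 (v : nat -> R) (e : R) : (forall n, 0 <= v n) -> 0 < e ->
  (\sum_(n <oo) (v n)%:E < +oo)%E -> exists N, forall n, (N <= n)%N -> v n <= e.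
Proof.
move=> v0 e0 fin.
have := @nneseries_tail_cvg R (EFin \o v) xpredT fin _.
have v0' n : xpredT n -> (0 <= (EFin \o v) n)%E by move=> _; rewrite lee_fin.
move=> /(_ v0') /fine_cvgP[[N1 _ hN1] /cvg_dist_leP/(_ _ e0)[N hN]].
exists (maxn N1 N) => n; rewrite geq_max => /andP[n1 n2].
have := hN _ n2; rewrite subr0 /= => h.
rewrite -lee_fin; apply: (@le_trans _ _ (\sum_(n <= k <oo) (v k)%:E)%E); last first.
  by rewrite -(fineK (hN1 _ n1)) lee_fin; apply: le_trans h; exact: ler_norm.
rewrite (@nneseries_split _ (EFin \o v) n 1)//; last by move=> k _; rewrite lee_fin.
rewrite addn1 big_nat1 leeDl//; apply: nneseries_ge0 => k _ _; exact: v0'.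
Qed.

Lemma dist_chain4 (a b c d f e : R) : `|b - a| <= e / 4 -> `|b - c| <= e / 4 ->
  `|c - d| <= e / 4 -> `|d - f| <= e / 4 -> `|f - a| <= e.
Proof.
rewrite !ler_norml => /andP[? ?] /andP[? ?] /andP[? ?] /andP[? ?].
by apply/andP; split; lra.
Qed.

(* [A] and [B] stand for [kern_avg] at [t] and at [(1 + v) t], [D] for [ray_avg]
   at [t], so that the slope [D - 2 A] is close to [q]. *)
Lemma taylor_lower (q v A B D f p : R) : `|v| < `|q| / 16 ->
  `|A - f| <= `|q| / 8 -> `|D - p| <= `|q| / 8 -> q = p - 2 * f ->
  `|B - A + v * (D - 2 * A)| <= 2 * v ^+ 2 -> `|q| / 4 * `|v| <= `|A - B|.
Proof.
move=> ud m1 m2 qE m3.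
have h4 : `|q| / 2 <= `|D - 2 * A|.
  have := ler_normD (D - 2 * A) (q - (D - 2 * A)); rewrite [X in `|X| <= _]addrC subrK => h.
  have h' : `|q - (D - 2 * A)| <= `|q| / 8 * 3.
    have -> : q - (D - 2 * A) = 2 * (A - f) - (D - p) by rewrite qE; ring.
    move: m1 m2; move: (`|q|) (A - f) (D - p) => z w w'; clear.
    rewrite !ler_norml => /andP[? ?] /andP[? ?]; apply/andP; split; lra.
  by move: h h' (normr_ge0 q); move: (`|q|) (`|D - 2 * A|) (`|q - _|) => z z1 z2; lra.
have := ler_normB (B - A + v * (D - 2 * A)) (B - A).
rewrite [X in `|X| <= _]addrAC subrr add0r normrM (distrC B A) => h5.
have h6 : `|v| * (`|q| / 2) <= `|v| * `|D - 2 * A| by rewrite ler_wpM2l.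
have h7 : 2 * v ^+ 2 <= `|v| * (`|q| / 8).
  rewrite -(real_normK (num_real v)) expr2 mulrCA ler_wpM2l//.
  by move: ud (normr_ge0 v); move: (`|v|) (`|q|) => z z'; nra.
move: h5 h6 h7 m3 (mulr_ge0 (normr_ge0 v) (normr_ge0 q)); clear; move: (`|v|) (`|q|) (`|A - B|) (v ^+ 2) => z z' x y.
by move: (`|B - A + _|) (z * `|D - _|) => X Y; lra.
Qed.

End series_facts.

Section almost_everywhere.
Context {R : realType} d (T : measurableType d).

Lemma ae_forall_count (I : countType) (m : {measure set T -> \bar R}) (P : I -> T -> Prop) :
  (forall i, {ae m, forall x, P i x}) -> {ae m, forall x i, P i x}.
Proof.
move=> h; have /ae_foralln : forall n, {ae m, forall x, forall i, unpickle n = Some i -> P i x}.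
  move=> n; case E : (unpickle n) => [i|]; last by apply: aeW.
  by apply: filterS (h i) => x hx j [<-].
by apply: filterS => x hx i; apply: (hx (pickle i)); exact: pickleK.
Qed.

Lemma ae_witness (m : probability T R) (P : T -> Prop) :
  {ae m, forall x, P x} -> exists x, P x.
Proof.
move=> h; apply: contrapT => hn.
have [A [mA A0 hA]] := h; suff AT : A = setT.
  by move: A0; rewrite AT probability_setT => /eqP; rewrite onee_eq0.
by apply/seteqP; split => // x _; apply: hA => Px; apply: hn; exists x.
Qed.

End almost_everywhere.

Section exactness.
Context {R : realType}.
Local Notation RR := (measurableTypeR R).
Variables (mu : probability X1 R) (J : nat -> X1 -> R).
Hypotheses (mu_pos : forall k x, (0 < mu (icyl k x))%E)
  (J_gt0 : forall j x, 0 < J j x)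
  (J_window : forall j (x y : X1), icyl j.+1 x y -> J j x = J j y)
  (J_ratio : forall j k x, (j < k)%N ->
     mu (icyl k (flip j x)) = ((J j x)%:E * mu (icyl k x))%E).
Variable kappa : {sigma_finite_measure set RR -> \bar R}.
Hypothesis hk : maharam_fibre_measure kappa.
Variable rho : nat -> X1 -> R.
Hypotheses (rho_gt0 : forall j x, 0 < rho j x)
  (rho_window : forall j (x y : X1), icyl j.+1 x y -> rho j x = rho j y).

(* A tail function is covariant for an explicit [rho]: flipping a coordinate of
   the base point amounts to rescaling the fibre. *)
Definition covariant (a : X1 * RR -> R) :=
  [/\ measurable_fun setT a, (forall w, 0 <= a w <= 1) &
      forall j, {ae mu, forall x, {ae kappa, forall t,
        a (flip j x, t) = a (x, scale (rho j x) t)}}].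

Section covariant_averages.
Variable a : X1 * RR -> R.
Hypothesis ca : covariant a.
Let ma : measurable_fun setT a. Proof. by case: ca. Qed.
Let a01 w : 0 <= a w <= 1. Proof. by case: ca. Qed.
Let a0 w : 0 <= a w. Proof. by have /andP[] := a01 w. Qed.
Let mas x : measurable_fun setT (fun v : RR => a (x, v)).
Proof. exact: measurable_fun_pair2. Qed.

Definition fibre_kern_avg t x : R := kern_avg kappa (fun v => a (x, v)) t.
Definition fibre_ray_avg t x : R := ray_avg kappa (fun v => a (x, v)) t.

Lemma fibre_kern_avg01 (t : R) x : 0 < t -> 0 <= fibre_kern_avg t x <= 1.
Proof. by move=> t0; apply: kern_avg01. Qed.

Lemma fibre_ray_avg01 (t : R) x : 0 < t -> 0 <= fibre_ray_avg t x <= 1.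
Proof. by move=> t0; apply: ray_avg01. Qed.

Lemma bounded_mfun_fibre_kern_avg (t : R) : 0 < t -> bounded_mfun (fibre_kern_avg t).
Proof. by move=> t0; apply: bounded_mfun01; [exact: measurable_kern_avg|move=> x; exact: fibre_kern_avg01]. Qed.

Lemma bounded_mfun_fibre_ray_avg (t : R) : 0 < t -> bounded_mfun (fibre_ray_avg t).
Proof. by move=> t0; apply: bounded_mfun01; [exact: measurable_ray_avg|move=> x; exact: fibre_ray_avg01]. Qed.

Lemma fibre_kern_avg_flip (j : nat) (t : R) : 0 < t ->
  {ae mu, forall x, fibre_kern_avg t (flip j x) = fibre_kern_avg (rho j x * t) x}.
Proof. by move=> t0; have [_ _ /(_ j)] := ca; apply: filterS => x h; exact: kern_avg_scale. Qed.

Lemma fibre_ray_avg_flip (j : nat) (t : R) : 0 < t ->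
  {ae mu, forall x, fibre_ray_avg t (flip j x) = fibre_ray_avg (rho j x * t) x}.
Proof. by move=> t0; have [_ _ /(_ j)] := ca; apply: filterS => x h; exact: ray_avg_scale. Qed.

(** A window longer than [j] fixes [rho j] and [J j], so the flip carries one cylinder to another
    with a constant density, which cancels in the quotient. The family [G] is abstract in order to
    cover the fibre averages as well as a single flip-invariant function. *)
Lemma cyl_avg_flip (G : R -> X1 -> R) (j k : nat) (t : R) (x : X1) :
  (forall t : R, 0 < t -> bounded_mfun (G t)) ->
  (forall (t : R) x, 0 < t -> 0 <= G t x) ->
  (forall t : R, 0 < t -> {ae mu, forall x, G t (flip j x) = G (rho j x * t) x}) ->
  (j < k)%N -> 0 < t ->
  cyl_avg mu k (G t) (flip j x) = cyl_avg mu k (G (rho j x * t)) x.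
Proof.
move=> bG G0 hG jk t0; set r := rho j x; have r0 : 0 < r * t by exact: mulr_gt0 (rho_gt0 j x) t0.
have mC y := measurable_icyl k y.
have e : (\int[mu]_(y in icyl k (flip j x)) (G t y)%:E =
          (J j x)%:E * \int[mu]_(y in icyl k x) (G (r * t) y)%:E)%E.
  have mG : measurable_fun setT (fun y => (G t y)%:E : \bar R).
    by apply/measurable_EFinP; exact: (bG _ t0).1.
  have mGr : measurable_fun setT (fun y => (G (r * t) y)%:E : \bar R).
    by apply/measurable_EFinP; exact: (bG _ r0).1.
  rewrite integral_mkcond -(flip_integral mu_pos J_gt0 J_window J_ratio j); last 2 first.
  - by rewrite -measurable_restrictT//; exact: measurable_funTS.
  - by move=> y; rewrite patchE; case: ifP => // _; rewrite lee_fin G0.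
  rewrite -ge0_integralZl//; last 3 first.
  - exact: measurable_funTS.
  - by move=> y _; rewrite lee_fin G0.
  - by rewrite lee_fin ltW.
  rewrite [RHS]integral_mkcond; apply: ae_eq_integral => //.
  - apply: emeasurable_funM; last by apply/measurable_EFinP; exact: measurable_J.
    apply: (measurableT_comp _ (measurable_flip j)).
    by rewrite -measurable_restrictT//; exact: measurable_funTS.
  - rewrite -measurable_restrictT//; apply: measurable_funTS.
    by apply: emeasurable_funM.
  apply: filterS (hG _ t0) => y hy _; rewrite !patchE.
  have jk' := ltnW jk; have E : (flip j y \in icyl k (flip j x)) = (y \in icyl k x).
    apply/idP/idP; rewrite !inE => h; last exact: flip_icyl.
    by have := flip_icyl jk' h; rewrite !flipK.
  rewrite E; case: ifPn => [|_]; last by rewrite mul0e.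
  rewrite inE => xy; have xy' := icyl_le jk xy.
  by rewrite hy muleC -(J_window xy') -(rho_window xy').
have b1 := bG _ t0; have b2 := bG _ r0.
rewrite !EFin_Rint// -EFinM in e; case: e => e.
rewrite /cyl_avg e J_ratio// fineM//; last by rewrite fin_num_measure.
by rewrite /= -mulf_div divff ?mul1r// lt0r_neq0.
Qed.

End covariant_averages.

Definition triple n (x : X1) : 'I_2 * 'I_2 * 'I_2 := (x n.*2, x n.*2.+1, x n.*2.+2).

(** At odd coordinates the product of [rho] and [J] depends on the triple only. [rs s n] is the
    rescaling factor in block [n] when the triple there is [s], and [beta s] is its limit along the
    good times. *)
Variables (C beta : 'I_2 * 'I_2 * 'I_2 -> R) (rs : 'I_2 * 'I_2 * 'I_2 -> nat -> R).
Hypotheses (C_gt0 : forall s, 0 < C s) (beta_gt0 : forall s, 0 < beta s)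
  (rs_gt0 : forall s n, 0 < rs s n)
  (rho_rs : forall n x, rho n.*2.+1 x = rs (triple n x) n)
  (J_rs : forall n x, J n.*2.+1 x = C (triple n x) / rs (triple n x) n).

Definition good_term s (eta : R) n (x : X1) : R :=
  if (triple n x == s) && (`|rs s n - beta s| < eta) then (rs s n - beta s) ^+ 2 else 0.

Lemma good_term_ge0 s eta n x : 0 <= good_term s eta n x.
Proof. by rewrite /good_term; case: ifP => // _; exact: sqr_ge0. Qed.

(** Divergence is required for every cut-off, so that the contributing times can be taken with
    [rs s n] as close to [beta s] as desired. Only the tail of the path matters, whence the
    invariance under flips. *)
Definition good_set s : set X1 :=
  [set x | forall i : nat, (\sum_(n <oo) (good_term s i.+1%:R^-1 n x)%:E = +oo)%E].

Lemma triple_window n x y : icyl n.*2.+2 x y -> triple n x = triple n y.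
Proof. by move=> /icylP h; rewrite /triple; congr (_, _, _); rewrite h//; lia. Qed.

Lemma measurable_good_term s eta n : measurable_fun setT (good_term s eta n).
Proof.
by apply: (@measurable_fun_window _ (iota 0 n.*2.+3)) => x y h; rewrite /good_term (triple_window h).
Qed.

Lemma measurable_good_set s : measurable (good_set s).
Proof.
have -> : good_set s = \bigcap_i [set x | (\sum_(n <oo) (good_term s i.+1%:R^-1 n x)%:E = +oo)%E].
  by apply/seteqP; split => x h; [move=> i _; exact: h|move=> i; exact: h].
apply: bigcap_measurable => // i _.
rewrite -[X in measurable X]setTI.
have mf : measurable_fun setT (fun x => \sum_(n <oo) (good_term s i.+1%:R^-1 n x)%:E)%E.
  apply: ge0_emeasurable_sum => n; first by move=> x _ _; rewrite lee_fin good_term_ge0.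
  by move=> _; apply/measurable_EFinP; exact: measurable_good_term.
exact: (mf measurableT [set +oo%E] (emeasurable_set1 _)).
Qed.

Lemma good_set_flip s j x : good_set s x -> good_set s (flip j x).
Proof.
move=> h i; apply/eqP; rewrite -leye_eq leNgt; apply/negP => fin.
suff : (\sum_(n <oo) (good_term s i.+1%:R^-1 n x)%:E < +oo)%E by rewrite h ltxx.
apply: (nneseries_compare (c := 1) (N := j.+1)) fin.
- by move=> n; exact: good_term_ge0.
- by move=> n; exact: good_term_ge0.
- by [].
move=> n jn; rewrite mul1r /good_term (_ : triple n (flip j x) = triple n x)//.
by rewrite /triple !flip_other//; rewrite neq_ltn; apply/orP; right; lia.
Qed.

Lemma good_set_near s x (e : R) N : good_set s x -> 0 < e ->
  exists n, [/\ (N <= n)%N, triple n x = s & `|rs s n - beta s| < e].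
Proof.
move=> h e0; have [i _ /(_ i (leqnn i)) /= ie] := near_infty_natSinv_lt (PosNum e0).
have [n Nn] := nneseries_infinite N (fun n => good_term_ge0 s i.+1%:R^-1 n x) (h i).
rewrite /good_term; case: ifPn => [/andP[/eqP c r] _|]; last by rewrite eqxx.
by exists n; split => //; apply: lt_trans ie.
Qed.

(** With [J = C / rs] the weight is [C / (rs + C)], and [rs] is at most [beta s + 1]. *)
Lemma flip_weight_lower s n x : triple n x = s -> `|rs s n - beta s| < 1 ->
  C s / (beta s + 1 + C s) <= flip_weight J n.*2.+1 x.
Proof.
move=> c h; rewrite /flip_weight J_rs c; have r0 := rs_gt0 s n; have c0 := C_gt0 s.
have b0 := beta_gt0 s.
have -> : C s / rs s n / (1 + C s / rs s n) = C s / (rs s n + C s).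
  by field; rewrite !lt0r_neq0// addr_gt0.
rewrite ler_pM2l// lef_pV2 ?posrE ?addr_gt0// lerD2r.
by move: h; rewrite ltr_norml => /andP[_ ?]; lra.
Qed.

Section one_class.
Variables (s : 'I_2 * 'I_2 * 'I_2) (a : X1 * RR -> R).
Hypotheses (ca : covariant a) (a_van : forall x v, ~ good_set s x -> a (x, v) = 0).
Let ma : measurable_fun setT a. Proof. by case: ca. Qed.
Let a01 w : 0 <= a w <= 1. Proof. by case: ca. Qed.
Let mas x : measurable_fun setT (fun v : RR => a (x, v)).
Proof. exact: measurable_fun_pair2. Qed.
Local Notation F := (fibre_kern_avg a).
Local Notation P := (fibre_ray_avg a).
Local Notation c0 := (C s / (beta s + 1 + C s)).
Let c0_gt0 : 0 < c0.
Proof. by rewrite divr_gt0// !addr_gt0. Qed.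

Let van x (t : R) : ~ good_set s x -> F t x = 0 /\ P t x = 0.
Proof.
move=> nx; have z k : pairing kappa (fun v => a (x, v)) k = 0.
  rewrite /pairing (_ : (fun v => _) = cst 0) ?Rintegral_cst0//.
    by rewrite /Rintegral integral0.
  by apply/funext => v; rewrite a_van// mul0r.
by rewrite /fibre_kern_avg /fibre_ray_avg /kern_avg /ray_avg !z !mulr0.
Qed.

Let dbl (n : nat) : (n <= n.*2.+2)%N. Proof. by lia. Qed.

Let osc (t : R) (n : nat) x := oscillation mu J (fun n => n.*2.+2) (F t) n x.

Let osc_lower (t : R) (n : nat) x : 0 < t -> triple n x = s -> `|rs s n - beta s| < 1 ->
  c0 * (cyl_avg mu n.*2.+2 (F t) x - cyl_avg mu n.*2.+2 (F (rs s n * t)) x) ^+ 2 <= osc t n x.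
Proof.
move=> t0 c h; rewrite /osc /oscillation (@cyl_avg_flip F); last 5 first.
- exact: bounded_mfun_fibre_kern_avg.
- by move=> t' x' t'0; have /andP[] := fibre_kern_avg01 ca x' t'0.
- exact: fibre_kern_avg_flip.
- by [].
- by [].
rewrite rho_rs c; apply: ler_wpM2r; first exact: sqr_ge0.
exact: flip_weight_lower.
Qed.

Let osc_ae (t : R) : 0 < t -> {ae mu, forall x, (\sum_(n <oo) (osc t n x)%:E < +oo)%E}.
Proof.
move=> t0; apply: variation_ae => //; first exact: bounded_mfun_fibre_kern_avg.
by move=> n; rewrite leqnSn leqnn.
Qed.

Let levy_fibre_kern_avg (t : R) : 0 < t -> {ae mu, forall x, cyl_avg mu k (F t) x @[k --> \oo] --> F t x}.
Proof.
by move=> t0; apply: levy => //; [exact: (bounded_mfun_fibre_kern_avg ca t0).1|move=> x; exact: fibre_kern_avg01].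
Qed.

Let lip (t u : R) x : 0 < t -> 0 < u ->
  `|F (u * t) x - F t x| <= 2 * `|u - 1| + 2 * (u - 1) ^+ 2.
Proof. by move=> t0 u0; exact: kern_avg_lip. Qed.

(** Along good times the oscillations tend to 0 while their weights stay bounded below, so the
    conditional expectations of [F t] and [F (rs t)] merge. Since [rs] comes close to [beta s],
    Levy's theorem identifies the two limits. *)
Lemma fibre_kern_avg_periodic (t : R) : 0 < t -> {ae mu, forall x, F (beta s * t) x = F t x}.
Proof.
move=> t0; have b0 := beta_gt0 s; have bt0 : 0 < beta s * t by rewrite mulr_gt0.
apply: filterS3 (osc_ae t0) (levy_fibre_kern_avg t0) (levy_fibre_kern_avg bt0) => x fin l1 l2.
have [gx|ngx] := pselect (good_set s x); last by rewrite !(van _ ngx).1.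
apply/eqP; rewrite -subr_eq0 -normr_le0; apply/ler_addgt0Pr => /= e e0; rewrite add0r.
have e4 : 0 < e / 4 by rewrite divr_gt0.
have [N1 h1] := (cvg_dist_leP _ _).1 l1 _ e4.
have [N2 h2] := (cvg_dist_leP _ _).1 l2 _ e4.
have ce : 0 < c0 * (e / 4) ^+ 2 by rewrite mulr_gt0// exprn_gt0.
have o0 n : 0 <= osc t n x by exact: oscillation_ge0.
have [N3 h3] := nneseries_to0 o0 ce fin.
(* With this choice the Lipschitz bound [2 d' + 2 d'^2] is at most [e / 4]; the factor [beta s]
   passes from [rs - beta] to [rs / beta - 1]. *)
pose d' : R := Num.min 1 (e / 16); pose d : R := Num.min 1 (beta s * d').
have d'0 : 0 < d' by rewrite lt_min ltr01 divr_gt0.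
have d0 : 0 < d by rewrite lt_min ltr01 mulr_gt0.
have [n [Nn cn dn]] := good_set_near (maxn N1 (maxn N2 N3)) gx d0.
move: Nn; rewrite !geq_max => /and3P[n1 n2 n3].
have d1 : `|rs s n - beta s| < 1 by apply: lt_le_trans dn _; rewrite ge_min lexx.
have l := le_trans (osc_lower t0 cn d1) (h3 _ n3).
have {}l : `|cyl_avg mu n.*2.+2 (F t) x - cyl_avg mu n.*2.+2 (F (rs s n * t)) x| <= e / 4.
  rewrite -(@ler_pXn2r _ 2)// ?nnegrE ?normr_ge0 ?(ltW e4)// real_normK ?num_real//.
  by rewrite -(ler_pM2l c0_gt0).
have k1 := leq_trans n1 (dbl n).
have k2 := leq_trans n2 (dbl n).
have m1 := h1 _ k1; have m2 := h2 _ k2.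
pose u := rs s n / beta s; have u0 : 0 < u by rewrite divr_gt0.
have eu : rs s n * t = u * (beta s * t) by rewrite mulrA divfK ?lt0r_neq0.
have ud : `|u - 1| <= d'.
  have -> : u - 1 = (rs s n - beta s) / beta s.
    by rewrite mulrBl divff ?lt0r_neq0.
  rewrite normrM normfV (gtr0_norm b0) ler_pdivrMr// mulrC ltW//.
  by apply: lt_le_trans dn _; rewrite ge_min lexx orbT.
have d'1 : d' <= 1 by rewrite ge_min lexx.
have d'e : d' <= e / 16 by rewrite ge_min lexx orbT.
have m3 : `|cyl_avg mu n.*2.+2 (F (rs s n * t)) x - cyl_avg mu n.*2.+2 (F (beta s * t)) x| <= e / 4.
  apply: cyl_avg_dist => //.
  - by apply: bounded_mfun_fibre_kern_avg => //; rewrite mulr_gt0.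
  - exact: bounded_mfun_fibre_kern_avg.
  move=> y; rewrite eu; apply: le_trans (lip y bt0 u0) _.
  rewrite -(real_normK (num_real (u - 1))); have := normr_ge0 (u - 1).
  by move: ud; move: (`|u - 1|) => z; nra.
exact: dist_chain4 m1 l m3 m2.
Qed.

(** At [r = t / beta s] a flip compares [F r] with [F (u t)], where [u = rs / beta s] is close to 1,
    and periodicity replaces [F r] by [F t]. A nonzero slope makes the difference at least
    proportional to [|u - 1|], so the divergent sum of [(rs - beta s)^2] would be dominated by the
    finite sum of the oscillations. *)
Lemma avg_slope_vanishes (t : R) : 0 < t ->
  {ae mu, forall x, avg_slope kappa (fun v => a (x, v)) t = 0}.
Proof.
move=> t0; have b0 := beta_gt0 s; pose r : R := t / beta s.
have r0 : 0 < r by rewrite divr_gt0.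
have br : beta s * r = t by rewrite mulrC divfK ?lt0r_neq0.
have levy_fibre_ray_avg : {ae mu, forall x, cyl_avg mu k (P t) x @[k --> \oo] --> P t x}.
  by apply: levy => //; [exact: (bounded_mfun_fibre_ray_avg ca t0).1|move=> x; exact: fibre_ray_avg01].
have per : forall k x, cyl_avg mu k (F r) x = cyl_avg mu k (F t) x.
  move=> k x.
  suff e : (\int[mu]_(y in icyl k x) (F r y)%:E = \int[mu]_(y in icyl k x) (F t y)%:E)%E.
    by rewrite /cyl_avg /Rintegral e.
  apply: ae_eq_integral.
  - exact: measurable_icyl.
  - by apply: measurable_funTS; apply/measurable_EFinP; exact: (bounded_mfun_fibre_kern_avg ca r0).1.
  - by apply: measurable_funTS; apply/measurable_EFinP; exact: (bounded_mfun_fibre_kern_avg ca t0).1.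
  by apply: filterS (fibre_kern_avg_periodic r0) => y; rewrite br => -> _.
apply: filterS3 (osc_ae r0) (levy_fibre_kern_avg t0) levy_fibre_ray_avg => x fin l1 l2.
have [gx|ngx] := pselect (good_set s x); last first.
  by have [] := van t ngx; rewrite /fibre_kern_avg /fibre_ray_avg /avg_slope => -> ->; rewrite mulr0 subrr.
set q := avg_slope _ _ t; apply/eqP/negPn/negP => q0.
have nq : 0 < `|q| by rewrite normr_gt0.
have q8 : 0 < `|q| / 8 by rewrite divr_gt0.
have [N1 h1] := (cvg_dist_leP _ _).1 l1 _ q8.
have [N2 h2] := (cvg_dist_leP _ _).1 l2 _ q8.
pose eta : R := Num.min 1 (beta s * (`|q| / 16)).
have eta0 : 0 < eta by rewrite lt_min ltr01 mulr_gt0// divr_gt0.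
have [i _ /(_ i (leqnn i)) /= ie] := near_infty_natSinv_lt (PosNum eta0).
have := gx i; apply/eqP; rewrite lt_eqF//.
(* From [osc >= c0 (|q| / 4)^2 (u - 1)^2] and [rs - beta s = beta s (u - 1)]. *)
pose K : R := 16 * beta s ^+ 2 / (c0 * `|q| ^+ 2).
have q2 : 0 < `|q| ^+ 2 by rewrite exprn_gt0.
have K0 : 0 <= K.
  by apply: divr_ge0; [exact: mulr_ge0 (ler0n _ _) (sqr_ge0 _)|exact/ltW/mulr_gt0].
apply: (nneseries_compare (c := K) (N := maxn N1 N2)) fin => //.
- by move=> n; exact: good_term_ge0.
- by move=> n; exact: oscillation_ge0.
have o0 n : 0 <= osc r n x by exact: oscillation_ge0.
move=> n; rewrite geq_max => /andP[n1 n2]; rewrite /good_term.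
case: ifPn => [/andP[/eqP cn dn]|_]; last by rewrite mulr_ge0.
have {}dn := lt_trans dn ie.
have d1 : `|rs s n - beta s| < 1 by apply: lt_le_trans dn _; rewrite ge_min lexx.
have l := osc_lower r0 cn d1; rewrite per in l.
pose u := rs s n / beta s; have u0 : 0 < u by rewrite divr_gt0.
have eu : rs s n * r = u * t by rewrite -br mulrA divfK ?lt0r_neq0.
have bu : rs s n - beta s = beta s * (u - 1) by rewrite mulrBr mulr1 mulrC divfK ?lt0r_neq0.
have ud : `|u - 1| < `|q| / 16.
  rewrite -(ltr_pM2l b0) -[X in X * _](gtr0_norm b0) -normrM -bu.
  by apply: lt_le_trans dn _; rewrite ge_min lexx orbT.
rewrite eu in l.
have ut0 : 0 < u * t by rewrite mulr_gt0.
have bf := bounded_mfun_fibre_kern_avg ca t0.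
have bfu := bounded_mfun_fibre_kern_avg ca ut0; have bp := bounded_mfun_fibre_ray_avg ca t0.
have k1 := leq_trans n1 (dbl n).
have k2 := leq_trans n2 (dbl n).
have m1 := h1 _ k1; have m2 := h2 _ k2.
set A := cyl_avg mu n.*2.+2 (F t) x in l m1 *.
set B := cyl_avg mu n.*2.+2 (F (u * t)) x in l *.
set D := cyl_avg mu n.*2.+2 (P t) x in m2 *.
(* The Taylor bound is pointwise and linear in the averages, hence it survives conditional
   expectation. *)
have m3 : `|B - A + (u - 1) * (D - 2 * A)| <= 2 * (u - 1) ^+ 2.
  have bz : bounded_mfun (fun y => 2 * F t y) by exact: (bounded_mfunM (bounded_mfun_cst 2) bf).
  have bd := bounded_mfunB bp bz; have bdu := bounded_mfunB bfu bf.
  have bud := bounded_mfunM (bounded_mfun_cst (u - 1)) bd.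
  have -> : B - A + (u - 1) * (D - 2 * A) = cyl_avg mu n.*2.+2
    (fun y => (F (u * t) y - F t y) + (u - 1) * (P t y - 2 * F t y)) x.
    by rewrite cyl_avgD// cyl_avgB// cyl_avgZ// cyl_avgB// cyl_avgZ.
  apply: cyl_avg_bound; [exact: mu_pos|exact: bounded_mfunD bdu bud|].
  by move=> y; exact: kern_avg_taylor.
have m4 : `|q| / 4 * `|u - 1| <= `|A - B| by exact: taylor_lower ud m1 m2 _ m3.
rewrite bu exprMn /K [leRHS]mulrAC ler_pdivlMr; last by exact: mulr_gt0.
have m5 : (`|q| / 4) ^+ 2 * `|u - 1| ^+ 2 <= (A - B) ^+ 2.
  by rewrite -exprMn -(real_normK (num_real (A - B))) ler_pXn2r// nnegrE.
rewrite real_normK ?num_real// in m5.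
have m6 : c0 * ((`|q| / 4) ^+ 2 * (u - 1) ^+ 2) <= osc r n x.
  by apply: le_trans l; rewrite ler_pM2l.
rewrite [leLHS](_ : _ = 16 * beta s ^+ 2 * (c0 * ((`|q| / 4) ^+ 2 * (u - 1) ^+ 2)));
  last by move: (c0) (`|q|) => c z; field.
by rewrite ler_pM2l ?mulr_gt0 ?exprn_gt0.
Qed.

End one_class.

(* Every point lies in one of the eight tail sets [good_set s]; cutting off
   by each of them reduces the general case to [avg_slope_vanishes]. *)
Lemma covariant_cut s a : covariant a ->
  covariant (fun w => a w * \1_(good_set s) w.1).
Proof.
move=> [ma a01 ha]; split.
- apply: measurable_funM => //.
  apply: (measurableT_comp _ measurable_fst); exact: measurable_indic (measurable_good_set s).
- move=> w; have := a01 w; rewrite indicE; case: (_ \in _) => /=; first by rewrite mulr1.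
  by rewrite mulr0 lexx ler01.
move=> j; apply: filterS (ha j) => x; apply: filterS => t /= ->; congr (_ * _).
rewrite !indicE; congr (nat_of_bool _)%:R; apply/idP/idP; rewrite !inE => h.
  by rewrite -(flipK j x); exact: good_set_flip.
exact: good_set_flip.
Qed.

Hypothesis good_cover : {ae mu, forall x, exists s, good_set s x}.

(** Triples and rational times are countably many, so one null set serves all of them; over a point
    of [good_set s] the cut-off leaves the fibre unchanged. *)
Lemma covariant_ray_avg a : covariant a ->
  {ae mu, forall x, forall t : R, 0 < t -> fibre_ray_avg a t x = fibre_ray_avg a 1 x}.
Proof.
move=> ca; have [ma a01 _] := ca.
have H : {ae mu, forall x, forall (sq : ('I_2 * 'I_2 * 'I_2) * rat), 0 < ratr sq.2 :> R ->
    avg_slope kappa (fun v => a (x, v) * \1_(good_set sq.1) x) (ratr sq.2) = 0}.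
  apply: ae_forall_count => -[s q] /=.
  have [q0|q0] := ltP 0 (ratr q : R); last by apply: aeW.
  have := avg_slope_vanishes (covariant_cut s ca) _ q0.
  have z x v : ~ good_set s x -> a (x, v) * \1_(good_set s) x = 0.
    by move=> ns; rewrite indicE memNset// mulr0.
  by move=> /(_ s z); apply: filterS => x h _.
apply: filterS2 good_cover H => x [s gs] h t t0.
apply: ray_avg_cst t t0 => //; first exact: measurable_fun_pair2.
apply: avg_slope_dense => //; first exact: measurable_fun_pair2.
move=> q q0; rewrite -(h (s, q) q0) /=; congr avg_slope; apply/funext => v.
by rewrite indicE mem_set// mulr1.
Qed.

(** A zero-one law. The conditional expectations of [g] are functions [h k] of a single letter, and
    the finite energy of the odd flips makes [h k 1 - h k 0] small for arbitrarily large [k]. Along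
    these [k] the martingale values at two generic points come together. *)
Lemma flip_invariant_cst (g : X1 -> R) : measurable_fun setT g ->
  (forall x, 0 <= g x <= 1) -> (forall j, {ae mu, forall x, g (flip j x) = g x}) ->
  exists c, {ae mu, forall x, g x = c}.
Proof.
move=> mg g01 hg; have bg := bounded_mfun01 mg g01.
have EEf j k x : (j < k)%N -> cyl_avg mu k g (flip j x) = cyl_avg mu k g x.
  by move=> jk; apply: (@cyl_avg_flip (fun _ : R => g) j k 1) => // t' x' _; have /andP[] := g01 x'.
(* the conditional expectation given the first coordinates depends on the
   last of them only *)
have EEl k x y : x k = y k -> cyl_avg mu k g x = cyl_avg mu k g y.
  move=> xyk; pose z m : X1 := fun i => if (i < m)%N then y i else x i.
  have -> : cyl_avg mu k g x = cyl_avg mu k g (z 0%N) by [].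
  have -> : cyl_avg mu k g y = cyl_avg mu k g (z k).
    apply: cyl_avg_icyl; apply/icylP => i; rewrite leq_eqVlt /z => /orP[/eqP ->|->//].
    by rewrite ltnn.
  suff H m : (m <= k)%N -> cyl_avg mu k g (z 0%N) = cyl_avg mu k g (z m) by exact: H.
  elim: m => // m IH mk; rewrite IH 1?ltnW//.
  have [e|e] := eqVneq (y m) (x m).
    congr (cyl_avg mu k g _); apply/funext => i; rewrite /z [in RHS]ltnS [in RHS]leq_eqVlt.
    by case: eqP => [->|//]; rewrite ltnn e.
  rewrite -(EEf m)//; congr (cyl_avg mu k g _); apply/funext => i; rewrite /z [in RHS]ltnS [in RHS]leq_eqVlt.
  case: eqP => [->|/eqP im]; last by rewrite flip_other.
  rewrite flip_same ltnn; move: e; rewrite /flip_letter.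
  by case: (ord2P (x m)) => ->; case: (ord2P (y m)) => ->.
pose h k b := cyl_avg mu k g (fun=> b).
have hE k x : cyl_avg mu k g x = h k (x k) by exact: EEl.
have L : {ae mu, forall x, cyl_avg mu k g x @[k --> \oo] --> g x} by exact: levy.
have V := variation_ae mu_pos J_gt0 J_window J_ratio bg (kappa := fun n => n.*2.+1).
have small : forall (e : R) N, 0 < e -> exists2 k, (N <= k)%N & `|h k 1 - h k 0| <= e.
  (* One good point with finite energy is enough, since the functions [h k] do not depend on the
     point. *)
  have {}V := V (fun n => _); have [|x [[s gs] fin]] := @ae_witness _ _ _ mu
      (fun x => (exists s, good_set s x) /\
         (\sum_(n <oo) (oscillation mu J (fun n => n.*2.+1) g n x)%:E < +oo)%E).
    by apply: filterS2 good_cover (V _) => // n; rewrite leqnn leqnSn.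
  move=> e N e0; pose c0 : R := C s / (beta s + 1 + C s).
  have c00 : 0 < c0 by rewrite divr_gt0// !addr_gt0.
  have ce : 0 < c0 * e ^+ 2 by rewrite mulr_gt0// exprn_gt0.
  have o0 n : 0 <= oscillation mu J (fun n => n.*2.+1) g n x by exact: oscillation_ge0.
  have [M hM] := nneseries_to0 o0 ce fin.
  have [n [Nn cn dn]] := good_set_near (maxn N M) gs ltr01.
  exists n.*2.+1; first by move: Nn; rewrite geq_max => /andP[+ _]; lia.
  move: Nn; rewrite geq_max => /andP[_ /hM]; rewrite /oscillation !hE flip_same.
  have -> : (h n.*2.+1 (x n.*2.+1) - h n.*2.+1 (flip_letter (x n.*2.+1))) ^+ 2 =
      (h n.*2.+1 1 - h n.*2.+1 0) ^+ 2.
    by case: (ord2P (x n.*2.+1)) => -> //; rewrite /flip_letter /= -sqrrN opprB.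
  move=> /(le_trans (ler_wpM2r (sqr_ge0 _) (flip_weight_lower cn dn))).
  rewrite ler_pM2l// => l; rewrite -(@ler_pXn2r _ 2)// ?nnegrE ?normr_ge0 ?(ltW e0)//.
  by rewrite real_normK ?num_real.
have [y ly] := ae_witness L; exists (g y); apply: filterS L => x lx.
apply/eqP; rewrite -subr_eq0 -normr_le0; apply/ler_addgt0Pr => /= e e0; rewrite add0r.
have e4 : 0 < e / 4 by rewrite divr_gt0.
have [N1 h1] := (cvg_dist_leP _ _).1 lx _ e4.
have [N2 h2] := (cvg_dist_leP _ _).1 ly _ e4.
have [k] := small _ (maxn N1 N2) e4; rewrite geq_max => /andP[k1 k2] hk01.
have m1 := h1 _ k1; have m2 := h2 _ k2; rewrite !hE in m1 m2.
have m3 : `|h k (x k) - h k (y k)| <= e / 4.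
  case: (ord2P (x k)) => ->; case: (ord2P (y k)) => -> //;
  by rewrite ?subrr ?normr0 ?(ltW e4)// distrC.
rewrite distrC; apply: (dist_chain4 m1 m3 _ m2).
by rewrite subrr normr0 ltW.
Qed.

(** Once the fibre averages do not depend on [t], the rescaling disappears from the covariance
    relation and they become flip-invariant, hence constant; the averages over rays then determine
    almost every fibre. *)
Theorem covariant_cst a : covariant a ->
  exists c, {ae mu, forall x, {ae kappa, forall t, a (x, t) = c}}.
Proof.
move=> ca; have [ma a01 _] := ca.
have p01 x : 0 <= fibre_ray_avg a 1 x <= 1 by exact: fibre_ray_avg01.
have H := covariant_ray_avg ca.
have [j|c hc] := flip_invariant_cst (bounded_mfun_fibre_ray_avg ca ltr01).1 p01.
  apply: filterS2 H (fibre_ray_avg_flip ca j ltr01) => x h ->; rewrite h// mulr1; exact: rho_gt0.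
exists c; apply: filterS2 H hc => x h hx.
have mx : measurable_fun setT (fun v : RR => a (x, v)) by exact: measurable_fun_pair2.
apply: (ray_avg_cst_ae hk mx) => //.
- by rewrite -hx; have /andP[] := p01 x.
- by move=> t t0; rewrite -hx; exact: h.
Qed.

End exactness.

(** * The one-sided shift *)

Section markov_weights.
Context {R : realType}.
Variables (l : 'I_2 -> R) (Q : nat -> 'M[R]_2).
Hypotheses (l_gt0 : forall a, 0 < l a) (Q_gt0 : forall n a b, 0 < Q n a b).

Definition path_weight (k : nat) (x : X1) : R :=
  l (x 0%N) * \prod_(i < k) Q i (x i) (x i.+1).

(** Only the transitions into and out of [j] change under a flip; at [j = 0] the initial law takes
    the place of the incoming transition. *)
Definition flip_ratio (j : nat) (x : X1) : R :=
  if j is i.+1 then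
    (Q i (x i) (flip_letter (x j)) * Q j (flip_letter (x j)) (x j.+1)) /
    (Q i (x i) (x j) * Q j (x j) (x j.+1))
  else (l (flip_letter (x 0%N)) * Q 0%N (flip_letter (x 0%N)) (x 1%N)) /
       (l (x 0%N) * Q 0%N (x 0%N) (x 1%N)).

Lemma path_weight_gt0 k x : 0 < path_weight k x.
Proof. by rewrite mulr_gt0//; elim/big_ind: _ => // u v u0 v0; exact: mulr_gt0. Qed.

Lemma path_weightS k x : path_weight k.+1 x = path_weight k x * Q k (x k) (x k.+1).
Proof. by rewrite /path_weight big_ord_recr mulrA. Qed.

Lemma path_weight_eq k x y : icyl k x y -> path_weight k y = path_weight k x.
Proof.
move=> /icylP h; rewrite /path_weight h//; congr (_ * _).
by apply: eq_bigr => i _; rewrite !h// ltnW.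
Qed.

Lemma flip_ratio_gt0 j x : 0 < flip_ratio j x.
Proof. by case: j => [|j]; rewrite divr_gt0 ?mulr_gt0. Qed.

Lemma flip_ratio_window j x y : icyl j.+1 x y -> flip_ratio j x = flip_ratio j y.
Proof.
by case: j => [|j] /icylP h; rewrite /flip_ratio !h//; exact: leq_trans (leqnSn _) (leqnSn _).
Qed.

Lemma path_weight_flip j k x : (j < k)%N ->
  path_weight k (flip j x) = flip_ratio j x * path_weight k x.
Proof.
elim: k => // k IH; rewrite ltnS leq_eqVlt => /predU1P[->|jk]; last first.
  have [n1 n2] : k != j /\ k.+1 != j by split; lia.
  by rewrite !path_weightS IH// !flip_other// mulrA.
case: k {IH} => [|k].
  rewrite /path_weight !big_ord1 /= flip_same flip_other// divfK// lt0r_neq0// mulr_gt0//.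
rewrite !path_weightS (@path_weight_eq _ x); last by apply: cyl_sym; exact: flip_small.
rewrite flip_same !flip_other//; last by rewrite neq_ltn ltnSn.
  rewrite /flip_ratio -!mulrA; field; rewrite !lt0r_neq0//.
by rewrite neq_ltn ltnSn orbT.
Qed.
End markov_weights.

Definition shift_marginal {R : realType} (l : 'I_2 -> R) (P : nat -> 'M[R]_2) (b : 'I_2) : R :=
  l 0 * P 0%N 0 b + l 1 * P 0%N 1 b.

Lemma measurable_shift1 : measurable_fun setT shift1.
Proof. by apply: measurable_fun_path => i b; exact: (@measurable_coord nat i.+1 b). Qed.

HB.instance Definition _ := isMeasurableFun.Build _ _ _ _ shift1 measurable_shift1.

Section nonsingular_shift.
Context {R : realType}.
Variables (lambda : 'I_2 -> R) (P : nat -> 'M[R]_2) (mu : probability X1 R).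
Hypothesis hmu : nonsingular_markov_shift lambda P mu.
Local Notation mu1 := (distribution mu shift1).
Local Notation lambda1 := (shift_marginal lambda P).
Local Notation P1 := (fun n => P n.+1).

Lemma lambda_gt0 a : 0 < lambda a. Proof. by case: hmu => -[]. Qed.
Lemma transition_gt0 n a b : 0 < P n a b. Proof. by case: hmu => _ []. Qed.
Lemma shift_marginal_gt0 b : 0 < lambda1 b.
Proof. by rewrite addr_gt0// mulr_gt0 ?lambda_gt0 ?transition_gt0. Qed.

Lemma mu_icyl k x : mu (icyl k x) = (path_weight lambda P k x)%:E.
Proof.
case: hmu => _ _ h _ _; rewrite -h; congr (mu _).
by apply/seteqP; split => y; [move=> /icylP|move=> ?; apply/icylP].
Qed.

Lemma mu_pos k x : (0 < mu (icyl k x))%E.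
Proof. by rewrite mu_icyl lte_fin; apply: path_weight_gt0 => *; [exact: lambda_gt0|exact: transition_gt0]. Qed.

Lemma mu_ratio j k x : (j < k)%N ->
  mu (icyl k (flip j x)) = ((flip_ratio lambda P j x)%:E * mu (icyl k x))%E.
Proof.
move=> jk; rewrite !mu_icyl -EFinM path_weight_flip//; [exact: lambda_gt0|exact: transition_gt0].
Qed.

Lemma mu1_icyl k x : mu1 (icyl k x) = (path_weight lambda1 P1 k x)%:E.
Proof.
pose y b : X1 := fun i => if i is i'.+1 then x i' else b.
have yE b : path_weight lambda P k.+1 (y b) = lambda b * P 0%N b (x 0%N) *
    \prod_(i < k) P i.+1 (x i) (x i.+1).
  by rewrite /path_weight big_ord_recl /= mulrA.
rewrite /distribution /pushforward (_ : _ @^-1` _ = icyl k.+1 (y 0) `|` icyl k.+1 (y 1)).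
  rewrite measureU; [|exact: measurable_icyl..|].
    transitivity ((path_weight lambda P k.+1 (y 0))%:E + (path_weight lambda P k.+1 (y 1))%:E)%E.
      by congr (_ + _)%E; exact: mu_icyl.
    by rewrite -EFinD !yE -mulrDl.
  by apply/seteqP; split => // z [/icylP/(_ 0%N isT)/= e0 /icylP/(_ 0%N isT)/= e1]; move: e1; rewrite e0.
apply/seteqP; split => z /=.
  move=> /icylP h; case: (ord2P (z 0%N)) => z0; [left|right];
    by apply/icylP => -[_|i ik]//=; exact: h.
by case=> /icylP h; apply/icylP => i ik; exact: (h i.+1).
Qed.

Lemma mu1_pos k x : (0 < mu1 (icyl k x))%E.
Proof.
by rewrite mu1_icyl lte_fin; apply: path_weight_gt0 => *; [exact: shift_marginal_gt0|exact: transition_gt0].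
Qed.

Lemma mu1_ratio j k x : (j < k)%N ->
  mu1 (icyl k (flip j x)) = ((flip_ratio lambda1 P1 j x)%:E * mu1 (icyl k x))%E.
Proof.
move=> jk; rewrite !mu1_icyl -EFinM path_weight_flip//; last by move=> *; exact: transition_gt0.
exact: shift_marginal_gt0.
Qed.

Lemma shift_density_exists : exists g : X1 -> R,
  [/\ measurable_fun setT g, (forall x, 0 < g x) &
      forall A, measurable A -> (mu (shift1 @^-1` A) = \int[mu]_(x in A) (g x)%:E)%E].
Proof.
have [_ _ _ _ [dom1 dom2]] := hmu.
have [f [f0 ffin fint fE]] := @radon_nikodym_sigma_finite _ _ _ mu mu1 dom1.
have mf := measurable_int _ fint.
have mf' : measurable_fun setT (fine \o f).
  apply/measurable_EFinP; rewrite (_ : EFin \o _ = f)//.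
  by apply/funext => x /=; rewrite fineK.
pose Z := [set x | fine (f x) <= 0].
have mZ : measurable Z.
  rewrite -[X in measurable X]setTI; exact: (@measurable_fun_ler _ _ _ _ (fine \o f) (cst 0)).
have Z0 : mu Z = 0%E.
  have H := (null_content_dominatesP mu mu1).1 dom2.
  apply: (H Z mZ); apply: etrans (fE Z mZ) _; apply: integral0_eq => x Zx.
  apply/eqP; rewrite eq_le f0 andbT -(fineK (ffin x)) lee_fin; exact: Zx.
(* The zeros of the derivative form a null set, where the value 1 makes the density positive
   everywhere. *)
exists (fun x => if fine (f x) <= 0 then 1 else fine (f x)); split.
- apply: measurable_fun_ifT => //.
  exact: (@measurable_fun_ler _ _ _ _ (fine \o f) (cst 0)).
- by move=> x; case: ifPn => [_|]; rewrite ?ltr01// -ltNge.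
move=> A mA; rewrite -[LHS]/(mu1 A) fE//; apply: ae_eq_integral => //.
- exact: measurable_funTS.
- apply: measurable_funTS; apply/measurable_EFinP; apply: measurable_fun_ifT => //.
  exact: (@measurable_fun_ler _ _ _ _ (fine \o f) (cst 0)).
exists Z; split => // x /=; apply: contra_notP => nZ _; case: ifPn => // _.
by rewrite fineK.
Qed.

Lemma shift1_null A : measurable A -> mu A = 0%E -> mu (shift1 @^-1` A) = 0%E.
Proof.
by have [_ _ _ _ [dom1 _]] := hmu; exact: (null_content_dominatesP mu1 mu).1 dom1 A.
Qed.

Local Notation J := (flip_ratio lambda P).
Local Notation J1 := (flip_ratio lambda1 P1).

Lemma J_gt0 j x : 0 < J j x.
Proof. exact: flip_ratio_gt0 lambda_gt0 transition_gt0 j x. Qed.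

Lemma J1_gt0 j x : 0 < J1 j x.
Proof. exact: flip_ratio_gt0 shift_marginal_gt0 (fun n => transition_gt0 n.+1) j x. Qed.

Lemma mJ j : measurable_fun setT (J j).
Proof. apply: measurable_J; exact: flip_ratio_window. Qed.

Lemma mJ1 j : measurable_fun setT (J1 j).
Proof. apply: measurable_J; exact: flip_ratio_window. Qed.

Lemma mu_flip_integral (j : nat) (h : X1 -> \bar R) : measurable_fun setT h ->
  (forall x, 0 <= h x)%E ->
  (\int[mu]_x (h (flip j x) * (J j x)%:E) = \int[mu]_x h x)%E.
Proof. exact: (flip_integral mu_pos J_gt0 (@flip_ratio_window _ _ _) mu_ratio). Qed.

Lemma mu1_flip_integral (j : nat) (h : X1 -> \bar R) : measurable_fun setT h ->
  (forall x, 0 <= h x)%E ->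
  (\int[mu1]_x (h (flip j x) * (J1 j x)%:E) = \int[mu1]_x h x)%E.
Proof. exact: (flip_integral mu1_pos J1_gt0 (@flip_ratio_window _ _ _) mu1_ratio). Qed.

(** With [h = 1_A J] the indicator of the preimage is [h (flip x) J(x)], since the values of [J] at
    a point and at its flip are inverse. *)
Lemma flip_null j A : measurable A -> mu A = 0%E -> mu (flip j @^-1` A) = 0%E.
Proof.
move=> mA A0; have mf := measurable_flip j.
have mfA : measurable (flip j @^-1` A) by rewrite -[X in measurable X]setTI; exact: mf.
have E x : J j (flip j x) * J j x = 1.
  rewrite (J_flip mu_pos J_gt0 mu_ratio) mulVf//.
  exact/lt0r_neq0/J_gt0.
pose h x : \bar R := ((\1_A x * J j x)%:E)%E.
have mh : measurable_fun setT h.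
  by apply/measurable_EFinP; apply: measurable_funM; [exact: measurable_indic|exact: mJ].
have h0 x : (0 <= h x)%E by rewrite lee_fin mulr_ge0// ltW// J_gt0.
transitivity (\int[mu]_x (h (flip j x) * (J j x)%:E)%E)%E.
  transitivity (\int[mu]_x (\1_(flip j @^-1` A) x)%:E)%E.
    by rewrite integral_indic// setIT.
  by apply: eq_integral => x _; rewrite /h -EFinM -mulrA E mulr1.
rewrite mu_flip_integral// -(@integral0 _ _ _ mu setT); apply: ae_eq_integral => //.
exists A; split => // x; apply: contra_notP => nA _.
by rewrite /h indicE memNset// mul0r.
Qed.

Lemma ae_flip j (Q : X1 -> Prop) : {ae mu, forall x, Q x} -> {ae mu, forall x, Q (flip j x)}.
Proof. by apply: ae_pullback; [exact: measurable_flip|exact: flip_null]. Qed.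

Lemma ae_shift1 (Q : X1 -> Prop) : {ae mu, forall x, Q x} -> {ae mu, forall x, Q (shift1 x)}.
Proof. by apply: ae_pullback; [exact: measurable_shift1|exact: shift1_null]. Qed.

Variable g : X1 -> R.
Hypotheses (mg : measurable_fun setT g) (g_gt0 : forall x, 0 < g x)
  (gE : forall A, measurable A -> (mu (shift1 @^-1` A) = \int[mu]_(x in A) (g x)%:E)%E).

(* Both sides are the density of [A |-> mu (shift1 @^-1` (flip j @^-1` A))]. *)
Lemma density_flip j : {ae mu, forall z, g (flip j z) * J j z = g z * J1 j z}.
Proof.
have mf := measurable_flip j.
have g0 x : 0 <= g x by rewrite ltW.
have mu1E (f : X1 -> \bar R) : measurable_fun setT f -> (forall x, 0 <= f x)%E ->
    (\int[mu1]_x f x = \int[mu]_x (f x * (g x)%:E))%E.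
  by move=> *; apply: (@integral_density _ _ _ _ _ mu1 mu id g f).
pose u z : \bar R := (g (flip j z) * J j z)%:E.
pose v z : \bar R := (g z * J1 j z)%:E.
have mgf : measurable_fun setT (fun z => g (flip j z)) by apply: measurableT_comp mg mf.
have mu_ : measurable_fun setT u.
  by apply/measurable_EFinP; apply: measurable_funM => //; exact: mJ.
have mv : measurable_fun setT v.
  by apply/measurable_EFinP; apply: measurable_funM => //; exact: mJ1.
have u0 z : (0 <= u z)%E by rewrite lee_fin mulr_ge0// ltW// J_gt0.
have v0 z : (0 <= v z)%E by rewrite lee_fin mulr_ge0// ltW// J1_gt0.
have uE A : measurable A -> (\int[mu]_(z in A) u z = mu1 (flip j @^-1` A))%E.
  move=> mA.
  have mfA : measurable (flip j @^-1` A) by rewrite -[X in measurable X]setTI; exact: mf.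
  pose h x : \bar R := ((\1_A (flip j x) * g x)%:E)%E.
  have mh : measurable_fun setT h.
    apply/measurable_EFinP; apply: measurable_funM => //.
    by apply: measurableT_comp mf; exact: measurable_indic.
  have h0 x : (0 <= h x)%E by rewrite lee_fin mulr_ge0.
  transitivity (\int[mu]_x (h (flip j x) * (J j x)%:E))%E.
    rewrite integral_mkcond; apply: eq_integral => x _; rewrite /h flipK patchE indicE.
    by case: ifPn => _; rewrite /= ?mul1r ?mul0r ?mul0e// EFinM.
  rewrite mu_flip_integral//; apply: etrans (esym (gE mfA)).
  rewrite [RHS]integral_mkcond; apply: eq_integral => x _; rewrite patchE /h indicE.
  by rewrite (_ : (x \in flip j @^-1` A) = (flip j x \in A))//; case: ifPn => _; rewrite /= ?mul1r ?mul0r.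
have vE A : measurable A -> (\int[mu]_(z in A) v z = mu1 (flip j @^-1` A))%E.
  move=> mA.
  have mfA : measurable (flip j @^-1` A) by rewrite -[X in measurable X]setTI; exact: mf.
  pose h x : \bar R := ((\1_A (flip j x))%:E)%E.
  have mh : measurable_fun setT h.
    by apply/measurable_EFinP; apply: measurableT_comp mf; exact: measurable_indic.
  have h0 x : (0 <= h x)%E by rewrite lee_fin.
  transitivity (\int[mu1]_x (h (flip j x) * (J1 j x)%:E))%E.
    rewrite mu1E; last 2 first.
    - apply: emeasurable_funM; last by apply/measurable_EFinP; exact: mJ1.
      exact: measurableT_comp mh mf.
    - by move=> x; rewrite mule_ge0// lee_fin ltW// J1_gt0.
    rewrite integral_mkcond; apply: eq_integral => x _; rewrite /h flipK patchE indicE.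
    by case: ifPn => _; rewrite /= ?mul1e ?mul0e// -EFinM mulrC.
  rewrite mu1_flip_integral//; rewrite -[RHS]/(mu1 _) -[in RHS](setIT (flip j @^-1` A)).
  by rewrite -integral_indic.
suff : ae_eq mu setT u v by apply: filterS => x /(_ I) [].
apply: integral_ae_eq => //; last by move=> A _ mA; rewrite uE// vE.
apply/integrableP; split => //.
under eq_integral do rewrite gee0_abs//.
by rewrite uE// preimage_setT probability_setT ltry.
Qed.

(** Found by solving the recursion [rho_step]. For [j > 0] the ratio [J1 j] at the shifted path is
    [J j.+1] at the path itself, so the quotients telescope; what is left is this function of the
    letters at [j], [j.+1], [j.+2], divided by [J j.+1]. *)
Definition rho_num (s : 'I_2 * 'I_2 * 'I_2) : R :=
  let: (a, b, c) := s in
  (lambda (flip_letter b) * P 0%N (flip_letter b) c * (lambda1 b * P 0%N a (flip_letter b))) /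
  (lambda b * P 0%N b c * (lambda1 (flip_letter b) * P 0%N a b)).

(** The shift forgets coordinate [0], hence the factor 1 there. *)
Definition rho (j : nat) (x : X1) : R :=
  if j is i.+1 then rho_num (x i, x i.+1, x i.+2) / J j x else 1.

Lemma rho_num_gt0 s : 0 < rho_num s.
Proof.
case: s => -[a b] c; have h := lambda_gt0; have h' := transition_gt0; have h1 := shift_marginal_gt0.
by rewrite divr_gt0 ?mulr_gt0.
Qed.

Lemma rho_gt0 j x : 0 < rho j x.
Proof. by case: j => [|j]; rewrite /rho ?ltr01//; exact: divr_gt0 (rho_num_gt0 _) (J_gt0 _ _). Qed.

Lemma rho_window j (x y : X1) : icyl j.+1 x y -> rho j x = rho j y.
Proof.
case: j => [//|j] h; rewrite /rho (flip_ratio_window _ _ h); move/icylP : h => h.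
by congr (rho_num (_, _, _) / _); rewrite h//; lia.
Qed.

Lemma rho_step j y :
  rho j.+1 y = rho j (shift1 y) * J j (shift1 y) / J1 j (shift1 y).
Proof.
have h a : lambda a != 0 by exact/lt0r_neq0/lambda_gt0.
have h' n a b : P n a b != 0 by exact/lt0r_neq0/transition_gt0.
have h1 b : lambda1 b != 0 by exact/lt0r_neq0/shift_marginal_gt0.
case: j => [|j]; last first.
  have -> : rho j.+1 (shift1 y) =
    rho_num (y j.+1, y j.+2, y j.+3) / J j.+1 (shift1 y) by [].
  by rewrite divfK// lt0r_neq0// J_gt0.
rewrite /rho /rho_num /= /shift1; field.
by rewrite !h !h' !h1.
Qed.

Variable kappa : {sigma_finite_measure set (measurableTypeR R) -> \bar R}.
Hypothesis hk : maharam_fibre_measure kappa.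

Lemma ae_scale (c : R) (Q : R -> Prop) : 0 < c ->
  {ae kappa, forall t, Q t} -> {ae kappa, forall t, Q (scale c t)}.
Proof.
move=> c0; apply: ae_pullback; first exact: measurable_scale.
by move=> A mA A0; apply: etrans (kappa_scale hk c0 mA) _; rewrite [X in (_ * X)%E]A0 mule0.
Qed.

(** A tail function [a 0] comes with the functions [a n] through which it factors after [n] steps of
    the skew product. *)
Variable a : nat -> X1 * measurableTypeR R -> R.
Hypotheses (ma : forall n, measurable_fun setT (a n)) (a01 : forall n w, 0 <= a n w <= 1)
  (aS : forall n, {ae mu, forall y, {ae kappa, forall t,
     a n (y, t) = a n.+1 (shift1 y, scale (g (shift1 y))^-1 t)}}).

(** A flip at [j.+1] is a flip at [j] after one step of the skew product, and the change of [g]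
    under that flip is known from [density_flip]. *)
Lemma tail_flip j n : {ae mu, forall y, {ae kappa, forall t,
  a n (flip j y, t) = a n (y, scale (rho j y) t)}}.
Proof.
elim: j n => [|j IH] n.
  apply: filterS2 (aS n) (ae_flip 0 (aS n)) => y h1 h2.
  apply: filterS2 h1 h2 => t h1 h2; rewrite h2 (_ : shift1 (flip 0 y) = shift1 y); last first.
    by apply/funext => i; rewrite /shift1 flip_other.
  by rewrite -h1 /rho /scale mul1r.
have H := ae_shift1 (density_flip j); move: (ae_shift1 (IH n.+1)); apply: filter_app.
apply: filterS3 (aS n) (ae_flip j.+1 (aS n)) H => y h1 h2 h4 h3.
have Sf : shift1 (flip j.+1 y) = flip j (shift1 y).
  apply/funext => i; rewrite /shift1; have [->|ij] := eqVneq i j; first by rewrite !flip_same.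
  by rewrite !flip_other.
have c0 : 0 < (g (flip j (shift1 y)))^-1 by rewrite invr_gt0.
rewrite Sf in h2; apply: filterS3 (ae_scale (rho_gt0 j.+1 y) h1) h2 (ae_scale c0 h3) => t -> -> ->.
congr (a _ (_, _)); rewrite /scale rho_step !mulrA; congr (_ * _).
have n0 z : g z != 0 by exact/lt0r_neq0/g_gt0.
have n1 : J1 j (shift1 y) != 0 by exact/lt0r_neq0/J1_gt0.
have -> : J j (shift1 y) = g (shift1 y) * J1 j (shift1 y) / g (flip j (shift1 y)).
  by rewrite -h4 mulrAC divff ?mul1r.
by field; rewrite !n0 n1.
Qed.

Lemma tail_covariant n : covariant mu kappa rho (a n).
Proof. by split => // j; exact: tail_flip. Qed.

Variable alpha : R.
Hypothesis alpha_gt0 : 0 < alpha.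

Definition J_odd (s : 'I_2 * 'I_2 * 'I_2) (n : nat) : R :=
  let: (a, b, c) := s in
  (P n.*2 a (flip_letter b) * P n.*2.+1 (flip_letter b) c) / (P n.*2 a b * P n.*2.+1 b c).

(** The ratio in the theorem compares letter 1 with letter 0 in the middle of a block, whereas
    [J_odd] compares the flipped letter with the present one. They are equal or inverse according to
    the present letter, hence the two cases for the limit of [rho_num / J_odd]. *)
Definition rho_limit (s : 'I_2 * 'I_2 * 'I_2) : R :=
  if s.1.2 == 0 then rho_num s / alpha else rho_num s * alpha.

Lemma J_odd_gt0 s n : 0 < J_odd s n.
Proof. by case: s => -[b c] d; rewrite /J_odd; have h := transition_gt0; rewrite divr_gt0 ?mulr_gt0. Qed.

Lemma ratio_J_odd n x : ratio P (odd_coordinates x) n =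
  if (triple n x).1.2 == 0 then J_odd (triple n x) n else (J_odd (triple n x) n)^-1.
Proof.
rewrite /ratio /odd_coordinates /triple /= doubleS /J_odd /flip_letter.
by case: (ord2P (x n.*2.+1)) => ->; rewrite /= ?invf_div.
Qed.

Lemma nneseries_subsequence (u : nat -> R) (n : nat -> nat) : (forall k, 0 <= u k) ->
  {homo n : i j / (i < j)%N} ->
  (\sum_(j <oo) (u (n j))%:E <= \sum_(k <oo) (u k)%:E)%E.
Proof.
move=> u0 hn; apply: lime_le; first by apply: is_cvg_nneseries => *; rewrite lee_fin.
apply: nearW => N; apply: (@le_trans _ _ (\sum_(0 <= k < n N) (u k)%:E)%E); last first.
  by apply: nneseries_lim_ge => *; rewrite lee_fin.
rewrite !sumEFin lee_fin; elim: N => [|N IH]; first by rewrite big_geq// sumr_ge0.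
rewrite big_nat_recr//= (@big_cat_nat _ _ _ (n N) 0 (n N.+1))//=; last exact/ltnW/hn.
rewrite lerD// big_ltn; last exact: hn.
by rewrite lerDl sumr_ge0.
Qed.

Lemma rho_limit_bilip s : exists c1 c2, [/\ 0 < c1, 0 < c2 &
  forall n x, triple n x = s ->
  `|ratio P (odd_coordinates x) n - alpha| <= alpha / 2 ->
  `|rho_num s / J_odd s n - rho_limit s| <=
     c1 * `|ratio P (odd_coordinates x) n - alpha| /\
  `|ratio P (odd_coordinates x) n - alpha| <=
     c2 * `|rho_num s / J_odd s n - rho_limit s|].
Proof.
have m0 := rho_num_gt0 s; set m := rho_num s in m0 *.
have [b0|b0] := boolP (s.1.2 == 0); last first.
  exists m, m^-1; split; rewrite ?invr_gt0// => n x xs _.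
  rewrite ratio_J_odd xs (negbTE b0) /rho_limit (negbTE b0) -/m -mulrBr.
  by rewrite normrM (gtr0_norm m0) mulKf ?lt0r_neq0.
exists (2 * m / alpha ^+ 2), (2 * alpha ^+ 2 / m).
split; rewrite ?divr_gt0 ?mulr_gt0 ?exprn_gt0// => n x xs.
rewrite ratio_J_odd xs b0 /rho_limit b0 -/m; have J0 := J_odd_gt0 s n.
set r := J_odd s n in J0 * => h.
have r1 : alpha / 2 <= r by move: h; rewrite ler_norml => /andP[? _]; lra.
have r2 : r <= 2 * alpha by move: h; rewrite ler_norml => /andP[_ ?]; lra.
have -> : m / r - m / alpha = m / (r * alpha) * (alpha - r).
  by field; rewrite !lt0r_neq0.
have ra : 0 < r * alpha by rewrite mulr_gt0.
rewrite normrM (distrC alpha) (gtr0_norm (divr_gt0 m0 ra)); split.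
  apply: ler_wpM2r => //; rewrite ler_pdivrMr// mulrAC ler_pdivlMr ?exprn_gt0//.
  rewrite -mulrA mulrCA ler_pM2l// expr2 mulrA ler_pM2r//; lra.
rewrite mulrA -[leLHS]mul1r; apply: ler_wpM2r => //.
rewrite mulrA ler_pdivlMr// mul1r divfK ?lt0r_neq0// expr2 mulrA ler_pM2r//.
Qed.

(** The divergent sum along the good sequence splits into eight sums according to the triple, and
    one of them diverges. *)
Lemma good_cover x : good_point (ratio P (odd_coordinates x)) alpha ->
  exists s, good_set rho_limit (fun s n => rho_num s / J_odd s n) s x.
Proof.
move=> [_ [n [hn rn sumn]]].
pose r k := ratio P (odd_coordinates x) k.
pose u s j := if triple (n j) x == s then (alpha - r (n j)) ^+ 2 else 0.
have u0 s j : 0 <= u s j by rewrite /u; case: ifP => // _; exact: sqr_ge0.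
have [s us] : exists s, (\sum_(j <oo) (u s j)%:E = +oo)%E.
  apply: contrapT => hs; move: sumn.
  rewrite (@eq_eseriesr _ _ (fun j => \sum_s (u s j)%:E)%E); last first.
    move=> j _; rewrite sumEFin (bigD1 (triple (n j) x))//= big1 ?addr0 /u ?eqxx//.
    by move=> s /negbTE; rewrite eq_sym => ->.
  rewrite nneseries_sum; last by move=> *; rewrite lee_fin.
  apply/eqP; rewrite lt_eqF//; apply/lte_sum_pinfty => s _.
  by rewrite ltey; apply/eqP => h; apply: hs; exists s.
have [c1 [c2 [c10 c20 lip]]] := rho_limit_bilip s.
exists s => i; apply/eqP; rewrite -leye_eq leNgt; apply/negP => fin.
have {}fin := le_lt_trans (nneseries_subsequence (fun k => good_term_ge0 _ _ _ _ k x) hn) fin.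
(* The first bound makes the bi-Lipschitz comparison applicable; the second keeps the factors below
   the cut-off after multiplication by [c1]. *)
pose e : R := Num.min (alpha / 2) (i.+1%:R^-1 / c1 / 2).
have e0 : 0 < e by rewrite lt_min !divr_gt0// invr_gt0.
have [N hN] := (cvg_dist_leP _ _).1 rn _ e0.
suff : (\sum_(j <oo) (u s j)%:E < +oo)%E by rewrite us ltxx.
apply: (nneseries_compare (c := c2 ^+ 2) (N := N)) fin => //.
- by move=> j; exact: good_term_ge0.
- exact: sqr_ge0.
move=> j Nj; rewrite /u; case: ifPn => [/eqP cs|_]; last first.
  by rewrite mulr_ge0 ?sqr_ge0 ?good_term_ge0.
have hj := hN j Nj; have hja : `|r (n j) - alpha| <= alpha / 2.
  by apply: le_trans hj _; rewrite ge_min lexx.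
have [l1 l2] := lip _ _ cs hja.
rewrite /good_term cs eqxx /= ifT.
  rewrite -exprMn -[leLHS]real_normK ?num_real// -[leRHS]real_normK ?num_real//.
  rewrite ler_pXn2r ?nnegrE// distrC; apply: le_trans l2 _.
  by rewrite normrM ler_wpM2r// ler_norm.
apply: le_lt_trans l1 _; apply: le_lt_trans (ler_wpM2l (ltW c10) hj) _.
have h : e <= i.+1%:R^-1 / c1 / 2 by rewrite ge_min lexx orbT.
have i0 : 0 < i.+1%:R^-1 :> R by rewrite invr_gt0.
apply: le_lt_trans (ler_wpM2l (ltW c10) h) _.
rewrite mulrA (mulrC c1) divfK ?lt0r_neq0//.
by move: i0; move: (i.+1%:R^-1) => t t0; lra.
Qed.

Hypothesis good_alpha :
  {ae (pushforward mu odd_coordinates : set X1 -> \bar R),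
     forall x, good_point (ratio P x) alpha}.

Lemma measurable_odd_coordinates : measurable_fun setT odd_coordinates.
Proof. by apply: measurable_fun_path => i b; exact: (@measurable_coord nat i.*2 b). Qed.

Lemma tail_trivial : exists c, {ae mu, forall x, {ae kappa, forall t, a 0%N (x, t) = c}}.
Proof.
have cover : {ae mu, forall x, exists s,
    good_set rho_limit (fun s n => rho_num s / J_odd s n) s x}.
  have [A [mA A0 hA]] := good_alpha.
  exists (odd_coordinates @^-1` A); split => //.
    by rewrite -[X in measurable X]setTI; exact: measurable_odd_coordinates.
  by move=> x nx; apply: hA => /= gx; apply: nx; exact: good_cover.
apply: (covariant_cst mu_pos J_gt0 _ mu_ratio hk rho_gt0 rho_window rho_num_gt0 _ _ _ _ cover).
- exact: flip_ratio_window.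
- by move=> s; rewrite /rho_limit; have := rho_num_gt0 s; case: ifP => _ ?; rewrite ?divr_gt0 ?mulr_gt0.
- by move=> s n; rewrite divr_gt0 ?rho_num_gt0 ?J_odd_gt0.
- by [].
- move=> n x; rewrite invf_div mulrCA divff ?mulr1//; exact/lt0r_neq0/rho_num_gt0.
exact: tail_covariant.
Qed.

End nonsingular_shift.

(** * The natural extension *)

Lemma measurable_inv_pos {R : realType} d (T : measurableType d) (f : T -> R) :
  measurable_fun setT f -> (forall x, 0 < f x) -> measurable_fun setT (fun x => (f x)^-1).
Proof.
move=> mf f0; rewrite (_ : (fun x => _) = (fun r => powR r (-1)) \o f).
  exact: measurableT_comp (measurable_powR _) mf.
by apply/funext => x /=; rewrite powR_inv1// ltW.
Qed.

(** Coordinate [1] of a two-sided path is the first letter of its future, because [lambda] sits at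
    [1] in the natural extension. *)
Definition proj (x : X2) : X1 := fun n => x n.+1%:Z.
Definition unshift2 (x : X2) : X2 := fun n => x (n - 1).

Lemma shift2K : cancel shift2 unshift2.
Proof. by move=> x; apply/funext => i; rewrite /unshift2 /shift2 subrK. Qed.

Lemma unshift2K : cancel unshift2 shift2.
Proof. by move=> x; apply/funext => i; rewrite /unshift2 /shift2 addrK. Qed.

Lemma measurable_shift2 : measurable_fun setT shift2.
Proof. by apply: measurable_fun_path => i b; exact: (@measurable_coord int (i + 1) b). Qed.

HB.instance Definition _ := isMeasurableFun.Build _ _ _ _ shift2 measurable_shift2.

Lemma measurable_unshift2 : measurable_fun setT unshift2.
Proof. by apply: measurable_fun_path => i b; exact: (@measurable_coord int (i - 1) b). Qed.

Lemma measurable_proj : measurable_fun setT proj.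
Proof. by apply: measurable_fun_path => i b; exact: (@measurable_coord int i.+1%:Z b). Qed.

Lemma proj_shift2 x : proj (shift2 x) = shift1 (proj x).
Proof. by apply/funext => n; rewrite /proj /shift1 /shift2; congr (x _); lia. Qed.

Lemma automorphism_shift2 : automorphism shift2.
Proof.
split; first exact: measurable_shift2.
by exists unshift2; split; [exact: shift2K|exact: unshift2K|exact: measurable_unshift2].
Qed.

Definition win (n m : nat) : seq int := [seq (k%:Z - n%:Z)%R | k <- iota 0 (n + m).+1].

Lemma mem_win n m (i : int) : (i \in win n m) = (- n%:Z <= i <= m%:Z).
Proof.
apply/mapP/idP => [[k]|h]; first by rewrite mem_iota => h ->; lia.
by exists (absz (i + n%:Z)); [rewrite mem_iota|]; lia.
Qed.

Lemma cyl_same (J J' : seq int) (x : X2) :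
  (forall i : int, (i \in J) = (i \in J')) -> cyl J x = cyl J' x.
Proof. by move=> h; apply/seteqP; split; apply: cyl_sub => i; rewrite h. Qed.

Lemma win_absorb n m (J : seq int) : {subset J <= win n m} ->
  forall n' m', (n <= n')%N -> (m <= m')%N -> {subset J <= win n' m'}.
Proof. by move=> h n' m' nn mm i /h; rewrite !mem_win; lia. Qed.

Lemma win_exhaust (J : seq int) : exists k, {subset J <= win k k}.
Proof.
elim: J => [|i J [k IH]]; first by exists 0%N.
exists (maxn k (absz i)) => j; rewrite inE => /predU1P[->|/IH]; rewrite !mem_win; lia.
Qed.

Section natural_extension.
Context {R : realType}.
Variables (lambda : 'I_2 -> R) (P : nat -> 'M[R]_2)
  (mu : probability X1 R) (tmu : probability X2 R).
Hypotheses (hmu : nonsingular_markov_shift lambda P mu)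
  (htmu : natural_extension_measure lambda P tmu).
Local Notation Q := (backward_matrix lambda P).
Local Notation lambda1 := (shift_marginal lambda P).

(** The conditional probability of the letters of [x] at [-n, ..., 0] given the letter [b] at
    [1]. *)
Definition past_weight (n : nat) (x : X2) (b : 'I_2) : R :=
  Q (x 0) b * \prod_(k < n) Q (x (- k.+1%:Z)) (x (- k%:Z)).

Lemma backward_sum b : Q 0 b + Q 1 b = 1.
Proof.
rewrite /backward_matrix -mulrDl divff// lt0r_neq0//.
exact: shift_marginal_gt0 hmu b.
Qed.

Lemma backward_gt0 a b : 0 < Q a b.
Proof.
rewrite divr_gt0//; last exact: shift_marginal_gt0 hmu b.
by rewrite mulr_gt0// ?(lambda_gt0 hmu) ?(transition_gt0 hmu).
Qed.

Lemma past_weight_gt0 n x b : 0 < past_weight n x b.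
Proof.
rewrite mulr_gt0 ?backward_gt0//; elim/big_ind: _ => // *; [exact: mulr_gt0|exact: backward_gt0].
Qed.

(** The measure is prescribed on symmetric windows. Shortening the past sums out the leftmost
    letter, and the columns of the backward matrix have sum one. *)
Lemma tmu_win n m x : (0 < m)%N -> (n <= m)%N ->
  tmu (cyl (win n m) x) = (past_weight n x (x 1) * path_weight lambda P m.-1 (proj x))%:E.
Proof.
move=> m0 nm; rewrite -(subKn nm); move: (m - n)%N (leq_subr n m) => d {n nm}.
elim: d x => [|d IH] x dm.
  rewrite subn0; have -> : cyl (win m m) x =
      [set z | forall i : int, - m%:Z <= i <= m%:Z -> z i = x i].
    by apply/seteqP; split => z h i; [rewrite -mem_win|rewrite mem_win]; exact: h.
  rewrite htmu//; congr EFin; rewrite /past_weight /path_weight big_ord_recl.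
  rewrite oppr0 subr0 mulrA; congr (Q _ _ * _ * _ * _).
  by apply: eq_bigr => k _; congr (Q (x _) (x _)); rewrite ?lift0; lia.
have IH' b : tmu (cyl ((- (m - d)%:Z) :: win (m - d.+1) m) (upd x (- (m - d)%:Z) b)) =
    (past_weight (m - d.+1) x (x 1) * path_weight lambda P m.-1 (proj x) *
      Q b (x (- (m - d.+1)%:Z)))%:E.
  set y := upd _ _ _.
  have -> : cyl (- (m - d)%:Z :: win (m - d.+1) m) y = cyl (win (m - d) m) y.
    by apply: cyl_same => i; rewrite inE !mem_win; lia.
  rewrite IH; last by rewrite ltnW.
  have yE (i : int) : (- (m - d)%:Z < i)%R -> y i = x i.
    by move=> h; rewrite /y upd_other//; apply/eqP; lia.
  have -> : path_weight lambda P m.-1 (proj y) = path_weight lambda P m.-1 (proj x).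
    by congr path_weight; apply/funext => i; rewrite /proj yE//; lia.
  rewrite /past_weight !yE; [|lia..].
  have -> : (m - d = (m - d.+1).+1)%N by lia.
  rewrite big_ord_recr /=; congr EFin.
  have e1 : - (m - d.+1).+1%:Z = - (m - d)%:Z :> int by lia.
  have ys : y (- (m - d)%:Z) = b by rewrite /y upd_same.
  rewrite e1 ys (yE (- (m - d.+1)%:Z)); last by lia.
  rewrite (eq_bigr (fun k : 'I_(m - d.+1) => Q (x (- k.+1%:Z)) (x (- k%:Z)))); first by ring.
  by move=> [k /= hk] _; rewrite !yE//; lia.
rewrite (@cyl_split _ (- (m - d)%:Z)); last by rewrite mem_win; apply/negP; lia.
rewrite measureU; [|exact: measurable_cyl..|exact: cyl_split_disj].
apply: etrans (congr2 adde (IH' 0) (IH' 1)) _.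
by rewrite -[LHS]EFinD -mulrDr backward_sum mulr1.
Qed.

Lemma cyl_past n m (x : X2) : (0 < m)%N ->
  cyl (win n m) x = cyl (win n 0) x `&` proj @^-1` icyl m.-1 (proj x).
Proof.
move=> m0; apply/seteqP; split => y.
  move=> h; split => [i|]; first by rewrite mem_win => ?; apply: h; rewrite mem_win; lia.
  by apply/icylP => i im; apply: h; rewrite mem_win; lia.
move=> [h1 /icylP h2] i; rewrite mem_win => hi.
case: i hi => [[|i]|i] hi; [by apply: h1; rewrite mem_win; lia| |by apply: h1; rewrite mem_win; lia].
by apply: h2; lia.
Qed.

(* Given the past, the future of a path is distributed according to a
   multiple of [mu] that depends on its first letter only. *)
Lemma past_future n (x : X2) (f : X1 -> \bar R) : measurable_fun setT f ->
  (forall y, 0 <= f y)%E ->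
  (\int[tmu]_(z in cyl (win n 0) x) f (proj z) =
   \int[mu]_y (f y * (past_weight n x (y 0%N))%:E))%E.
Proof.
move=> mf f0; have mC := measurable_cyl (win n 0) x.
pose h : X2 -> R := \1_(cyl (win n 0) x); pose q (y : X1) := past_weight n x (y 0%N).
have mh : measurable_fun setT h by exact: measurable_indic.
have h0 z : 0 <= h z by rewrite /h indicE.
have mq : measurable_fun setT q.
  by apply: (@measurable_fun_window _ [:: 0%N]) => y y' yy; rewrite /q yy.
have q0 y : 0 <= q y by rewrite ltW// past_weight_gt0.
pose m1 := image_density tmu measurable_proj mh h0.
pose m2 := image_density mu (@measurable_id _ _ setT) mq q0.
have m1E A : measurable A -> m1 A = tmu (cyl (win n 0) x `&` proj @^-1` A).
  move=> mA; rewrite /m1 /= /image_density -[RHS]integral_indic//.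
  by rewrite -[X in measurable X]setTI; exact: measurable_proj.
have e k y : m1 (cyl (iota 0 (k + n).+1) y) = m2 (cyl (iota 0 (k + n).+1) y).
  rewrite -/(icyl _ _) m1E; last exact: measurable_icyl.
  pose z : X2 := fun i => if i is Posz i'.+1 then y i' else x i.
  have zx (i : int) : i <= 0 -> z i = x i by case: i => // -[].
  have zC : cyl (win n 0) x = cyl (win n 0) z.
    by apply/cyl_eq => i; rewrite mem_win => ?; rewrite zx//; lia.
  have -> : y = proj z by [].
  rewrite zC -(@cyl_past n (k + n).+1)// tmu_win//; last by rewrite ltnW// ltnS leq_addl.
  rewrite /m2 /= /image_density (eq_integral (cst (q y)%:E)); last first.
    by move=> w; rewrite inE => /icylP/(_ 0%N isT) wy; rewrite /q wy.
  rewrite integral_cst//; last exact: measurable_icyl.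
  apply: etrans (esym (congr1 (fun t => (q y)%:E * t)%E (mu_icyl hmu _ _))).
  rewrite -EFinM; congr EFin; congr (_ * _); rewrite /q /past_weight zx//; congr (_ * _).
  by apply: eq_bigr => -[i /= hi] _; rewrite !zx//; lia.
have E A : measurable A -> m1 A = m2 A.
  apply: (path_measure_unique (W := fun k => iota 0 (k + n).+1)) => //.
  - pose M := past_weight n x 0 + past_weight n x 1.
    apply: (@le_lt_trans _ _ (\int[mu]_(y in setT) (cst M%:E) y)%E); last first.
      rewrite integral_cst//; apply: (@le_lt_trans _ _ (M%:E * 1)%E); last by rewrite mule1 ltry.
      by rewrite lee_wpmul2l ?probability_le1// lee_fin addr_ge0// ltW// past_weight_gt0.
    apply: ge0_le_integral => //; first exact: measurableT.
    - by move=> y _; rewrite lee_fin.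
    - by apply: measurable_funTS; apply/measurable_EFinP.
    move=> y _; rewrite lee_fin /q /M.
    by case: (ord2P (y 0%N)) => ->; rewrite ?lerDl ?lerDr ltW// past_weight_gt0.
  - move=> J; exists (\max_(i <- J) i)%N => i iJ; rewrite mem_iota /=.
    have h1 : (i <= \max_(i <- J) i)%N by rewrite (big_rem i)//= leq_maxl.
    by rewrite add0n ltnS; exact: leq_trans h1 (leq_addr _ _).
transitivity (\int[m1]_y f y)%E.
  rewrite (@integral_density _ _ _ _ _ m1 tmu proj h f)//; last exact: measurable_proj.
  rewrite [LHS]integral_mkcond; apply: eq_integral => z _; rewrite patchE /h indicE.
  by case: ifPn => _; rewrite ?mule1 ?mule0.
rewrite -(@integral_density _ _ _ _ _ m2 mu id q f)//.
by apply: eq_measure_integral => A mA _; exact: E.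
Qed.

(** Whatever the first letter of the future, the two possible letters at [0] have total conditional
    weight one. *)
Lemma tmu_proj A : measurable A -> tmu (proj @^-1` A) = mu A.
Proof.
move=> mA; have mp : measurable (proj @^-1` A).
  by rewrite -[X in measurable X]setTI; exact: measurable_proj.
pose f y : \bar R := (\1_A y)%:E.
have mf : measurable_fun setT f by apply/measurable_EFinP; exact: measurable_indic.
have f0 y : (0 <= f y)%E by rewrite lee_fin.
pose b0 (b : 'I_2) : X2 := fun=> b.
have mc b : measurable (cyl (win 0 0) (b0 b)) by exact: measurable_cyl.
have cE b : cyl (win 0 0) (b0 b) = [set z : X2 | z 0 = b].
  apply/seteqP; split => [z /(_ 0)|z zb i]; first by rewrite mem_win; apply.
  by rewrite mem_win => i0; rewrite (_ : i = 0)//; lia.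
have T : cyl (win 0 0) (b0 0) `|` cyl (win 0 0) (b0 1) = setT.
  by rewrite !cE; apply/seteqP; split => // z _; case: (ord2P (z 0)); [left|right].
have D : [disjoint cyl (win 0 0) (b0 0) & cyl (win 0 0) (b0 1)].
  by apply/disj_setPS => z; rewrite !cE => -[/= ->].
pose C0 := cyl (win 0 0) (b0 0); pose C1 := cyl (win 0 0) (b0 1).
transitivity (\int[tmu]_(z in C0 `|` C1) f (proj z))%E.
  by rewrite /C0 /C1 T -[in LHS](setIT (proj @^-1` A)) -integral_indic.
rewrite ge0_integral_setU//; [|exact: mc|exact: mc|]; last first.
  by apply: measurable_funTS; exact: measurableT_comp mf measurable_proj.
rewrite /C0 /C1 !past_future//.
have w0 b y : (0 <= f y * (past_weight 0 (b0 b) (y 0%N))%:E)%E.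
  by rewrite mule_ge0// lee_fin ltW// past_weight_gt0.
have mw b : measurable_fun setT (fun y : X1 => f y * (past_weight 0 (b0 b) (y 0%N))%:E)%E.
  apply: emeasurable_funM => //; apply/measurable_EFinP.
  by apply: (@measurable_fun_window _ [:: 0%N]) => y y' yy; rewrite yy.
rewrite -ge0_integralD//.
transitivity (\int[mu]_y f y)%E; last by rewrite integral_indic// setIT.
apply: eq_integral => y _; rewrite -ge0_muleDr ?lee_fin ?ltW ?past_weight_gt0//.
by rewrite -EFinD /past_weight !big_ord0 !mulr1 backward_sum mule1.
Qed.

Variable g : X1 -> R.
Hypotheses (mg : measurable_fun setT g) (g_gt0 : forall x, 0 < g x)
  (gE : forall A, measurable A -> (mu (shift1 @^-1` A) = \int[mu]_(x in A) (g x)%:E)%E).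

(** The pasts before and after the shift match because [Q(x_0, x_1) lambda1(x_1) = lambda(x_0)
    P(x_0, x_1)], by definition of the backward matrix. What remains is the change of the law of the
    future, given by [g]. *)
Lemma tmu_shift2 A : measurable A ->
  (tmu (shift2 @^-1` A) = \int[tmu]_(x in A) (g (proj x))%:E)%E.
Proof.
have mgp : measurable_fun setT (g \o proj) by exact: measurableT_comp mg measurable_proj.
have g0 x : 0 <= (g \o proj) x by apply: ltW; exact: g_gt0.
pose m2 := image_density tmu (@measurable_id _ _ setT) mgp g0.
pose m1 := distribution tmu shift2.
suff E : forall A, measurable A -> m2 A = m1 A by move=> mA; rewrite -[LHS](E _ mA).
apply: (@path_measure_unique _ _ _ m1 (fun k => win k.+1 k.+1)).
- by apply: le_lt_trans (probability_le1 m1 measurableT) (ltry _).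
- move=> J; have [k Jk] := win_exhaust J; exists k; exact: win_absorb Jk _ _ _ _.
move=> n x; transitivity (tmu (shift2 @^-1` cyl (win n.+1 n.+1) x)) => //.
pose y := unshift2 x.
have -> : shift2 @^-1` cyl (win n.+1 n.+1) x = cyl (win n n.+2) y.
  apply/seteqP; split => z h i; rewrite mem_win => hi.
    by have := h (i - 1); rewrite mem_win /shift2 subrK; apply; lia.
  by have := h (i + 1); rewrite mem_win /y /unshift2 addrK; apply; lia.
rewrite tmu_win//; last by lia.
have mI : measurable (icyl n (proj x)) by exact: measurable_icyl.
pose f z : \bar R := (\1_(icyl n (proj x)) z * g z)%:E.
have mf : measurable_fun setT f.
  by apply/measurable_EFinP; apply: measurable_funM => //; exact: measurable_indic.
have f0 z : (0 <= f z)%E by rewrite lee_fin mulr_ge0// ltW.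
transitivity (\int[tmu]_(z in cyl (win n.+1 0) x) f (proj z))%E.
  rewrite /m2 /= /image_density preimage_id cyl_past// [LHS]integral_mkcond [RHS]integral_mkcond.
  apply: eq_integral => z _; rewrite !patchE in_setI /f indicE.
  case: (z \in cyl (win n.+1 0) x) => //=.
  rewrite (_ : (z \in proj @^-1` _) = (proj z \in icyl n (proj x)))//.
  by case: ifPn => _; rewrite /= ?mul1r ?mul0r.
rewrite past_future//; pose c := past_weight n.+1 x (x 1).
transitivity (c%:E * \int[mu]_(z in icyl n (proj x)) (g z)%:E)%E.
  rewrite [X in (_ * X)%E]integral_mkcond -ge0_integralZl//; last 3 first.
  - rewrite -measurable_restrictT//; apply: measurable_funTS.
    exact/measurable_EFinP.
  - by move=> z _; rewrite patchE; case: ifPn => // _; rewrite lee_fin ltW.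
  - by rewrite lee_fin ltW// past_weight_gt0.
  apply: eq_integral => z _; rewrite patchE /f indicE.
  case: ifPn => [|_]; last by rewrite mul0r mul0e mule0.
  by rewrite inE => /icylP/(_ 0%N isT) z0; rewrite /= mul1r muleC z0.
rewrite -gE//; apply: etrans (congr1 (fun t => c%:E * t)%E (mu1_icyl hmu n (proj x))) _.
rewrite -EFinM; congr EFin; rewrite /c /past_weight /path_weight.
rewrite !big_ord_recl /= /proj /y /unshift2 oppr0.
rewrite (_ : 1 - 1 = 0 :> int)// (_ : 0 - 1 = - 1%:Z :> int)// (_ : 2%:Z - 1 = 1 :> int)//.
have e : Q (x 0) (x 1) * lambda1 (x 1) = lambda (x 0) * P 0%N (x 0) (x 1).
  by rewrite /backward_matrix divfK// lt0r_neq0//; exact: shift_marginal_gt0 hmu _.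
have e1 : \prod_(i < n) Q (x (- (bump 0 i).+1%:Z)) (x (- (bump 0 i)%:Z)) =
   \prod_(k < n) Q (x (- k.+1%:Z - 1)) (x (- k%:Z - 1)).
  by apply: eq_bigr => k _; congr (Q (x _) (x _)); rewrite /bump; lia.
have e2 : \prod_(i < n) P i.+1 (x i.+1%:Z) (x i.+2%:Z) =
   \prod_(i < n) P (bump 0 i) (x ((bump 0 i).+1%:Z - 1)) (x ((bump 0 i).+2%:Z - 1)).
  by apply: eq_bigr => k _; congr (P _ (x _) (x _)); rewrite /bump; lia.
rewrite e1 e2; move: e.
have alg (a b c' d l p : R) : a * l = p -> a * (b * c') * (l * d) = b * c' * (p * d).
  by move=> <-; ring.
by move=> e; rewrite [lambda _ * (_ * _)]mulrA; exact: alg.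
Qed.

Lemma tmu_shift2_integral (f : X2 -> \bar R) : measurable_fun setT f ->
  (forall x, 0 <= f x)%E ->
  (\int[tmu]_x f (shift2 x) = \int[tmu]_x (f x * (g (proj x))%:E))%E.
Proof.
move=> mf f0; rewrite -(@ge0_integral_distribution _ _ _ _ _ tmu shift2 f)//.
apply: (@integral_density _ _ _ _ _ (distribution tmu shift2) tmu id (g \o proj)) => //.
- exact: measurableT_comp mg measurable_proj.
- by move=> x; apply: ltW; exact: g_gt0.
- by move=> A mA; rewrite -tmu_shift2.
Qed.

Let mginv : measurable_fun setT (fun x : X2 => (g (proj (shift2 x)))^-1).
Proof.
apply: measurable_inv_pos => //.
exact: (measurableT_comp mg (measurableT_comp measurable_proj measurable_shift2)).
Qed.

Lemma tmu_shift2_inv A : measurable A ->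
  (tmu A = \int[tmu]_(x in shift2 @^-1` A) ((g (proj (shift2 x)))^-1)%:E)%E.
Proof.
move=> mA; pose f x : \bar R := (\1_A x / g (proj x))%:E.
have mf : measurable_fun setT f.
  apply/measurable_EFinP; apply: measurable_funM; first exact: measurable_indic.
  apply: measurable_inv_pos => //; exact: measurableT_comp mg measurable_proj.
have f0 x : (0 <= f x)%E by rewrite lee_fin divr_ge0// ltW.
transitivity (\int[tmu]_x (\1_A x)%:E)%E; first by rewrite integral_indic// setIT.
rewrite [RHS]integral_mkcond; transitivity (\int[tmu]_x f (shift2 x))%E; last first.
  apply: eq_integral => x _; rewrite /f patchE indicE.
  rewrite (_ : (x \in shift2 @^-1` A) = (shift2 x \in A))//.
  by case: ifPn => _; rewrite /= ?mul1r ?mul0r.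
rewrite tmu_shift2_integral//; apply: eq_integral => x _.
by rewrite /f -EFinM divfK// lt0r_neq0.
Qed.

Lemma nonsingular_shift2 : nonsingular_automorphism tmu shift2.
Proof.
split; first exact: automorphism_shift2.
have mgp : measurable_fun setT (fun x => (g (proj x))%:E : \bar R).
  by apply/measurable_EFinP; exact: measurableT_comp mg measurable_proj.
split; apply/null_content_dominatesP => A mA A0.
  rewrite /pushforward tmu_shift2//; apply: null_set_integral => //.
  exact: measurable_funTS.
have mA' : measurable (shift2 @^-1` A).
  by rewrite -[X in measurable X]setTI; exact: measurable_shift2.
rewrite (tmu_shift2_inv mA); apply: null_set_integral => //.
by apply: measurable_funTS; apply/measurable_EFinP.
Qed.

(** As the derivative depends on the future only, the Maharam extension acts on the future and the
    fibre coordinate without reference to the past. *)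
Lemma rn_cocycle_shift2 omega : rn_cocycle tmu shift2 omega ->
  {ae tmu, forall x, omega x = (g (shift1 (proj x)))^-1}.
Proof.
move=> [mo o0 oE].
suff : ae_eq tmu setT (EFin \o omega) (fun x => ((g (proj (shift2 x)))^-1)%:E).
  by apply: filterS => x /(_ I) [->]; rewrite proj_shift2.
have imE A : shift2 @` A = unshift2 @^-1` A.
  apply/seteqP; split => [_ [x Ax <-]|x Ax]; rewrite /= ?shift2K//.
  by exists (unshift2 x); rewrite ?unshift2K.
have mi A : measurable A -> measurable (shift2 @` A).
  by move=> mA; rewrite imE -[X in measurable X]setTI; exact: measurable_unshift2.
have oi A : measurable A -> (\int[tmu]_(x in A) (omega x)%:E =
    \int[tmu]_(x in A) ((g (proj (shift2 x)))^-1)%:E)%E.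
  move=> mA; rewrite -oE// (tmu_shift2_inv (mi _ mA)) imE -comp_preimage.
  by rewrite (_ : unshift2 \o shift2 = id)//; apply/funext => x /=; rewrite shift2K.
apply: integral_ae_eq => //; last 2 first.
- exact/measurable_EFinP.
- by move=> A _ mA; exact: oi.
apply/integrableP; split; first exact/measurable_EFinP.
under eq_integral do rewrite gee0_abs ?lee_fin ?(ltW (o0 _))//.
rewrite -oE//; apply: le_lt_trans (probability_le1 _ _) (ltry _).
exact: mi.
Qed.

End natural_extension.

(** * First returns and the Maharam extension *)

Section measure_facts.
Context {d : measure_display} {Y : measurableType d} {R : realType}.
Variable m : {measure set Y -> \bar R}.

Lemma measurable_pre d' (Y' : measurableType d') (f : Y -> Y') (A : set Y') :
  measurable_fun setT f -> measurable A -> measurable (f @^-1` A).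
Proof. by move=> mf mA; rewrite -[X in measurable X]setTI; exact: mf. Qed.

Lemma measurable_iter (f : Y -> Y) n : measurable_fun setT f -> measurable_fun setT (iter n f).
Proof.
by move=> mf; elim: n => [|n IH]; [exact: measurable_id|exact: measurableT_comp mf IH].
Qed.

Definition symdiff (A B : set Y) := (A `\` B) `|` (B `\` A).

Lemma measurable_symdiff A B : measurable A -> measurable B -> measurable (symdiff A B).
Proof. by move=> mA mB; apply: measurableU; exact: measurableD. Qed.

Lemma ae_iff_measure A B : measurable A -> measurable B ->
  {ae m, forall x, A x <-> B x} -> m A = m B.
Proof.
move=> mA mB [N [mN N0 h]]; apply/eqP; rewrite eq_le.
have H C D : measurable C -> measurable D -> (forall x, ~ N x -> C x -> D x) -> (m C <= m D)%E.
  move=> mC mD CD; apply: (@le_trans _ _ (m (D `|` N))%E).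
    apply: le_measure; rewrite ?inE//; first exact: measurableU.
    by move=> x Cx; have [Nx|nN] := pselect (N x); [right|left; exact: CD].
  by apply: le_trans (measureU2 _ mD mN) _; rewrite [X in (_ + X)%E]N0 adde0.
have AB x : ~ N x -> A x <-> B x by move=> nN; apply: contrapT => h'; apply: nN; exact: h.
by apply/andP; split; apply: H => // x /AB [].
Qed.

End measure_facts.

Section first_return.
Context {d : measure_display} {Y : measurableType d} {R : realType}.
Variables (m : {measure set Y -> \bar R}) (N : Y -> Y) (G : set Y).
Hypotheses (mN : measurable_fun setT N)
  (NP : forall A, measurable A -> m (N @^-1` A) = m A) (mG : measurable G).

Definition avoiding k : set Y := [set w | forall j, (j < k)%N -> ~ G (iter j N w)].

(** For [A] inside [G], the preimage of [A] under the first return map to [G]. The index [k] counts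
    the steps spent outside [G], so the return time is [k.+1]. *)
Definition first_return (A : set Y) : set Y :=
  G `&` \bigcup_k (N @^-1` (avoiding k `&` iter k N @^-1` A)).

Lemma measurable_avoiding k : measurable (avoiding k).
Proof.
rewrite (_ : avoiding k = \bigcap_(j in [set j | (j < k)%N]) iter j N @^-1` (~` G))//.
by apply: bigcap_measurableType => j _; apply: measurable_pre; [exact: measurable_iter|exact: measurableC].
Qed.

Let mA' k A : measurable A -> measurable (avoiding k `&` iter k N @^-1` A).
Proof.
move=> mA; apply: measurableI; first exact: measurable_avoiding.
by apply: measurable_pre mA; exact: measurable_iter.
Qed.

Lemma measurable_first_return A : measurable A -> measurable (first_return A).
Proof.
move=> mA; apply: measurableI => //; apply: bigcup_measurable => k _.
by apply: measurable_pre => //; exact: mA'.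
Qed.

(** Let [D k] be the set of points that avoid [G] for [k] steps and are then in [A]. The preimage of
    [D k] has the same measure and splits into its part in [G] and [D k.+1]; the sum telescopes from
    [D 0 = A]. *)
Lemma first_return_le A : measurable A -> (m (first_return A) <= m A)%E.
Proof.
move=> mA; pose D k := avoiding k `&` iter k N @^-1` A.
pose F k := G `&` N @^-1` D k.
have mF k : measurable (F k) by apply: measurableI => //; apply: measurable_pre => //; exact: mA'.
have DS k : m (D k) = (m (F k) + m (D k.+1))%E.
  have mND : measurable (N @^-1` D k) by apply: measurable_pre => //; exact: mA'.
  rewrite -NP; last exact: mA'.
  rewrite (measureDI _ mND mG) addeC.
  congr (_ + _)%E; first by rewrite /F setIC.
  congr (m _); apply/seteqP; split => w /=.
    move=> [[aw Aw] nG]; split; last by move: Aw; rewrite /= -iterS iterSr.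
    by case=> [_|j jk]; [exact: nG|rewrite iterSr; exact: aw].
  move=> [aw Aw]; split; last exact: (aw 0%N).
  by split; [move=> j jk; rewrite -iterSr; apply: aw|move: Aw; rewrite /= -iterS iterSr].
have -> : first_return A = \bigcup_k F k by rewrite /first_return setI_bigcupr.
apply: le_trans (measure_sigma_subadditive _ mF _ (@subset_refl _ _)) _.
  exact: bigcup_measurable.
have D0 : m (D 0%N) = m A by congr (m _); rewrite /D; apply/seteqP; split => [x []//|x Ax]; split.
apply: lime_le; first exact: is_cvg_nneseries.
apply: nearW => n; rewrite -D0.
have -> : (m (D 0%N) = \sum_(0 <= k < n) m (F k) + m (D n))%E.
  elim: n => [|n IH]; first by rewrite big_geq// add0e.
  by rewrite big_nat_recr//= -addeA -DS.
by rewrite leeDl.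
Qed.

Lemma first_return_symdiff A B : A `<=` G -> B `<=` G ->
  symdiff (first_return A) (first_return B) `<=` first_return (symdiff A B).
Proof.
have H C D w : C `<=` G -> first_return C w -> ~ first_return D w ->
    first_return (C `\` D) w.
  move=> CG [Gw [k _ [aw Cw]]] nD; split => //; exists k => //; split => //; split => // Dw.
  by apply: nD; split => //; exists k.
move=> AG BG w [[h1 h2]|[h1 h2]].
  have [Gw [k _ [aw h]]] := H _ _ _ AG h1 h2.
  by split => //; exists k => //; split => //; left.
have [Gw [k _ [aw h]]] := H _ _ _ BG h1 h2.
by split => //; exists k => //; split => //; right.
Qed.

Lemma first_return_invariant E : N @^-1` E = E ->
  first_return (E `&` G) = E `&` first_return G.
Proof.
move=> NE; have EN w : E (N w) = E w by rewrite -[in RHS]NE.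
have Ek k w : E (iter k N w) = E w by elim: k => //= k <-; rewrite EN.
apply/seteqP; split => w.
  move=> [Gw [k _ [aw [Ew Gk]]]]; split; last by split => //; exists k.
  by move: Ew; rewrite /= Ek EN.
move=> [Ew [Gw [k _ [aw Gk]]]]; split => //; exists k => //; split => //; split => //.
by rewrite /= Ek EN.
Qed.

End first_return.

(** * Invariant sets are measurable with respect to the future *)

Section future_measurability.
Context {d : measure_display} {Y : measurableType d} {R : realType}.
Variables (m : {measure set Y -> \bar R}) (N : Y -> Y) (G : set Y).
Hypotheses (mN : measurable_fun setT N)
  (NP : forall A, measurable A -> m (N @^-1` A) = m A) (mG : measurable G)
  (finG : (m G < +oo)%E).
Variable F0 : set (set Y).
Hypotheses (F0_measurable : forall A, F0 A -> measurable A)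
  (F00 : F0 set0) (F0C : forall A, F0 A -> F0 (~` A))
  (F0U : forall A : nat -> set Y, (forall n, F0 (A n)) -> F0 (\bigcup_n A n))
  (F0N : forall A, F0 A -> F0 (N @^-1` A))
  (F0_ae : forall A B, measurable A -> F0 B -> {ae m, forall x, A x <-> B x} -> F0 A)
  (F0G : F0 G).
(** In the invertible case this is [N^l F0], a filtration that increases with [l]. *)
Definition stage l : set (set Y) := [set A | measurable A /\ F0 (iter l N @^-1` A)].
Hypotheses (gen : measurable `<=` <<s \bigcup_l stage l >>)
  (recurrent : m (G `\` first_return N G G) = 0%E).

Let F0U2 A B : F0 A -> F0 B -> F0 (A `|` B).
Proof. by move=> fA fB; rewrite -bigcup2E; apply: F0U => -[|[|n]]. Qed.

Let F0I A B : F0 A -> F0 B -> F0 (A `&` B).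
Proof.
by move=> fA fB; rewrite -[A `&` B]setCK setCI; apply: F0C; apply: F0U2; exact: F0C.
Qed.

Let iter_preS l A : iter l.+1 N @^-1` A = N @^-1` (iter l N @^-1` A).
Proof. by apply/seteqP; split => w; rewrite /preimage /= -iterS iterSr. Qed.

Let F0_iter k A : F0 A -> F0 (iter k N @^-1` A).
Proof.
move=> fA; elim: k => // k IH.
by rewrite iter_preS; exact: F0N.
Qed.

Let stageW l A : stage l A -> stage l.+1 A.
Proof. by move=> [mA fA]; split => //; rewrite iter_preS; exact: F0N. Qed.

Let stage_le j k A : (j <= k)%N -> stage j A -> stage k A.
Proof. by move=> /subnK <-; elim: (k - j)%N => // n IH /IH; exact: stageW. Qed.

(** A return takes at least one step, and [G] itself belongs to [F0]; so pulling back along the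
    first return map gains one stage. *)
Lemma first_return_stage l A : stage l.+1 A -> stage l (first_return N G A).
Proof.
have E j w : iter j N (N (iter l N w)) = iter (l + j.+1) N w.
  by rewrite -iterSr -iterD addnC.
move=> [mA fA]; split; first exact: measurable_first_return.
rewrite /first_return preimage_setI preimage_bigcup.
apply: F0I; first exact: F0_iter.
apply: F0U => k; rewrite !preimage_setI; apply: F0I.
  rewrite (_ : _ @^-1` _ = ~` \bigcup_j (if (j < k)%N then iter (l + j.+1) N @^-1` G else set0)).
    apply: F0C; apply: F0U => j; case: ifP => // _; exact: F0_iter.
  apply/seteqP; split => w.
    move=> h [j _]; case: ifP => // jk; apply: contra_not (h j jk) => /=.
    by rewrite E.
  move=> h j jk; apply: contra_not h => Gw; exists j => //; rewrite jk /=.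
  by rewrite -E.
rewrite (_ : _ @^-1` _ = iter k N @^-1` (iter l.+1 N @^-1` A)); first exact: F0_iter.
by apply/seteqP; split => w; rewrite /preimage /= E -iterS -iterD addSnnS.
Qed.

Let iter_first_return l A : stage l A -> F0 (iter l (first_return N G) A).
Proof.
by elim: l A => [|l IH] A; [case|move=> /first_return_stage; rewrite iterSr; exact: IH].
Qed.

Let iter_le l A : measurable A -> (m (iter l (first_return N G) A) <= m A)%E.
Proof.
move=> mA; suff [] : measurable (iter l (first_return N G) A) /\
  (m (iter l (first_return N G) A) <= m A)%E by [].
elim: l => // l [mI IH]; split; first exact: measurable_first_return.
by apply: le_trans IH; exact: first_return_le.
Qed.

Let first_return_sub A : first_return N G A `<=` G.
Proof. by move=> w []. Qed.

Let iter_sub l A : A `<=` G -> iter l (first_return N G) A `<=` G.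
Proof. by case: l => // l _; exact: first_return_sub. Qed.

Let first_return_mono A B : A `<=` B -> first_return N G A `<=` first_return N G B.
Proof. by move=> AB w [Gw [k _ [aw Aw]]]; split => //; exists k => //; split => //; exact: AB. Qed.

Let iter_symdiff l A B : A `<=` G -> B `<=` G ->
  symdiff (iter l (first_return N G) A) (iter l (first_return N G) B) `<=`
  iter l (first_return N G) (symdiff A B).
Proof.
move=> AG BG; elim: l => // l IH; apply: subset_trans.
  by apply: first_return_symdiff; exact: iter_sub.
exact: first_return_mono IH.
Qed.

Let miter l A : measurable A -> measurable (iter l (first_return N G) A).
Proof. by move=> mA; elim: l => // l IH; exact: measurable_first_return. Qed.

(** Recurrence means that almost every point of [G] returns, so the part of an invariant set in [G]
    is its own pull-back up to a null set; by [first_return_le] null errors stay null under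
    iteration. *)
Let invariant_iter E l : measurable E -> N @^-1` E = E ->
  m ((E `&` G) `\` iter l (first_return N G) (E `&` G)) = 0%E /\
  iter l (first_return N G) (E `&` G) `<=` E `&` G.
Proof.
move=> mE NE; have mEG : measurable (E `&` G) by exact: measurableI.
have R1 : first_return N G (E `&` G) `<=` E `&` G.
  by rewrite (first_return_invariant _ NE) => w [Ew [Gw _]].
have R0 : m ((E `&` G) `\` first_return N G (E `&` G)) = 0%E.
  apply: (subset_measure0 _ _ _ recurrent).
  - by apply: measurableD => //; exact: measurable_first_return.
  - by apply: measurableD => //; exact: measurable_first_return.
  rewrite (first_return_invariant _ NE) => w [[Ew Gw] h]; split => // h'.
  by apply: h; split.
elim: l => [|l [IH1 IH2]]; first by rewrite setDv measure0; split.
split; last by apply: subset_trans R1; exact: first_return_mono IH2.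
have mI := miter l mEG; have mI' := miter l.+1 mEG.
have mR := measurable_first_return mN mG mEG.
apply: (@subset_measure0 _ _ _ m _ (((E `&` G) `\` first_return N G (E `&` G)) `|`
   first_return N G (symdiff (E `&` G) (iter l (first_return N G) (E `&` G))))).
- exact: measurableD.
- apply: measurableU; first exact: measurableD.
  by apply: measurable_first_return => //; exact: measurable_symdiff.
- move=> w [EGw nI]; have [Rw|nR] := pselect (first_return N G (E `&` G) w); last by left.
  have IG : iter l (first_return N G) (E `&` G) `<=` G.
    by apply: subset_trans IH2 _; exact: subIsetr.
  right; exact: (first_return_symdiff (@subIsetr _ E G) IG (or_introl (conj Rw nI))).
apply/eqP; rewrite eq_le measure_ge0 andbT.
apply: le_trans (measureU2 _ _ _) _; first exact: measurableD.
  by apply: measurable_first_return => //; exact: measurable_symdiff.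
rewrite [X in (X + _)%E]R0 add0e; apply: le_trans (first_return_le mN NP mG (measurable_symdiff _ _)) _ => //.
rewrite (_ : symdiff _ _ = (E `&` G) `\` iter l (first_return N G) (E `&` G)) ?IH1//.
by rewrite /symdiff [X in _ `|` X](_ : _ = set0) ?setU0//; apply/seteqP; split => // w [/IH2].
Qed.

(* An invariant set is approximated within [G] by a set of some stage [l];
   pulling the approximation back [l] times along the first return map to [G]
   does not increase the error and brings it to stage [0]. *)
Let approx E (e : R) : measurable E -> N @^-1` E = E -> 0 < e ->
  exists2 B, F0 B & (m (symdiff B (E `&` G)) < e%:E)%E.
Proof.
move=> mE NE e0; pose mr := mrestr m mG.
have finr : (mr setT < +oo)%E by rewrite /mr /mrestr /= setTI.
have mEG : measurable (E `&` G) by exact: measurableI.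
have [||||l [B [[mB fB] Be]]] := measure_approximation (m := mr) finr _ _ _ _ stage_le gen mE e0.
- by move=> j A [].
- by move=> j; split => //; rewrite preimage_set0.
- by move=> j A [mA fA]; split; [exact: measurableC|rewrite preimage_setC; exact: F0C].
- by move=> j A B [mA fA] [mB fB]; split; [exact: measurableU|rewrite preimage_setU; exact: F0U2].
have mBG : measurable (B `&` G) by exact: measurableI.
exists (iter l (first_return N G) (B `&` G)).
  by apply: iter_first_return; split => //; rewrite preimage_setI; apply: F0I => //; exact: F0_iter.
have [i0 iEG] := invariant_iter l mE NE.
set I := iter l _ _ in i0 iEG; have mI : measurable I by exact: miter.
set B' := iter l _ _; have mB' : measurable B' by exact: miter.
apply: (@le_lt_trans _ _ (m (symdiff B' I `|` ((E `&` G) `\` I)))).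
  apply: le_measure; rewrite ?inE.
  - exact: measurable_symdiff.
  - by apply: measurableU; [exact: measurable_symdiff|exact: measurableD].
  move=> w [[Bw nE]|[Ew nB]].
    by left; left; split => // /iEG.
  by have [Iw|nI] := pselect (I w); [left; right|right].
apply: (@le_lt_trans _ _ (m (symdiff B' I) + 0)%E).
  rewrite -i0; apply: measureU2; [exact: measurable_symdiff|exact: measurableD].
rewrite adde0; apply: le_lt_trans Be.
apply: (@le_trans _ _ (m (iter l (first_return N G) (symdiff (B `&` G) (E `&` G))))).
  apply: le_measure; rewrite ?inE; [exact: measurable_symdiff|exact/miter/measurable_symdiff|].
  by apply: iter_symdiff; exact: subIsetr.
apply: le_trans (iter_le l (measurable_symdiff mBG mEG)) _.
have mS : measurable (symdiff E B) by exact: measurable_symdiff.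
rewrite -[leRHS]/(m (symdiff E B `&` G)); apply: le_measure; rewrite ?inE.
- exact: measurable_symdiff.
- exact: measurableI.
by move=> w [[[Bw Gw] nE]|[[Ew Gw] nB]]; split => //; [right|left]; split => // h;
  [apply: nE|apply: nB].
Qed.

(** The errors [2^-(n+1)] are summable, so by Borel-Cantelli the upper limit of the approximating
    sets equals the given set almost everywhere. *)
Theorem invariant_future E : measurable E -> N @^-1` E = E -> F0 (E `&` G).
Proof.
move=> mE NE; have mEG : measurable (E `&` G) by exact: measurableI.
have H n : exists B, F0 B /\ (m (symdiff B (E `&` G)) <= (1 / (2 ^ n.+1)%:R)%:E)%E.
  have e0 : 0 < 1 / (2 ^ n.+1)%:R :> R by rewrite divr_gt0// ltr0n expn_gt0.
  by have [B fB /ltW hB] := approx mE NE e0; exists B.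
have [B /all_and2[fB hB]] := choice H.
have mB n := F0_measurable (fB n).
have mD n : measurable (symdiff (B n) (E `&` G)) by exact: measurable_symdiff.
have fS : F0 (lim_sup_set B).
  rewrite (_ : lim_sup_set B = ~` \bigcup_n ~` \bigcup_j (if (n <= j)%N then B j else set0)).
    by apply: F0C; apply: F0U => n; apply: F0C; apply: F0U => j; case: ifP.
  rewrite setC_bigcup /lim_sup_set; apply: eq_bigcapr => n _; rewrite setCK.
  apply/seteqP; split => w [j]; first by move=> /= nj Bw; exists j => //; rewrite nj.
  by move=> _; case: ifP => // nj Bw; exists j.
apply: (F0_ae mEG fS).
exists (lim_sup_set (fun n => symdiff (B n) (E `&` G))); split.
- by apply: bigcap_measurableType => n _; exact: bigcup_measurable.
- apply: lim_sup_set_cvg0 => //.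
  apply: (le_lt_trans _ (ltry 1)); apply: le_trans _ (@epsilon_trick0 R 1 xpredT ler01).
  by apply: lee_nneseries => n _.
move=> w /= h n _.
have [EGw|nEG] := pselect ((E `&` G) w).
  have [k nk nB] : exists2 k, (n <= k)%N & ~ B k w.
    apply: contrapT => hn; apply: h; split => // _ n' _; exists (maxn n n') => /=.
      exact: leq_maxr.
    by apply: contrapT => nB; apply: hn; exists (maxn n n') => //; exact: leq_maxl.
  by exists k => //; right.
have : lim_sup_set B w by apply: contrapT => nS; apply: h; split.
by move=> /(_ n I)[k nk Bk]; exists k => //; left.
Qed.

End future_measurability.

(** * The Maharam extension and its recurrence *)

Section maharam_extension.
Context {d : measure_display} {Y : measurableType d} {R : realType}.
Local Notation RR := (measurableTypeR R).
Variables (nu : probability Y R) (T Tinv : Y -> Y) (omega : Y -> R).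
Hypotheses (TK : cancel T Tinv) (TinvK : cancel Tinv T)
  (mT : measurable_fun setT T) (mTinv : measurable_fun setT Tinv)
  (ho : rn_cocycle nu T omega).
Let mo : measurable_fun setT omega. Proof. by case: ho. Qed.
Let o0 y : 0 < omega y. Proof. by case: ho. Qed.

Lemma rn_integral (f : Y -> \bar R) : measurable_fun setT f -> (forall y, 0 <= f y)%E ->
  (\int[nu]_y (f (T y) * (omega y)%:E) = \int[nu]_y f y)%E.
Proof.
move=> mf f0; apply/esym/integral_density => //; first by move=> y; rewrite ltW.
move=> A mA; have [_ _ <-] := ho; last exact: measurable_pre.
by rewrite image_preimage//; apply/seteqP; split => // y _; exists (Tinv y).
Qed.

Definition cocycle n (y : Y) : R := \prod_(k < n) omega (iter k T y).

Lemma cocycle_gt0 n y : 0 < cocycle n y.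
Proof. by rewrite /cocycle; elim/big_ind: _ => // *; exact: mulr_gt0. Qed.

Lemma cocycleSl n y : cocycle n.+1 y = omega y * cocycle n (T y).
Proof.
rewrite /cocycle big_ord_recl; congr (_ * _); apply: eq_bigr => i _.
by rewrite lift0 iterSr.
Qed.

Lemma measurable_cocycle n : measurable_fun setT (cocycle n).
Proof.
elim: n => [|n IH].
  rewrite (_ : cocycle 0 = cst 1); first exact: measurable_cst.
  by apply/funext => y; rewrite /cocycle big_ord0.
rewrite (_ : cocycle n.+1 = fun y => omega y * cocycle n (T y)); last exact/funext/cocycleSl.
by apply: measurable_funM => //; exact: measurableT_comp IH mT.
Qed.

Lemma rn_integral_iter n (f : Y -> \bar R) : measurable_fun setT f -> (forall y, 0 <= f y)%E ->
  (\int[nu]_y (f (iter n T y) * (cocycle n y)%:E) = \int[nu]_y f y)%E.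
Proof.
move=> mf f0; elim: n => [|n IH].
  by apply: eq_integral => y _; rewrite /cocycle big_ord0 mule1.
rewrite -IH -[RHS]rn_integral.
- by apply: eq_integral => y _; rewrite cocycleSl iterSr -muleA -EFinM mulrC.
- apply: emeasurable_funM; first exact: measurableT_comp mf (measurable_iter n mT).
  by apply/measurable_EFinP; exact: measurable_cocycle.
- by move=> y; rewrite mule_ge0// lee_fin ltW// cocycle_gt0.
Qed.

Lemma iterK n : cancel (iter n T) (iter n Tinv).
Proof. by elim: n => // n IH y; rewrite iterSr iterS TK IH. Qed.

Lemma iterinvK n : cancel (iter n Tinv) (iter n T).
Proof. by elim: n => // n IH y; rewrite iterSr iterS TinvK IH. Qed.

Lemma rn_iter_image n C : measurable C ->
  (nu (iter n Tinv @^-1` C) = \int[nu]_(y in C) (cocycle n y)%:E)%E.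
Proof.
move=> mC; have mi := measurable_iter n mTinv.
pose f y : \bar R := (\1_C (iter n Tinv y))%:E.
have mf : measurable_fun setT f.
  by apply/measurable_EFinP; apply: measurableT_comp mi; exact: measurable_indic.
transitivity (\int[nu]_y f y)%E.
  by rewrite (integral_indic nu measurableT (measurable_pre mi mC)) setIT.
rewrite -(rn_integral_iter n)//; last by move=> y; rewrite lee_fin.
rewrite [RHS]integral_mkcond; apply: eq_integral => y _; rewrite /f iterK patchE indicE.
by case: ifPn; rewrite ?mul1e ?mul0e.
Qed.

(** Let [A] be the set where all cocycles stay below 1. By conservativity almost every point of [A]
    has visited [A] before, so [A] is covered, up to a null set, by the images of the disjoint sets
    [C n] of points whose first return takes [n.+1] steps. The measure of such an image is the
    integral of a cocycle over [C n], and this integrand is less than 1; hence [A] is null. *)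
Lemma conservative_cocycle : conservative nu T ->
  {ae nu, forall y, exists n, 1 <= cocycle n.+1 y}.
Proof.
move=> cons; pose A := [set y | forall n, cocycle n.+1 y < 1].
have mA : measurable A.
  have -> : A = \bigcap_n [set y | cocycle n.+1 y < 1].
    by apply/seteqP; split => y h; [move=> n _; exact: h|move=> n; exact: h].
  apply: bigcap_measurableType => n _; rewrite -[X in measurable X]setTI.
  by apply: (@measurable_fun_ltr _ _ _ _ (cocycle n.+1) (cst 1)) => //; exact: measurable_cocycle.
suff A0 : nu A = 0%E.
  exists A; split => // y hy n; rewrite ltNge; apply/negP => h; apply: hy; by exists n.
pose U (S : Y -> Y) n := [set y | A y /\ A (iter n.+1 S y) /\ forall j, (j < n)%N -> ~ A (iter j.+1 S y)].
pose C := U T.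
have mC n : measurable (C n).
  rewrite (_ : C n = A `&` (iter n.+1 T @^-1` A) `&`
      \bigcap_(j in [set j | (j < n)%N]) iter j.+1 T @^-1` (~` A)).
    apply: measurableI; first by apply: measurableI => //; apply: measurable_pre mA; exact: measurable_iter.
    apply: bigcap_measurableType => j _; apply: measurable_pre (measurableC mA).
    exact: measurable_iter.
  by apply/seteqP; split => [y [h1 [h2 h3]]|y [[h1 h2] h3]].
(* A point of [B] has no earlier visit to [A], so no orbit meets [B] twice and conservativity makes
   [B] null. *)
pose B := A `\` \bigcup_n (iter n.+1 Tinv @^-1` A).
have mB : measurable B.
  apply: measurableD => //; apply: bigcup_measurable => n _.
  by apply: measurable_pre mA; exact: measurable_iter.
have B0 : nu B = 0%E.
  apply: contrapT => /eqP; rewrite -measure_gt0 => B0.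
  have [n n0] := cons _ mB B0; rewrite (_ : _ `&` _ = set0) ?measure0 ?ltxx//.
  apply/seteqP; split => // y [[_ hB] [Ay _]]; apply: hB; case: n n0 => // n _.
  by exists n => //=; rewrite /preimage /= -iterS -iterS iterK.
pose I n := iter n.+1 Tinv @^-1` C n.
have mI n : measurable (I n) by apply: measurable_pre (mC n); exact: measurable_iter.
have AI : A `<=` B `|` \bigcup_n I n.
  move=> y Ay; have [[n _ hn]|nB] := pselect ((\bigcup_n (iter n.+1 Tinv @^-1` A)) y); last by left.
  right; have ex : exists n, `[< A (iter n.+1 Tinv y) >] by exists n; apply/asboolP.
  exists (ex_minn ex) => //; case: ex_minnP => k /asboolP Ak kmin; split => //; split.
    by rewrite /preimage iterinvK.
  move=> j jk Aj; have := kmin (k - j.+1)%N; rewrite leqNgt => /(_ _)/negP; apply; last by lia.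
  apply/asboolP; move: Aj; rewrite (_ : k.+1 = j.+1 + (k - j.+1).+1)%N; last by lia.
  by rewrite [iter (j.+1 + _) _ _]iterD iterinvK.
pose f n y : \bar R := (\1_(C n) y * cocycle n.+1 y)%:E.
have f0 n y : (0 <= f n y)%E by rewrite lee_fin mulr_ge0// ltW// cocycle_gt0.
have mf n : measurable_fun setT (f n).
  apply/measurable_EFinP; apply: measurable_funM; first exact: measurable_indic.
  exact: measurable_cocycle.
pose F y := (\sum_(n <oo) f n y)%E.
have mF : measurable_fun setT F by apply: ge0_emeasurable_sum.
have FA y : A y -> exists2 r : R, F y = r%:E & r < 1.
  move=> Ay; have [[n Cn]|nC] := pselect (exists n, C n y); last first.
    exists 0 => //; rewrite /F eseries0// => n _ _.
    by rewrite /f indicE memNset ?mul0r// => Cn; apply: nC; exists n.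
  exists (cocycle n.+1 y) => //; rewrite /F (@nneseriesD1 _ (f^~ y) n)//.
  rewrite eseries0 ?adde0; first by rewrite /f indicE mem_set// mul1r.
  move=> k _ kn; rewrite /f indicE memNset ?mul0r// => Ck.
  have [kn'|nk'|e] := ltngtP k n; last by rewrite e eqxx in kn.
    by have [_ [_ /(_ _ kn')]] := Cn; apply; case: Ck => _ [].
  by have [_ [_ /(_ _ nk')]] := Ck; apply; case: Cn => _ [].
have FnA y : ~ A y -> F y = 0%E.
  move=> nA; rewrite /F eseries0// => n _ _.
  by rewrite /f indicE memNset ?mul0r// => -[].
have le : (nu A <= \int[nu]_y F y)%E.
  apply: (@le_trans _ _ (nu (B `|` \bigcup_n I n))).
    by apply: le_measure; rewrite ?inE//; apply: measurableU => //; exact: bigcup_measurable.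
  apply: le_trans (measureU2 _ _ _) _ => //; first exact: bigcup_measurable.
  rewrite [X in (X + _)%E]B0 add0e.
  apply: le_trans (measure_sigma_subadditive _ mI _ (@subset_refl _ _)) _.
    exact: bigcup_measurable.
  rewrite /F integral_nneseries//; apply: lee_nneseries => // n _.
  rewrite [leLHS](rn_iter_image n.+1 (mC n)) [leLHS]integral_mkcond le_eqVlt.
  apply/orP; left; apply/eqP; apply: eq_integral => y _; rewrite patchE /f indicE.
  by case: ifP; rewrite ?mul1r ?mul0r.
(* The defect [h] is positive on [A], while the covering of [A] by the images forces its integral to
   vanish. *)
pose h y := ((\1_A y)%:E - F y)%E.
have m1 : measurable_fun setT (fun y => (\1_A y)%:E : \bar R).
  by apply/measurable_EFinP; exact: measurable_indic.
have mh : measurable_fun setT h by exact: emeasurable_funB.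
have hE y : exists2 r : R, h y = r%:E & 0 <= r /\ (A y -> 0 < r).
  have [Ay|nA] := pselect (A y); last first.
    by exists 0 => //; rewrite /h FnA// indicE memNset// sube0.
  have [r Fr r1] := FA _ Ay; exists (1 - r); last by split => [|_]; rewrite ?subr_gt0 ?subr_ge0 ?ltW.
  by rewrite /h Fr indicE mem_set.
have h0 y : (0 <= h y)%E by have [r -> [? _]] := hE y; rewrite lee_fin.
have F0 y : (0 <= F y)%E by apply: nneseries_ge0 => *; exact: f0.
have sum : (\int[nu]_y F y + \int[nu]_y h y = nu A)%E.
  rewrite -ge0_integralD//; transitivity (\int[nu]_y (\1_A y)%:E)%E.
    apply: eq_integral => y _; rewrite /h addeC subeK//.
    have [Ay|nA] := pselect (A y); last by rewrite FnA.
    by have [r -> _] := FA _ Ay.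
  by rewrite integral_indic// setIT.
have Afin : nu A \is a fin_num by exact: fin_num_measure.
have Ffin : (\int[nu]_y F y)%E \is a fin_num.
  rewrite ge0_fin_numE ?integral_ge0//; apply: (@le_lt_trans _ _ (nu A)); last by rewrite ltey_eq Afin.
  by rewrite -sum leeDl// integral_ge0.
have hi : (\int[nu]_y h y = 0)%E.
  apply/eqP; rewrite eq_le integral_ge0// andbT.
  have F_le : (\int[nu]_y F y + \int[nu]_y h y <= \int[nu]_y F y)%E by rewrite sum.
  by move: F_le; rewrite -[leRHS]adde0 leeD2lE.
have [hz _] := ae_eq_integral_abs nu measurableT mh.
have [|N [mN N0 hN]] := hz _.
  by rewrite -[RHS]hi; apply: eq_integral => y _; rewrite gee0_abs.
apply: (subset_measure0 mA mN) N0 => y Ay; apply: hN => /= /(_ Logic.I).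
by have [r -> [_ /(_ Ay) r0]] := hE y; move=> [e]; move: r0; rewrite e ltxx.
Qed.

Variable kappa : {sigma_finite_measure set RR -> \bar R}.
Hypothesis hk : maharam_fibre_measure kappa.
Local Notation M := (maharam_map T omega).

Definition maharam_inv (w : Y * RR) : Y * RR := (Tinv w.1, (omega (Tinv w.1))^-1 * w.2).

Lemma maharamK : cancel M maharam_inv.
Proof.
by move=> [y t]; rewrite /maharam_inv /maharam_map /= TK mulKf// lt0r_neq0.
Qed.

Lemma maharam_invK : cancel maharam_inv M.
Proof.
by move=> [y t]; rewrite /maharam_inv /maharam_map /= TinvK mulrA mulfV ?mul1r// lt0r_neq0.
Qed.

Lemma measurable_maharam : measurable_fun setT M.
Proof.
apply: measurable_fun_pair; first exact: measurableT_comp mT measurable_fst.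
apply: measurable_funM; last exact: measurable_snd.
exact: measurableT_comp mo measurable_fst.
Qed.

Lemma measurable_maharam_inv : measurable_fun setT maharam_inv.
Proof.
have m1 : measurable_fun setT (fun w : Y * RR => Tinv w.1) by exact: measurableT_comp mTinv measurable_fst.
apply: measurable_fun_pair => //; apply: measurable_funM; last exact: measurable_snd.
by apply: measurable_inv_pos => //; exact: measurableT_comp mo m1.
Qed.

Lemma maharam_preserves B : measurable B ->
  (nu \x kappa)%E (M @^-1` B) = (nu \x kappa)%E B.
Proof.
move=> mB; rewrite /product_measure1 -[RHS]rn_integral; last 2 first.
- exact: measurable_fun_xsection.
- by move=> y; exact: measure_ge0.
apply: eq_integral => y _ /=.
rewrite (_ : xsection _ y = scale (omega y) @^-1` xsection B (T y)).
  by apply: etrans (kappa_scale hk (o0 y) (measurable_xsection _ mB)) _; rewrite muleC.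
by apply/seteqP; split => t; rewrite /xsection /= !inE.
Qed.

Lemma iter_maharam n w : iter n M w = (iter n T w.1, cocycle n w.1 * w.2).
Proof.
elim: n w => [|n IH] [y t]; first by rewrite /cocycle big_ord0 mul1r.
by rewrite iterSr IH cocycleSl iterSr /= mulrA (mulrC (omega y)).
Qed.

Definition upper_half (c : R) : set (Y * RR) := [set w | c < w.2].

Lemma measurable_upper_half c : measurable (upper_half c).
Proof.
rewrite -[X in measurable X]setTI.
by apply: (@measurable_fun_ltr _ _ _ _ (cst c) snd) => //; exact: measurable_snd.
Qed.

(** At a time when the cocycle is at least 1 the fibre coordinate has not decreased. *)
Lemma maharam_recurrent (c : R) : 0 < c -> conservative nu T ->
  {ae (nu \x kappa)%E, forall w, upper_half c w -> exists k, upper_half c (iter k.+1 M w)}.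
Proof.
move=> c0 cons; have [N [mN N0 hN]] := conservative_cocycle cons.
exists (fst @^-1` N); split.
- by apply: measurable_pre mN; exact: measurable_fst.
- rewrite (_ : fst @^-1` N = N `*` setT); last by apply/seteqP; split => [w|w []].
  apply: etrans (product_measure1E _ _ mN measurableT) _.
  by rewrite [X in (X * _)%E]N0 mul0e.
move=> w nw; apply: hN => -[n hn]; apply: nw => cw; exists n.
rewrite iter_maharam /upper_half /=.
have w0 : 0 <= w.2 := ltW (lt_trans c0 cw).
by apply: (lt_le_trans cw); exact: ler_peMl.
Qed.

Lemma upper_half_lty c : 0 < c -> ((nu \x kappa)%E (upper_half c) < +oo)%E.
Proof.
move=> c0; rewrite (_ : upper_half c = setT `*` `]c, +oo[%classic); last first.
  by apply/seteqP; split => [w h|w []]; rewrite /upper_half /= in_itv /= andbT.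
have E := product_measure1E nu kappa measurableT (measurable_itv `]c, +oo[).
rewrite [ltLHS]E [X in (X * _)%E]probability_setT mul1e; exact: kappa_ray_lty.
Qed.
End maharam_extension.

Lemma first_return_exists d (Y : measurableType d) (N : Y -> Y) (G : set Y) w k :
  G w -> G (iter k.+1 N w) -> first_return N G G w.
Proof.
move=> Gw Gk; split => //.
have ex : exists k, `[< G (iter k.+1 N w) >] by exists k; exact/asboolP.
exists (ex_minn ex) => //; case: ex_minnP => j /asboolP Gj jmin; split.
  move=> i ij Gi; have := jmin i; rewrite leqNgt ij => /(_ _)/negP; apply => //.
  by apply/asboolP; rewrite iterSr.
by rewrite /preimage /= -iterSr.
Qed.

Lemma iter_preimageS T (N : T -> T) l (A : set T) :
  iter l.+1 N @^-1` A = N @^-1` (iter l N @^-1` A).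
Proof. by apply/seteqP; split => w; rewrite /preimage /= -iterS iterSr. Qed.

(** * Ergodicity of products with the Maharam extension *)

Section products.
Context {d1 d2 : measure_display} {T1 : measurableType d1} {T2 : measurableType d2} {R : realType}.
Variables (m1 : {measure set T1 -> \bar R}) (m2 : {sigma_finite_measure set T2 -> \bar R}).

Lemma ae_fst (Q : T1 -> Prop) : {ae m1, forall x, Q x} -> {ae (m1 \x m2)%E, forall w, Q w.1}.
Proof.
move=> [N [mN N0 hN]]; exists (fst @^-1` N); split.
- by apply: measurable_pre mN; exact: measurable_fst.
- rewrite (_ : fst @^-1` N = N `*` setT); last by apply/seteqP; split => [w|w []].
  apply: etrans (product_measure1E _ _ mN measurableT) _.
  by rewrite [X in (X * _)%E]N0 mul0e.
by move=> w nw; exact: hN.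
Qed.

Lemma preserving_integral (N : T1 -> T1) (f : T1 -> \bar R) : measurable_fun setT N ->
  (forall A, measurable A -> m1 (N @^-1` A) = m1 A) ->
  measurable_fun setT f -> (forall x, 0 <= f x)%E ->
  (\int[m1]_x f (N x) = \int[m1]_x f x)%E.
Proof.
move=> mN NP mf f0; rewrite (@integral_density _ _ _ _ _ m1 m1 N (cst 1) f)//.
  by apply: eq_integral => x _; rewrite mule1.
move=> A mA; rewrite -[LHS](NP _ mA); transitivity (\int[m1]_(x in N @^-1` A) (cst 1%E) x)%E => //.
by rewrite integral_cst ?mul1e//; exact: measurable_pre.
Qed.

Lemma product_preserving (M : T1 -> T1) (s : T2 -> T2) :
  measurable_fun setT M -> (forall A, measurable A -> m1 (M @^-1` A) = m1 A) ->
  measurable_fun setT s -> (forall A, measurable A -> m2 (s @^-1` A) = m2 A) ->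
  forall A, measurable A ->
  (m1 \x m2)%E ((fun w => (M w.1, s w.2)) @^-1` A) = (m1 \x m2)%E A.
Proof.
move=> mM MP ms sP A mA; rewrite /product_measure1.
rewrite -[RHS](preserving_integral mM MP); last 2 first.
- exact: measurable_fun_xsection.
- by move=> x; exact: measure_ge0.
apply: eq_integral => x _ /=.
rewrite (_ : xsection _ x = s @^-1` xsection A (M x)).
  by apply: sP; exact: measurable_xsection.
by apply/seteqP; split => t; rewrite /xsection /= !inE.
Qed.

End products.

(** * Sets whose fibres have constant measure *)

Section constant_fibres.
Context {d1 d2 : measure_display} {T1 : measurableType d1} {T2 : measurableType d2} {R : realType}.
Variables (m1 : {measure set T1 -> \bar R}) (p : probability T2 R)
  (b : set (T1 * T2)) (V0 : set T1) (K : R).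
Hypotheses (m1_sigma : sigma_finite setT m1) (mb : measurable b)
  (mV0 : measurable V0) (V0E : m1 V0 = K%:E) (K0 : 0 < K)
  (hcst : forall D, measurable D ->
     exists c : R, {ae m1, forall v, p (D `&` xsection b v) = c%:E}).

Let h : T1 * T2 -> R := \1_(b `&` (V0 `*` setT)).
Let h0 w : 0 <= h w. Proof. by rewrite /h indicE. Qed.
Let mbV : measurable (b `&` (V0 `*` setT)).
Proof. by apply: measurableI => //; exact: measurableX. Qed.
Let mh : measurable_fun setT h. Proof. exact: measurable_indic. Qed.
Let k (w : T1 * T2) : R := K * \1_b w.
Let k0 w : 0 <= k w. Proof. by rewrite /k indicE mulr_ge0// ltW. Qed.
Let mk : measurable_fun setT k.
Proof. by apply: measurable_funM => //; exact: measurable_indic. Qed.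

(** [p0 D] is the mass of [b] over [V0] with second coordinate in [D], and [bM] is [K] times the
    restriction to [b]. Constancy of the fibre measures makes [bM] the product of [m1] and [p0]. *)
Let p0 : {measure set T2 -> \bar R} := image_density (m1 \x p)%E measurable_snd mh h0.
Let bM : {measure set (T1 * T2) -> \bar R} :=
  image_density (m1 \x p)%E (@measurable_id _ _ setT) mk k0.

Let box A D c : measurable A -> measurable D ->
  {ae m1, forall v, p (D `&` xsection b v) = c%:E} ->
  (m1 \x p)%E (b `&` (A `*` D)) = (c%:E * m1 A)%E.
Proof.
move=> mA mD hc; rewrite -integral_cst// [RHS]integral_mkcond.
transitivity (\int[m1]_v p (xsection (b `&` (A `*` D)) v))%E => //.
apply: ae_eq_integral => //.
- by apply: measurable_fun_xsection; apply: measurableI => //; exact: measurableX.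
- by rewrite -measurable_restrictT.
apply: filterS hc => v hv _ /=; rewrite patchE; case: ifPn => vA.
  rewrite -hv; congr (p _); apply/seteqP; split => z; rewrite /xsection /= !inE.
    by move=> [bz [_ Dz]].
  by move=> [Dz bz]; split => //; split => //; rewrite inE in vA.
rewrite (_ : xsection _ v = set0) ?measure0//.
apply/seteqP; split => // z; rewrite /xsection /= inE => -[_ [Av _]].
by rewrite notin_setE in vA.
Qed.

Let p0E D c : measurable D -> {ae m1, forall v, p (D `&` xsection b v) = c%:E} ->
  p0 D = (c * K)%:E.
Proof.
move=> mD hc; have mTD : measurable (setT `*` D : set (T1 * T2)) by exact: measurableX.
transitivity ((m1 \x p)%E ((b `&` (V0 `*` setT)) `&` (setT `*` D))).
  rewrite -integral_indic// /p0 /= /image_density.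
  by rewrite (_ : snd @^-1` D = setT `*` D)//; apply/seteqP; split => [w|w []].
rewrite -setIA -setXI setIT setTI (box mV0 mD hc) EFinM.
by rewrite [X in (_ * X)%E]V0E.
Qed.

Let p0_fin : fin_num_fun p0.
Proof. by move=> D mD; have [c hc] := hcst mD; rewrite (p0E mD hc). Qed.
Let p0_sigma : sigma_finite setT p0.
Proof. by apply: fin_num_fun_sigma_finite; [rewrite measure0|exact: p0_fin]. Qed.
Let P0 : {sigma_finite_measure set T2 -> \bar R} :=
  HB.pack_for (SigmaFiniteMeasure.type T2 R) (Measure.sort p0)
    (isSFinite.Build _ _ _ _ (sfinite_measure_sigma_finite p0_sigma))
    (isSigmaFinite.Build _ _ _ _ p0_sigma).

(* The measure [1_b (m1 x p)] is a product, hence concentrated on almost every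
   fibre of [b]. *)
Lemma constant_fibres : exists2 D, measurable D &
  {ae m1, forall v, {ae p, forall z, b (v, z) <-> D z}}.
Proof.
have prod X : measurable X -> (m1 \x P0)%E X = bM X.
  pose m1' : {sigma_finite_measure set T1 -> \bar R} :=
    HB.pack_for (SigmaFiniteMeasure.type T1 R) (Measure.sort m1)
      (isSFinite.Build _ _ _ _ (sfinite_measure_sigma_finite m1_sigma))
      (isSigmaFinite.Build _ _ _ _ m1_sigma).
  apply: (product_measure_unique (m1 := m1')) => A D mA mD; have [c hc] := hcst mD.
  have mAD : measurable (A `*` D) by exact: measurableX.
  apply: etrans (esym (congr1 (fun t => m1 A * t)%E (p0E mD hc))).
  transitivity (\int[(m1 \x p)%E]_(w in A `*` D) (k w)%:E)%E => //.
  under eq_integral do rewrite /k EFinM.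
  rewrite ge0_integralZl//; last 2 first.
  - by apply: measurable_funTS; apply/measurable_EFinP; exact: measurable_indic.
  - by rewrite lee_fin ltW.
  transitivity (K%:E * (c%:E * m1 A))%E; last by rewrite muleA -EFinM (mulrC K) muleC.
  by congr (_ * _)%E; rewrite integral_indic//; exact: box.
have bP : {ae (m1 \x P0)%E, forall w, b w}.
  exists (~` b); split => //; first exact: measurableC.
  rewrite prod; last exact: measurableC.
  apply: integral0_eq => w nb; by rewrite /k indicE memNset// mulr0.
have sec := ae_xsection bP.
have [cT hT] := hcst measurableT.
(* A generic fibre supplies [D]. It carries all of [p0], so almost every fibre lies in [D] up to a
   null set, and equal measure then gives equality. *)
have [v0 [h1 h2]] : exists v, {ae P0, forall z, b (v, z)} /\ p (setT `&` xsection b v) = cT%:E.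
  apply: contrapT => nex.
  have : {ae m1, forall v : T1, False}.
    by apply: filterS2 sec hT => v hv1 hv2; apply: nex; exists v.
  move=> [C [mC C0 hC]]; suff : m1 V0 = 0%E by rewrite V0E => -[e]; move: K0; rewrite e ltxx.
  by apply: (subset_measure0 mV0 mC) C0 => v _; apply: hC => -[].
pose D := xsection b v0; have mD : measurable D by exact: measurable_xsection.
exists D => //.
have [c hc] := hcst (measurableC mD).
have c0 : c = 0.
  have : p0 (~` D) = 0%E.
    have [C [mC C0 hC]] := h1.
    apply: (@subset_measure0 _ _ _ p0 _ _ (measurableC mD) mC _ C0).
    by move=> z nDz; apply: hC => bz; apply: nDz; rewrite /D /xsection /= inE.
  rewrite (p0E (measurableC mD) hc) => -[/eqP]; rewrite mulf_eq0 => /orP[/eqP//|/eqP e].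
  by move: K0; rewrite e ltxx.
apply: filterS2 hc hT => v; rewrite c0 => hv1 hv2.
pose B := xsection b v; have mB : measurable B by exact: measurable_xsection.
have pD : p D = cT%:E by rewrite -h2 setTI.
have pB : p B = cT%:E by rewrite -hv2 setTI.
have pBD : p (B `&` D) = cT%:E.
  rewrite -pB (measureDI p mB mD) [X in (X + _)%E](_ : _ = 0%E) ?add0e//.
  by rewrite setDE setIC.
have pDB : p (D `\` B) = 0%E.
  rewrite measureD//; last by rewrite (le_lt_trans (probability_le1 p mD))// ltry.
  rewrite [X in (X - _)%E]pD [X in (_ - X)%E](_ : _ = cT%:E) ?subee//.
  by rewrite setIC; exact: pBD.
have pBD0 : p (B `\` D) = 0%E by rewrite setDE setIC; exact: hv1.
exists (symdiff B D); split.
- exact: measurable_symdiff.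
- apply/eqP; rewrite eq_le measure_ge0 andbT; apply: le_trans (measureU2 _ _ _) _; [exact: measurableD..|].
  by rewrite [X in (X + _)%E]pBD0 [X in (_ + X)%E]pDB adde0.
move=> z nz; have [Bz|nB] := pselect (B z); have [Dz|nD] := pselect (D z).
- by exfalso; apply: nz; split => // _; move: Bz; rewrite /B /xsection /= inE.
- by left.
- by right.
- by exfalso; apply: nz; split => // bz; exfalso; apply: nB; rewrite /B /xsection /= inE.
Qed.

End constant_fibres.

Section factor_algebra.
Context {d d' : measure_display} {Y : measurableType d} {Y' : measurableType d'} {R : realType}.
Variables (m : {measure set Y -> \bar R}) (pi : Y -> Y').
Hypothesis mpi : measurable_fun setT pi.

(* The completion of the sigma-algebra generated by the factor map [pi]. *)
Definition factor_algebra : set (set Y) :=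
  [set A | measurable A /\
     exists2 B, measurable B & {ae m, forall w, A w <-> B (pi w)}].

Lemma factor_measurable A : factor_algebra A -> measurable A.
Proof. by case. Qed.

Lemma factor_pull B : measurable B -> factor_algebra (pi @^-1` B).
Proof. by move=> mB; split; [exact: measurable_pre|exists B => //; exact: aeW]. Qed.

Lemma factor0 : factor_algebra set0.
Proof. by rewrite -(preimage_set0 pi); exact: factor_pull. Qed.

Lemma factorC A : factor_algebra A -> factor_algebra (~` A).
Proof.
move=> [mA [B mB AB]]; split; first exact: measurableC.
exists (~` B); first exact: measurableC.
by apply: filterS AB => w AB; split; apply: contra_not => /AB.
Qed.

Lemma factorU (A : nat -> set Y) : (forall n, factor_algebra (A n)) ->
  factor_algebra (\bigcup_n A n).
Proof.
move=> fA; split; first by apply: bigcup_measurable => n _; case: (fA n).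
have H n : exists B, measurable B /\ {ae m, forall w, A n w <-> B (pi w)}.
  by case: (fA n) => _ [B mB AB]; exists B.
have [B /all_and2[mB AB]] := choice H.
exists (\bigcup_n B n); first exact: bigcup_measurable.
have /ae_foralln := AB; apply: filterS => w h.
by split => -[n _] /h; exists n.
Qed.

Lemma factor_ae A A' : measurable A -> factor_algebra A' ->
  {ae m, forall x, A x <-> A' x} -> factor_algebra A.
Proof.
move=> mA [_ [B mB h]] h'; split => //; exists B => //.
by apply: filterS2 h h' => w -> ->.
Qed.

Lemma factor_pre (N : Y -> Y) (S : Y' -> Y') : measurable_fun setT N ->
  (forall A, measurable A -> m (N @^-1` A) = m A) -> measurable_fun setT S ->
  {ae m, forall w, pi (N w) = S (pi w)} ->
  forall A, factor_algebra A -> factor_algebra (N @^-1` A).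
Proof.
move=> mN NP mS NS A [mA [B mB AB]]; split; first exact: measurable_pre.
exists (S @^-1` B); first exact: measurable_pre.
have AB' : {ae m, forall w, A (N w) <-> B (pi (N w))}.
  by apply: (ae_pullback (f := N)) AB => // C mC C0; rewrite NP.
by apply: filterS2 NS AB' => w /= <-.
Qed.

End factor_algebra.

Lemma product_generated d1 d2 (T1 : measurableType d1) (T2 : measurableType d2)
    (G : set (set (T1 * T2))) (G1 : set (set T1)) :
  measurable `<=` <<s G1 >> ->
  (forall A, G1 A -> <<s G >> (A `*` setT)) ->
  (forall B, measurable B -> <<s G >> (setT `*` B)) ->
  measurable `<=` <<s G >>.
Proof.
move=> gG1 h1 h2; rewrite measurable_prod_measurableType.
have sG : sigma_algebra setT <<s G >> by exact: smallest_sigma_algebra.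
have [s0 sC sU] := sG.
apply: smallest_sub => // _ [A mA [B mB <-]].
have hA : <<s G >> (A `*` setT).
  suff sub : <<s G1 >> `<=` [set A | <<s G >> (A `*` setT)] by exact: sub (gG1 _ mA).
  apply: smallest_sub; last exact: h1.
  split => [|C hC|F hF].
    - by rewrite /= set0X.
    - rewrite /= (_ : _ `*` _ = setT `\` (C `*` setT)); first exact: sC.
      by apply/seteqP; split => [[x y] [[_ nC] _]|[x y] [_ nC]] /=;
        [split => // -[]|split => //; split => // Cx; apply: nC].
    rewrite /= (_ : _ `*` _ = \bigcup_n (F n `*` setT)); first exact: sU.
    by apply/seteqP; split => [[x y] [[n _ Fx] _]|[x y] [n _ [Fx _]]]; [exists n|split => //; exists n].
have -> : A `*` B = setT `\` ((setT `\` (A `*` setT)) `|` (setT `\` (setT `*` B))).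
  apply/seteqP; split => [[x y] /= [Ax By]|[x y] /= [_ h]].
    by split => // -[[_]|[_]]; apply.
  by split; apply: contrapT => n; apply: h; [left|right]; split => // -[].
apply: (sC); rewrite -bigcup2E; apply: (sU) => -[|[|n]] /=; [exact: sC hA|apply: sC; exact: h2|exact: s0].
Qed.

Section markov_maharam.
Context {R : realType}.
Local Notation RR := (measurableTypeR R).
Variables (lambda : 'I_2 -> R) (P : nat -> 'M[R]_2)
  (mu : probability X1 R) (tmu : probability X2 R).
Hypotheses (hmu : nonsingular_markov_shift lambda P mu)
  (htmu : natural_extension_measure lambda P tmu).
Variable g : X1 -> R.
Hypotheses (mg : measurable_fun setT g) (g_gt0 : forall x, 0 < g x)
  (gE : forall A, measurable A -> (mu (shift1 @^-1` A) = \int[mu]_(x in A) (g x)%:E)%E).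
Variables (omega : X2 -> R) (kappa : {sigma_finite_measure set RR -> \bar R}).
Hypotheses (ho : rn_cocycle tmu shift2 omega) (hk : maharam_fibre_measure kappa).
Local Notation M := (maharam_map shift2 omega).
Local Notation nk := (tmu \x kappa)%E.
Local Notation mk := (mu \x kappa)%E.

Definition future (w : X2 * RR) : X1 * RR := (proj w.1, w.2).
Definition future_map (v : X1 * RR) : X1 * RR :=
  (shift1 v.1, scale (g (shift1 v.1))^-1 v.2).

Lemma measurable_future : measurable_fun setT future.
Proof.
apply: measurable_fun_pair; last exact: measurable_snd.
exact: measurableT_comp measurable_proj measurable_fst.
Qed.

Lemma measurable_future_map : measurable_fun setT future_map.
Proof.
have m1 : measurable_fun setT (fun v : X1 * RR => shift1 v.1).
  exact: measurableT_comp measurable_shift1 measurable_fst.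
apply: measurable_fun_pair => //; apply: measurable_funM; last exact: measurable_snd.
by apply: measurable_inv_pos => //; exact: measurableT_comp mg m1.
Qed.

Let mM : measurable_fun setT M.
Proof. exact: measurable_maharam measurable_shift2 ho. Qed.

Let MP A : measurable A -> nk (M @^-1` A) = nk A.
Proof. exact: (maharam_preserves unshift2K measurable_shift2 ho hk). Qed.

Lemma ae_future_map : {ae nk, forall w, future (M w) = future_map (future w)}.
Proof.
have := ae_fst kappa (rn_cocycle_shift2 hmu htmu mg g_gt0 gE ho).
apply: filterS => -[x t] /= e.
by rewrite /future /future_map /maharam_map /= proj_shift2 e.
Qed.

Lemma future_law B : measurable B -> nk (future @^-1` B) = mk B.
Proof.
move=> mB; rewrite /product_measure1.
pose f y := kappa (xsection B y).
transitivity (\int[tmu]_x f (proj x))%E.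
  by apply: eq_integral => x _ /=; rewrite /f; congr (kappa _).
rewrite (@integral_density _ _ _ _ _ mu tmu proj (cst 1) f)//.
- by apply: eq_integral => x _; rewrite mule1.
- exact: measurable_proj.
- move=> A mA; apply: etrans (esym (tmu_proj hmu htmu mA)) _; transitivity (\int[tmu]_(x in proj @^-1` A) (cst 1%E) x)%E => //.
  by rewrite integral_cst ?mul1e//; apply: measurable_pre mA; exact: measurable_proj.
- exact: measurable_fun_xsection.
Qed.

Local Notation FK := (factor_algebra nk future).

Lemma FK_pre A : FK A -> FK (M @^-1` A).
Proof.
exact: (factor_pre mM MP measurable_future_map ae_future_map).
Qed.

Lemma iter_shift2 n x i : iter n shift2 x i = x (i + n%:Z).
Proof.
elim: n i => [|n IH] i; first by rewrite addr0.
by rewrite iterS /shift2 IH; congr (x _); lia.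
Qed.

Lemma stage_FK_pull l B : measurable B -> stage M FK l (future @^-1` B).
Proof.
move=> mB; split; first exact: (measurable_pre measurable_future mB).
elim: l => [|l IH]; first exact: (factor_pull nk measurable_future mB).
by rewrite iter_preimageS; exact: FK_pre.
Qed.

(** After [|i| + 1] shifts coordinate [i] has become coordinate [i + |i| + 1], which lies in the
    future and has index [i + |i|] there; the fibre coordinate is visible from the start. *)
Lemma stage_FK_generates : measurable `<=` <<s \bigcup_l stage M FK l >>.
Proof.
apply: (@product_generated _ _ X2 RR _ (@coordinate_sets int)) => //.
  move=> _ [i [b ->]]; apply: sub_sigma_algebra; exists (absz i).+1 => //.
  have mA : measurable ([set x : X2 | x i = b] `*` [set: RR]).
    by apply: measurableX => //; exact: measurable_coord.
  split => //; pose n := absz (i + absz i).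
  rewrite (_ : _ @^-1` _ = future @^-1` ([set y : X1 | y n = b] `*` [set: RR])).
    apply: (factor_pull nk measurable_future); apply: measurableX => //.
    exact: (@measurable_coord nat n b).
  have e (x : X2) t : (future (x, t)).1 n = (iter (absz i).+1 M (x, t)).1 i.
    rewrite iter_maharam; apply: etrans _ (esym (iter_shift2 _ x i)).
    by transitivity (x n.+1%:Z) => //; congr (x _); rewrite /n; lia.
  apply/seteqP; split => -[x t] [h _]; split => //; first exact: etrans (e x t) h.
  exact: etrans (esym (e x t)) h.
move=> B mB; apply: sub_sigma_algebra; exists 0%N => //.
rewrite (_ : _ `*` _ = future @^-1` (setT `*` B))//; apply: stage_FK_pull.
exact: measurableX.
Qed.

Let iterMK n : cancel (iter n M) (iter n (maharam_inv unshift2 omega)).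
Proof. by apply: iterK => //; exact: maharamK shift2K ho. Qed.

Let iterMinvK n : cancel (iter n (maharam_inv unshift2 omega)) (iter n M).
Proof. by apply: iterinvK => //; exact: maharam_invK unshift2K ho. Qed.

Lemma automorphism_maharam : nonsingular_automorphism nk M.
Proof.
split.
  split => //; exists (maharam_inv unshift2 omega); split.
  - exact: maharamK shift2K ho.
  - exact: maharam_invK unshift2K ho.
  - exact: measurable_maharam_inv measurable_unshift2 ho.
split; apply/null_content_dominatesP => A mA A0.
  by rewrite /pushforward MP.
by rewrite -MP.
Qed.

Section tail.
Variable alpha : R.
Hypotheses (alpha_gt0 : 0 < alpha) (good_alpha :
  {ae (pushforward mu odd_coordinates : set X1 -> \bar R),
     forall x, good_point (ratio P x) alpha}).

Lemma ae_null d (Y : measurableType d) (m : {measure set Y -> \bar R}) (Q : Y -> Prop) :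
  measurable [set x | ~ Q x] -> {ae m, forall x, Q x} -> m [set x | ~ Q x] = 0%E.
Proof. by move=> mQ [N [mN N0 hN]]; apply: (subset_measure0 mQ mN) N0. Qed.

(** The future of a point has law [mk], so relations that hold almost everywhere upstairs become
    relations over the one-sided shift, where tail functions are constant. *)
Lemma tail_const (a : nat -> X1 * RR -> R) : (forall n, measurable_fun setT (a n)) ->
  (forall n w, 0 <= a n w <= 1) ->
  (forall n, {ae nk, forall w, a n (future w) = a n.+1 (future_map (future w))}) ->
  exists c, {ae mk, forall v, a 0%N v = c}.
Proof.
move=> ma a01 aS.
have mneq (f h : X1 * RR -> R) : measurable_fun setT f -> measurable_fun setT h ->
    measurable [set v | ~ (f v = h v)].
  move=> mf mh; have -> : [set v | ~ (f v = h v)] = ~` ((fun v => f v - h v) @^-1` [set 0]).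
    apply/seteqP; split => v /= nv e; apply: nv; apply/eqP; first by rewrite -subr_eq0; apply/eqP.
    by rewrite subr_eq0; apply/eqP.
  by apply/measurableC/measurable_pre => //; exact: measurable_funB.
have aS' n : {ae mu, forall y, {ae kappa, forall t,
     a n (y, t) = a n.+1 (shift1 y, scale (g (shift1 y))^-1 t)}}.
  have mS : measurable_fun setT (fun v => a n.+1 (future_map v)).
    exact: measurableT_comp (ma _) measurable_future_map.
  pose B := [set v | ~ (a n v = a n.+1 (future_map v))].
  have mB : measurable B by exact: mneq.
  apply: (@ae_xsection _ _ _ _ _ mu kappa (fun v => a n v = a n.+1 (future_map v))).
  exists B; split => //; rewrite -future_law//; apply: ae_null (aS n).
  by apply: (measurable_pre measurable_future mB).
have [c hc] := tail_trivial hmu mg g_gt0 gE hk ma a01 aS' alpha_gt0 good_alpha.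
exists c; have mc : measurable [set v | ~ (a 0%N v = c)] by exact: (mneq _ (cst c)).
exists [set v | ~ (a 0%N v = c)]; split => //; apply: xsection_null => //.
apply: filterS hc => y hy; rewrite (_ : xsection _ y = [set t | ~ (a 0%N (y, t) = c)]).
  apply: ae_null hy; rewrite (_ : [set t | _] = xsection [set v | ~ (a 0%N v = c)] y).
    exact: measurable_xsection.
  by apply/seteqP; split => t; rewrite /xsection /= !inE.
by apply/seteqP; split => t; rewrite /xsection /= !inE.
Qed.

(** If [A] is the [n]-th preimage of [B n] for all [n], bijectivity of [M] makes [B n] the preimage
    of [B n.+1]. The indicators of sets representing the [B n] on the future then form the sequence
    of a tail function. *)
Lemma tail_FK_trivial A :
  (forall n, (0 < n)%N -> exists2 B, FK B & A = iter n M @^-1` B) ->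
  nk A = 0%E \/ nk (~` A) = 0%E.
Proof.
move=> hA.
have H n : exists B, FK B /\ A = iter n M @^-1` B.
  case: n => [|n]; last by have [B fB eB] := hA n.+1 isT; exists B.
  by exists A; split => //; have [B fB ->] := hA 1%N isT; exact: FK_pre.
have [B /all_and2[fB eB]] := choice H.
have step n w : B n w <-> B n.+1 (M w).
  have [v ->] : exists v, w = iter n M v by exists (iter n (maharam_inv unshift2 omega) w); rewrite iterMinvK.
  by rewrite -iterS -[B n _]/((iter n M @^-1` B n) v) -eB [in X in X <-> _](eB n.+1).
have H' n : exists b, measurable b /\ {ae nk, forall w, B n w <-> b (future w)}.
  by have [_ [b mb hb]] := fB n; exists b.
have [b /all_and2[mb hb]] := choice H'.
pose a n v : R := \1_(b n) v.
have ma n : measurable_fun setT (a n) by exact: measurable_indic.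
have a01 n v : 0 <= a n v <= 1 by rewrite /a indicE; case: (_ \in _); rewrite ?lexx ?ler01.
have aS n : {ae nk, forall w, a n (future w) = a n.+1 (future_map (future w))}.
  have hb' : {ae nk, forall w, B n.+1 (M w) <-> b n.+1 (future (M w))}.
    by apply: (ae_pullback (f := M)) (hb n.+1) => // C mC C0; apply: etrans (MP mC) _.
  apply: filterS3 (hb n) hb' ae_future_map => w h1 h2 <-.
  rewrite /a !indicE; congr (nat_of_bool _)%:R; apply/idP/idP; rewrite !inE.
    by move=> h; exact: h2.1 ((step n w).1 (h1.2 h)).
  by move=> h; exact: h1.1 ((step n w).2 (h2.2 h)).
have [c hc] := tail_const ma a01 aS.
have mA : measurable A by rewrite (eB 0%N); exact: factor_measurable (fB 0%N).
have hA0 : {ae nk, forall w, A w <-> b 0%N (future w)} by rewrite (eB 0%N); exact: hb.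
have hcn : {ae nk, forall w, a 0%N (future w) = c}.
  apply: (ae_pullback (f := future)) hc => //; first exact: measurable_future.
  by move=> C mC C0; apply: etrans (future_law mC) _.
have [c1|c1] := eqVneq c 1.
  right; have -> : ~` A = [set w | ~ A w] by [].
  apply: ae_null; first exact: measurableC.
  apply: filterS2 hA0 hcn => w -> ; rewrite c1 /a indicE.
  by have [|_ /eqP] := boolP (future w \in b 0%N); [rewrite inE|rewrite eq_sym oner_eq0].
left; have -> : A = [set w | ~ ~ A w] by apply/seteqP; split => w /= ?; [apply|apply: contrapT].
apply: ae_null.
  by rewrite (_ : [set w | _] = A)//; apply/seteqP; split => w /= ?; [apply: contrapT|apply].
apply: filterS2 hA0 hcn => w h hw Aw; move: hw; rewrite /a indicE mem_set; last exact/h.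
by move=> c1'; rewrite -c1' eqxx in c1.
Qed.

Lemma maharam_K_automorphism : K_automorphism nk M.
Proof.
split; first exact: automorphism_maharam.
exists FK; split; split.
- split; first exact: (factor0 nk measurable_future).
    by move=> A fA; rewrite setTD; exact: factorC.
  by move=> A fA; exact: factorU.
- by move=> A; exact: factor_measurable.
(* Nonpositive fibre coordinates form a null set, and the rays []1 / n, +oo[] have finite measure
   and exhaust the rest. *)
- pose U n : set RR := if n is k.+1 then `]k.+1%:R^-1, +oo[%classic else [set t : R | t <= 0].
  have mU n : measurable (U n) by case: n => [|n] /=; [exact: measurable_neg|exact: measurable_itv].
  have Ufin n : (kappa (U n) < +oo)%E.
    by case: n => [|n] /=; [case: hk => -> _ _|apply: kappa_ray_lty => //; rewrite invr_gt0].
  exists (fun n => future @^-1` (setT `*` U n)); split.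
    move=> n; split.
      by apply: (factor_pull nk measurable_future); exact: measurableX.
    have E := product_measure1E tmu kappa measurableT (mU n).
    by apply: (@le_lt_trans _ _ (kappa (U n))) => //; rewrite [leLHS]E [X in (X * _)%E]probability_setT mul1e.
  apply/seteqP; split => // -[x t] _.
  have [t0|t0] := leP t 0; first by exists 0%N.
  have [n _ /(_ n (leqnn n)) /= hn] := near_infty_natSinv_lt (PosNum t0).
  by exists n.+1 => //; split => //=; rewrite in_itv /= andbT.
- exact: FK_pre.
(* The Maharam extension preserves its measure, so its derivative is 1. *)
- exists (cst 1); last first.
    move=> B mB; have [B1|nB1] := pselect (B 1).
      rewrite (_ : _ @^-1` B = setT); first by rewrite -setC0; apply: factorC; exact: (factor0 nk measurable_future).
      by apply/seteqP; split.
    rewrite (_ : _ @^-1` B = set0); first exact: (factor0 nk measurable_future).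
    by apply/seteqP; split.
  split => // A mA; apply: (@etrans _ _ (nk A)); last first.
    by transitivity (\int[nk]_(y in A) (cst 1%E y))%E => //; rewrite integral_cst// mul1e.
  have -> : M @` A = maharam_inv unshift2 omega @^-1` A.
    apply/seteqP; split => [_ [w Aw <-]|w Aw].
      by rewrite /preimage /= (maharamK shift2K ho).
    by exists (maharam_inv unshift2 omega w) => //; exact: maharam_invK unshift2K ho _.
  have mI : measurable (maharam_inv unshift2 omega @^-1` A).
    by apply: measurable_pre mA; exact: measurable_maharam_inv measurable_unshift2 ho.
  rewrite -MP//; congr nk; apply/seteqP; split => w; by rewrite /preimage /= (maharamK shift2K ho).
- have imE n A : iter n M @` A = iter n (maharam_inv unshift2 omega) @^-1` A.
    apply/seteqP; split => [_ [w Aw <-]|w Aw]; first by rewrite /preimage /= iterMK.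
    by exists (iter n (maharam_inv unshift2 omega) w) => //; exact: iterMinvK.
  apply/seteqP; split.
    apply: smallest_sub; first exact: sigma_algebra_measurable.
    move=> _ [n _ [A fA <-]]; rewrite imE; apply: measurable_pre (factor_measurable fA).
    by apply: measurable_iter; exact: measurable_maharam_inv measurable_unshift2 ho.
  apply: subset_trans stage_FK_generates _; apply: smallest_sub.
    exact: smallest_sigma_algebra.
  move=> A [l _ [mA fA]]; apply: sub_sigma_algebra; exists l.+1 => //; exists (iter l.+1 M @^-1` A).
    by rewrite iter_preimageS; exact: FK_pre.
  by rewrite imE; apply/seteqP; split => w; rewrite /preimage /= -/(iter l.+1 M _) iterMinvK.
- exact: tail_FK_trivial.
Qed.

(** * Products with an ergodic probability preserving system *)

Section weak_mixing.
Hypothesis cons : conservative tmu shift2.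
Variables (d : measure_display) (Z : measurableType d) (p : probability Z R) (s : Z -> Z).
Hypotheses (ms : measurable_fun setT s)
  (sP : forall A, measurable A -> p (s @^-1` A) = p A) (erg : ergodic p s).
Local Notation m := (nk \x p)%E.

Definition product_map (w : X2 * RR * Z) : X2 * RR * Z := (M w.1, s w.2).
Definition product_future (w : X2 * RR * Z) : X1 * RR * Z := (future w.1, w.2).
Definition product_future_map (v : X1 * RR * Z) : X1 * RR * Z := (future_map v.1, s v.2).
Local Notation N := product_map.
Local Notation F0 := (factor_algebra m product_future).

Let mN : measurable_fun setT N.
Proof.
by apply: measurable_fun_pair; [exact: measurableT_comp mM measurable_fst|
  exact: measurableT_comp ms measurable_snd].
Qed.

Let mpf : measurable_fun setT product_future.
Proof.
apply: measurable_fun_pair; last exact: measurable_snd.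
exact: measurableT_comp measurable_future measurable_fst.
Qed.

Let mpfm : measurable_fun setT product_future_map.
Proof.
by apply: measurable_fun_pair; [exact: measurableT_comp measurable_future_map measurable_fst|
  exact: measurableT_comp ms measurable_snd].
Qed.

Let NP A : measurable A -> m (N @^-1` A) = m A.
Proof. exact: product_preserving. Qed.

Let ae_pfm : {ae m, forall w, product_future (N w) = product_future_map (product_future w)}.
Proof.
have := ae_fst p ae_future_map; apply: filterS => w e.
by rewrite /product_future /product_future_map /product_map /= e.
Qed.

Let iterN l w : iter l N w = (iter l M w.1, iter l s w.2).
Proof. by elim: l => [|l IH]; [case: w|rewrite !iterS IH]. Qed.

Let FK_F0 A : FK A -> F0 (A `*` setT).
Proof.
move=> [mA [B mB AB]]; split; first exact: measurableX.
exists (B `*` setT); first exact: measurableX.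
have := ae_fst p AB; apply: filterS => w h.
by split => -[/h].
Qed.

Let gen : measurable `<=` <<s \bigcup_l stage N F0 l >>.
Proof.
apply: product_generated stage_FK_generates _ _.
  move=> A [l _ [mA fA]]; apply: sub_sigma_algebra; exists l => //.
  split; first exact: measurableX.
  rewrite (_ : _ @^-1` _ = (iter l M @^-1` A) `*` setT); first exact: FK_F0.
  by apply/seteqP; split => w; rewrite /preimage /= iterN.
move=> B mB; apply: sub_sigma_algebra; exists 0%N => //.
have mTB : measurable ([set: X1 * RR] `*` B) by exact: measurableX.
split; first exact: measurableX.
exact: (factor_pull m mpf mTB).
Qed.

(** The sets [G n], with fibre coordinate above [1 / (n + 1)], have finite measure, are recurrent
    and exhaust almost all of the space. *)
Lemma invariant_factor E : measurable E -> N @^-1` E = E -> F0 E.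
Proof.
move=> mE NE.
pose c n : R := n.+1%:R^-1.
have c0 n : 0 < c n by rewrite invr_gt0.
pose G n : set (X2 * RR * Z) := upper_half (c n) `*` setT.
have mG n : measurable (G n) by apply: measurableX => //; exact: measurable_upper_half.
have F0E n : F0 (E `&` G n).
  apply: (invariant_future mN NP (mG n) _ _ _ _ _ _ _ _ gen) => //.
  - have E1 := product_measure1E nk p (measurable_upper_half (c n)) measurableT.
    rewrite [ltLHS]E1 [X in (_ * X)%E]probability_setT mule1.
    exact: (upper_half_lty tmu hk (c0 n)).
  - by move=> A; exact: factor_measurable.
  - exact: (factor0 m mpf).
  - by move=> A; exact: factorC.
  - by move=> A; exact: factorU.
  - exact: (factor_pre mN NP mpfm ae_pfm).
  - by move=> A B; exact: factor_ae.
  - rewrite (_ : G n = product_future @^-1` ([set v : X1 * RR | c n < v.2] `*` setT)).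
      apply: (factor_pull m mpf); apply: measurableX => //.
      rewrite -[X in measurable X]setTI.
      by apply: (@measurable_fun_ltr _ _ _ _ (cst (c n)) snd) => //; exact: measurable_snd.
    by apply/seteqP; split => w [].
  have := ae_fst p (maharam_recurrent shift2K unshift2K measurable_shift2 measurable_unshift2 ho kappa (c0 n) cons).
  move=> [C [mC C0 hC]].
  have mfr : measurable (first_return N (G n) (G n)) by exact: measurable_first_return.
  apply: (subset_measure0 _ mC) C0; first exact: measurableD.
  move=> w [[Gw _] nfr]; apply: hC => /(_ Gw)[k hk']; apply: nfr.
  by apply: (first_return_exists (k := k)) => //; rewrite iterN.
have F0U : F0 (\bigcup_n (E `&` G n)) by apply: factorU => n; exact: F0E.
apply: (factor_ae mE F0U).
have pos : {ae nk, forall w, 0 < w.2}.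
  exists (setT `*` [set t : R | t <= 0]); split.
  - apply: measurableX => //; exact: measurable_neg.
  - apply: etrans (product_measure1E _ _ measurableT (@measurable_neg R)) _.
    by case: hk => -> _ _; rewrite mule0.
  - by move=> w /= /negP; rewrite -leNgt.
have := ae_fst p pos; apply: filterS => w w0; split => [Ew|[n _ []//]].
have [n _ /(_ n (leqnn n)) /= hn] := near_infty_natSinv_lt (PosNum w0).
by exists n.
Qed.

Let iter_sP n A : measurable A -> p (iter n s @^-1` A) = p A.
Proof.
move=> mA; elim: n => // n IH; rewrite iter_preimageS sP//.
by apply: measurable_pre mA; exact: measurable_iter.
Qed.

Let ae_s n (Q : Z -> Prop) : {ae p, forall z, Q z} -> {ae p, forall z, Q (iter n s z)}.
Proof.
by apply: ae_pullback; [exact: measurable_iter|move=> A mA A0; exact: etrans (iter_sP n mA) A0].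
Qed.

Section invariant_set.
Variables (E : set (X2 * RR * Z)) (b : set (X1 * RR * Z)).
Hypotheses (NE : N @^-1` E = E) (mb : measurable b)
  (Eb : {ae m, forall w, E w <-> b (product_future w)}).

Let section_shift : {ae nk, forall w, {ae p, forall z,
  b (future w, z) <-> b (future_map (future w), s z)}}.
Proof.
apply: (@ae_xsection _ _ _ _ _ nk p
  (fun w => b (product_future w) <-> b (product_future_map (product_future w)))).
have Eb' : {ae m, forall w, E (N w) <-> b (product_future (N w))}.
  by apply: (ae_pullback (f := N)) Eb => // A mA A0; apply: etrans (NP mA) _.
apply: filterS3 Eb Eb' ae_pfm => w h1 h2 <-.
by rewrite -h1 -h2 -[in X in X <-> _]NE.
Qed.

(* The conditional probability of [D] on a fibre of [b] is a tail function. *)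
Let section_cst D : measurable D ->
  exists c, {ae mk, forall v, p (D `&` xsection b v) = c%:E}.
Proof.
(* The section of [X n] at [v] consists of the [z] in [D] with [s^n z] in the section of [b] at [v].
   Moving [v] one step adds one application of [s], which leads to [X n.+1]. *)
move=> mD; pose X n : set (X1 * RR * Z) :=
  (setT `*` D) `&` ((fun w => (w.1, iter n s w.2)) @^-1` b).
have mX n : measurable (X n).
  apply: measurableI; first exact: measurableX.
  apply: measurable_pre mb; apply: measurable_fun_pair; first exact: measurable_fst.
  by apply: measurableT_comp measurable_snd; exact: measurable_iter.
pose a n v : R := fine (p (xsection (X n) v)).
have pfin n v : p (xsection (X n) v) \is a fin_num.
  by apply: fin_num_measure; exact: measurable_xsection.
have ma n : measurable_fun setT (a n).
  apply/measurable_EFinP; rewrite (_ : EFin \o a n = p \o xsection (X n)).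
    exact: measurable_fun_xsection.
  by apply/funext => v /=; rewrite fineK.
have a01 n v : 0 <= a n v <= 1.
  by rewrite fine_ge0//= -lee_fin fineK// probability_le1//; exact: measurable_xsection.
have aS n : {ae nk, forall w, a n (future w) = a n.+1 (future_map (future w))}.
  apply: filterS section_shift => w /(ae_s n) h; congr fine.
  apply: ae_iff_measure; [exact: measurable_xsection..|].
  apply: filterS h => z h; rewrite /xsection /= !inE /X /=.
  by split => -[dz bz]; split => //; apply/h.
have [c hc] := tail_const ma a01 aS; exists c.
apply: filterS hc => v; rewrite /a => <-; rewrite fineK//; congr (p _).
apply/seteqP; split => z; rewrite /xsection /=.
  by move=> [Dz]; rewrite !inE => bz; split.
by rewrite inE => -[[_ Dz] bz]; split => //; rewrite inE.
Qed.

Let V0 : set (X1 * RR) := setT `*` `]1, +oo[%classic.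

Lemma invariant_fibre : exists2 D, measurable D &
  {ae mk, forall v, {ae p, forall z, b (v, z) <-> D z}}.
Proof.
have mV0 : measurable V0 by apply: measurableX => //; exact: measurable_itv.
have V0E : mk V0 = (kappa1 kappa)%:E.
  apply: etrans (product_measure1E mu kappa measurableT (measurable_itv _)) _.
  rewrite [X in (X * _)%E]probability_setT mul1e.
  by rewrite (kappa_ray hk ltr01) divr1.
have mk_sigma : sigma_finite setT mk.
  have [F FT Ffin] := sigma_finiteT kappa.
  exists (fun n => setT `*` F n); last first.
    move=> n; have [mF fF] := Ffin n; split; first exact: measurableX.
    have e := product_measure1E mu kappa measurableT mF.
    by rewrite [ltLHS]e [X in (X * _)%E]probability_setT mul1e.
  apply/seteqP; split => // -[x t] _; have : setT t by [].
  by rewrite FT => -[n _ Fn]; exists n.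
exact: (constant_fibres mk_sigma mb mV0 V0E (kappa1_gt0 hk) section_cst).
Qed.

End invariant_set.

Lemma product_ergodic : ergodic m N.
Proof.
move=> E mE NE; have [_ [b mb Eb]] := invariant_factor mE NE.
have [D mD bD] := invariant_fibre NE mb Eb.
have ED : {ae nk, forall w, {ae p, forall z, E (w, z) <-> D z}}.
  have bD' : {ae nk, forall w, {ae p, forall z, b (future w, z) <-> D z}}.
    apply: (ae_pullback (f := future)) bD; first exact: measurable_future.
    by move=> C mC C0; apply: etrans (future_law mC) _.
  have Eb' := @ae_xsection _ _ _ _ _ nk p (fun w => E w <-> b (product_future w)) Eb.
  apply: filterS2 Eb' bD' => w; apply: filterS2 => z h1 h2.
  by apply: iff_trans h1 h2.
have sD : {ae p, forall z, D z <-> D (s z)}.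
  have ED' : {ae nk, forall w, {ae p, forall z, E (M w, z) <-> D z}}.
    by apply: (ae_pullback (f := M)) ED => // C mC C0; apply: etrans (MP mC) _.
  (* The fibres of [E] over [w] and over [M w] both equal [D] almost everywhere, and by invariance
     of [E] the map [s] relates one to the other. *)
  have [w [h1 h2]] : exists w, {ae p, forall z, E (w, z) <-> D z} /\
      {ae p, forall z, E (M w, z) <-> D z}.
    apply: contrapT => nex.
    have : {ae nk, forall w : X2 * RR, False}.
      by apply: filterS2 ED ED' => w hw1 hw2; apply: nex; exists w.
    move=> [C [mC C0 hC]].
    have e := product_measure1E tmu kappa measurableT (measurable_itv `]1, +oo[).
    have : nk (setT `*` `]1, +oo[%classic) = 0%E.
      apply: (subset_measure0 _ mC) C0; last by move=> w _; apply: hC => -[].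
      by apply: measurableX => //; exact: measurable_itv.
    rewrite [LHS]e [X in (X * _)%E]probability_setT mul1e (kappa_ray hk ltr01) divr1.
    by move=> -[k0]; have := kappa1_gt0 hk; rewrite k0 ltxx.
  apply: filterS2 h1 (ae_s 1 h2) => z e1 e2.
  apply: iff_trans (iff_sym e1) (iff_trans _ e2).
  by rewrite -[in X in X <-> _]NE.
(* [D] is invariant only up to a null set. Its upper limit along the orbit is invariant everywhere,
   as the definition of ergodicity demands. *)
pose D1 := [set z | forall n, exists2 k, (n <= k)%N & D (iter k s z)].
have mD1 : measurable D1.
  rewrite (_ : D1 = lim_sup_set (fun k => iter k s @^-1` D)).
    apply: bigcap_measurableType => n _; apply: bigcup_measurable => k _.
    by apply: measurable_pre mD; exact: measurable_iter.
  apply/seteqP; split => z h n; first by move=> _; have [k nk' Dk] := h n; exists k.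
  by have [k nk' Dk] := h n I; exists k.
have sD1 : s @^-1` D1 = D1.
  apply/seteqP; split => z h n; have [k nk' Dk] := h n.
    by exists k.+1; [exact: leq_trans nk' (leqnSn k)|rewrite iterSr].
  have [[|k'] //] := h n.+1; move=> nk'' Dk'; exists k' => //.
  by rewrite -iterSr.
have DD1 : {ae p, forall z, D1 z <-> D z}.
  have H : {ae p, forall z, forall n, D (iter n s z) <-> D (s (iter n s z))}.
    by apply: ae_foralln => n; exact: (ae_s n sD).
  apply: filterS H => z h.
  have Dk k : D (iter k s z) <-> D z.
    by elim: k => // k IH; rewrite iterS; apply: iff_trans (iff_sym (h k)) IH.
  by split => [/(_ 0%N)[k _ /Dk]|Dz n] //; exists n => //; exact/Dk.
have pD1 : p D1 = p D by exact: ae_iff_measure.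
have pnD1 : p (~` D1) = p (~` D).
  apply: ae_iff_measure; [exact: measurableC..|].
  by apply: filterS DD1 => z h; split; apply: contra_not => /h.
have mEc : measurable (~` E) by exact: measurableC.
have [h0|h0] := erg mD1 sD1; [left|right]; apply: xsection_null => //;
  apply: filterS ED => w h.
  rewrite -h0 pD1; apply: ae_iff_measure => //; first exact: measurable_xsection.
  by apply: filterS h => z hz; rewrite /xsection /= inE.
rewrite -h0 pnD1; apply: ae_iff_measure; [exact: measurable_xsection|exact: measurableC|].
by apply: filterS h => z hz; rewrite /xsection /= inE; split; apply: contra_not => /hz.
Qed.

End weak_mixing.

(** The product theorem is applied to a trivial system, the point mass at [0] on the line with the
    identity map. *)
Lemma maharam_ergodic : conservative tmu shift2 -> ergodic nk M.
Proof.
move=> cons; pose p : probability RR R := \d_(0 : RR).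
have pE A : p A = ((0 \in A)%:R)%:E by rewrite -[RHS]/((\1_A (0 : RR))%:E).
have erg : ergodic p id.
  move=> A mA _; have [A0|A0] := boolP (0 \in A); [right|left].
    by rewrite pE in_setC A0.
  by rewrite pE (negbTE A0).
have H := product_ergodic cons (@measurable_id _ RR setT) (fun A _ => erefl) erg.
have PE A : measurable A -> (nk \x p)%E (A `*` setT) = nk A.
  move=> mA; apply: etrans (product_measure1E _ _ mA measurableT) _.
  by rewrite [X in (_ * X)%E]probability_setT mule1.
move=> E mE ME; have mEc := measurableC mE.
have [||h|h] := H (E `*` setT).
- exact: measurableX.
- by rewrite -[in RHS]ME; apply/seteqP; split => -[w z] [Ew _].
- by left; rewrite -PE.
right; rewrite -PE// -h; congr (_ _); apply/seteqP; split => [[w z] [nE _] [Ew _]//|[w z] nE].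
by split => // Ew; apply: nE.
Qed.

End tail.
End markov_maharam.

Theorem conservative_maharam {R : realType} (lambda : 'I_2 -> R) (P : nat -> 'M[R]_2)
    (mu : probability X1 R) (tmu : probability X2 R) (alpha : R) :
  nonsingular_markov_shift lambda P mu ->
  natural_extension_measure lambda P tmu ->
  conservative tmu shift2 -> 0 < alpha ->
  {ae (pushforward mu odd_coordinates : set X1 -> \bar R),
     forall x, good_point (ratio P x) alpha} ->
  maharam_extension_is (fun m f => weakly_mixing m f /\ K_automorphism m f) tmu shift2 /\
  type_III1 tmu shift2.
Proof.
move=> hmu htmu cons a0 good; have [g [mg g0 gE]] := shift_density_exists hmu.
have ns := nonsingular_shift2 hmu htmu mg g0 gE.
split; split => // omega kappa ho hk; last exact: (maharam_ergodic hmu htmu mg g0 gE ho hk a0 good cons).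
split; last exact: (maharam_K_automorphism hmu htmu mg g0 gE ho hk a0 good).
move=> d' Z p s _ [ms _] [_ sP] erg.
exact: (product_ergodic hmu htmu mg g0 gE ho hk a0 good cons ms sP erg).
Qed.

(** * The stationary case *)

(** Both sides are additive over cylinders, so the bound passes from the two refinements at [i] to
    their union as soon as the weights add up. *)
Lemma cyl_merge {I : eqType} {R : realType} (m1 m2 : {measure set (path_space I) -> \bar R})
    (A : set (path_space I)) (J : seq I) (i : I) (x : path_space I) (w0 w1 w s : R) :
  measurable A -> i \notin J -> w0 + w1 <= w ->
  (m1 (A `&` cyl (i :: J) (upd x i 0%R)) <=
     w0%:E + s%:E * m2 (A `&` cyl (i :: J) (upd x i 0%R)))%E ->
  (m1 (A `&` cyl (i :: J) (upd x i 1%R)) <=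
     w1%:E + s%:E * m2 (A `&` cyl (i :: J) (upd x i 1%R)))%E ->
  (m1 (A `&` cyl J x) <= w%:E + s%:E * m2 (A `&` cyl J x))%E.
Proof.
move=> mA iJ ww h0 h1.
have dec (m : {measure set (path_space I) -> \bar R}) : m (A `&` cyl J x) =
    (m (A `&` cyl (i :: J) (upd x i 0%R)) + m (A `&` cyl (i :: J) (upd x i 1%R)))%E.
  rewrite (cyl_split _ iJ) setIUr measureU//;
    [by apply: measurableI => //; exact: measurable_cyl..|].
  by rewrite setIACA cyl_split_disj setI0.
rewrite !dec ge0_muleDr//; apply: le_trans (leeD h0 h1) _.
by rewrite addeACA -EFinD leeD2r.
Qed.

(** * Comparison of two measures on windows *)

Section window_comparison.
Context {R : realType}.
Variables (lambda : 'I_2 -> R) (M : 'M[R]_2) (v m1 m2 : probability X2 R).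
Hypotheses (hv : stationary_markov_measure lambda M v)
  (lambda_gt0 : forall a, 0 < lambda a) (M_gt0 : forall a b, 0 < M a b).
Variables A B : nat -> 'M[R]_2.
Hypotheses (A_gt0 : forall k a b, 0 < A k a b) (B_gt0 : forall k a b, 0 < B k a b)
  (A_sum : forall k a, A k a 0 + A k a 1 = 1) (B_sum : forall k a, B k a 0 + B k a 1 = 1).

Definition stationary_weight (n m : nat) (x : X2) : R :=
  lambda (x (- n%:Z)) * \prod_(k < n + m) M (x (- n%:Z + k%:Z)) (x (- n%:Z + k%:Z + 1)).

Definition forward_weight (C : nat -> 'M[R]_2) (n : nat) (x : X2) : R :=
  \prod_(k < n) C k (x k.+1%:Z) (x k.+2%:Z).

Lemma stationary_weight_gt0 n m x : 0 < stationary_weight n m x.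
Proof.
rewrite mulr_gt0//; elim/big_ind: _ => // *; exact: mulr_gt0.
Qed.

Lemma forward_weight_gt0 (C : nat -> 'M[R]_2) n x :
  (forall k a b, 0 < C k a b) -> 0 < forward_weight C n x.
Proof. by move=> C0; rewrite /forward_weight; elim/big_ind: _ => // *; exact: mulr_gt0. Qed.

Lemma stationary_win n m x : v (cyl (win n m) x) = (stationary_weight n m x)%:E.
Proof.
rewrite /stationary_weight -hv; congr (v _); apply/seteqP; split => y h i; rewrite ?mem_win => hi.
  by apply: h; rewrite mem_win; lia.
by apply: h; lia.
Qed.

Lemma stationary_weight_forward n m x :
  stationary_weight n m.+1 x = stationary_weight n 1 x * forward_weight (fun=> M) m x.
Proof.
elim: m => [|m IH]; first by rewrite /forward_weight big_ord0 mulr1.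
rewrite /forward_weight big_ord_recr /= mulrA -/(forward_weight (fun=> M) m x) -IH.
rewrite /stationary_weight addnS big_ord_recr /= mulrA; congr (_ * _ * M (x _) (x _)); lia.
Qed.

Hypotheses (m1E : forall n x, m1 (cyl (win n.+1 n.+1) x) =
    (stationary_weight n.+1 1 x * forward_weight A n x)%:E)
  (m2E : forall n x, m2 (cyl (win n.+1 n.+1) x) =
    (stationary_weight n.+1 1 x * forward_weight B n x)%:E).
Variables (d S : R) (u : nat -> R).
Hypotheses (d_gt0 : 0 < d) (B_ge : forall k a b, d <= B k a b)
  (u_ge : forall k a, (A k a 0 - B k a 0) ^+ 2 <= u k)
  (u_sum : forall n, \sum_(0 <= k < n) u k <= S).

(** [h] consists of the transition weights of the second moment: the squared likelihood ratio of [A]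
    to [B], weighted by [B]. Its row sums are bounded by [e]. *)
Let h k : 'M[R]_2 := \matrix_(a, b) (A k a b ^+ 2 / B k a b).
Let e k := 1 + 2 / d * u k.

Let h_gt0 k a b : 0 < h k a b.
Proof. by rewrite mxE divr_gt0// exprn_gt0. Qed.

Let u_ge0 k : 0 <= u k.
Proof. by apply: le_trans (u_ge k 0); exact: sqr_ge0. Qed.

Let e_ge1 k : 1 <= e k.
Proof. by rewrite lerDl mulr_ge0// divr_ge0// ltW. Qed.

(** The sum of [A^2 / B] over two probability vectors exceeds 1 by their chi-square distance, which
    for two letters is [(A_0 - B_0)^2 (1 / B_0 + 1 / B_1)]. *)
Let h_sum k a : h k a 0 + h k a 1 <= e k.
Proof.
have -> : h k a 0 + h k a 1 =
    1 + (A k a 0 - B k a 0) ^+ 2 * ((B k a 0)^-1 + (B k a 1)^-1).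
  have := A_sum k a; have := B_sum k a; rewrite !mxE.
  move: (B_gt0 k a 0) (B_gt0 k a 1); move: (A k a 0) (A k a 1) (B k a 0) (B k a 1) => p q r t.
  move=> r0 t0 rt pq; have -> : q = 1 - p by lra.
  have tE : t = 1 - r by lra.
  rewrite tE in t0 *; field; rewrite !lt0r_neq0//.
rewrite lerD2l mulrC; apply: ler_pM => //; [by rewrite addr_ge0// invr_ge0 ltW|exact: sqr_ge0|].
have -> : 2 / d = d^-1 + d^-1 by field; rewrite lt0r_neq0.
by apply: lerD; rewrite lef_pV2 ?posrE.
Qed.

Let e_prod n : \prod_(0 <= k < n) e k <= expR (2 / d * S).
Proof.
apply: (@le_trans _ _ (expR (\sum_(0 <= k < n) (2 / d * u k)))).
  elim: n => [|n IH]; first by rewrite !big_nil expR0.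
  rewrite !big_nat_recr//= expRD; apply: ler_pM => //; last exact: expR_ge1Dx.
    by elim/big_ind: _ => // *; [exact: mulr_ge0|exact: le_trans (e_ge1 _)].
  exact: le_trans (e_ge1 _).
by rewrite ler_expR -mulr_sumr ler_wpM2l// divr_ge0// ltW.
Qed.

Let w n j x := stationary_weight n.+1 1 x * forward_weight h j x.

Let w_ge0 n j x : 0 <= w n j x.
Proof. by rewrite ltW// mulr_gt0 ?stationary_weight_gt0// forward_weight_gt0. Qed.

Let w_step n j x b :
  w n j.+1 (upd x j.+2%:Z b) = w n j x * h j (x j.+1%:Z) b.
Proof.
have yE (i : int) : (i < j.+2%:Z)%R -> upd x j.+2%:Z b i = x i.
  by move=> ?; rewrite upd_other//; apply/eqP; lia.
rewrite /w /forward_weight big_ord_recr /= upd_same yE; last by lia.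
rewrite mulrA; congr (_ * _ * _).
  rewrite /stationary_weight yE; last by lia.
  by congr (_ * _); apply: eq_bigr => -[k hk] _ /=; rewrite !yE//; lia.
by apply: eq_bigr => -[k hk] _ /=; rewrite !yE//; lia.
Qed.

Section cylinder_set.
Variables (n : nat) (D : set X2) (s : R).
Hypotheses (hD : forall x y, cyl (win n.+1 n.+1) x y -> D x -> D y) (s0 : 0 < s).

Let mD : measurable D. Proof. exact: measurable_window hD. Qed.

(** Proved by descending induction on [j]: the letters are summed out from the right end of the
    window, each at the cost of one factor [e k]. *)
Let claim j x := (m1 (D `&` cyl (win n.+1 j.+1) x) <=
  (s * (w n j x * \prod_(j <= k < n) e k))%:E +
  s^-1%:E * m2 (D `&` cyl (win n.+1 j.+1) x))%E.

(* AM-GM *)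
Let claim_full x : claim n x.
Proof.
rewrite /claim big_geq// mulr1.
have [Dx|Dx] := pselect (D x); last first.
  rewrite (_ : D `&` _ = set0); last first.
    by apply/seteqP; split => // y [Dy] xy; apply: Dx; apply: hD Dy; exact: cyl_sym.
  by rewrite !measure0 mule0 adde0 lee_fin mulr_ge0// ltW.
rewrite (_ : D `&` _ = cyl (win n.+1 n.+1) x); last first.
  by apply/seteqP; split => [y []//|y xy]; split => //; exact: hD Dx.
rewrite m1E m2E -EFinM -EFinD lee_fin /w.
have -> : forward_weight h n x = forward_weight A n x ^+ 2 / forward_weight B n x.
  by rewrite expr2 -big_split -prodf_div; apply: eq_bigr => k _; rewrite mxE expr2.
have := stationary_weight_gt0 n.+1 1 x.
have := forward_weight_gt0 n x A_gt0; have := forward_weight_gt0 n x B_gt0.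
move: (stationary_weight _ _ _) (forward_weight _ _ _) (forward_weight _ _ _) => p a b b0 a0 p0.
have -> : s * (p * (a ^+ 2 / b)) + s^-1 * (p * b) =
    p * a + p * ((s * a - b) ^+ 2 + s * a * b) / (s * b).
  by field; rewrite !lt0r_neq0.
rewrite lerDl divr_ge0 ?mulr_ge0 ?addr_ge0 ?sqr_ge0 ?mulr_ge0 ?ltW//.
Qed.

Let claim_le q j x : (j + q)%N = n -> claim j x.
Proof.
elim: q j x => [|q IH] j x; first by rewrite addn0 => ->; exact: claim_full.
move=> jq; have jn : (j < n)%N by lia.
have e1 b : cyl (j.+2%:Z :: win n.+1 j.+1) (upd x j.+2%:Z b) =
    cyl (win n.+1 j.+2) (upd x j.+2%:Z b).
  by apply: cyl_same => i; rewrite inE !mem_win; lia.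
apply: (@cyl_merge _ _ m1 m2 D _ j.+2%:Z x
    (s * (w n j.+1 (upd x j.+2%:Z 0) * \prod_(j.+1 <= k < n) e k))
    (s * (w n j.+1 (upd x j.+2%:Z 1) * \prod_(j.+1 <= k < n) e k))) => //.
- by rewrite mem_win; lia.
- rewrite !w_step (big_ltn jn).
  have : 0 <= \prod_(j.+1 <= k < n) e k.
    by elim/big_ind: _ => // *; [exact: mulr_ge0|exact: le_trans (e_ge1 _)].
  move: (w_ge0 n j x) (h_sum j (x j.+1%:Z)).
  move: (w n j x) (h j _ 0) (h j _ 1) (e j) (\prod_(_ <= _ < _) _) => W a b E F W0 ab F0.
  by rewrite -mulrDr ler_pM2l// -mulrDl -mulrDr -mulrA ler_wpM2l// ler_wpM2r.
- by rewrite e1; apply: IH; lia.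
- by rewrite e1; apply: IH; lia.
Qed.

Let claim_cyl (J : seq int) : (forall x, (m1 (D `&` cyl J x) <=
    (s * expR (2 / d * S) * fine (v (cyl J x)))%:E + s^-1%:E * m2 (D `&` cyl J x))%E) ->
  (m1 D <= (s * expR (2 / d * S))%:E + s^-1%:E * m2 D)%E.
Proof.
elim: J => [|i J IH] hJ.
  have := hJ (fun=> 0); rewrite cyl_nil setIT.
  by rewrite [X in fine X](_ : _ = 1%E) ?mulr1//; exact: probability_setT.
apply: IH => x; have [iJ|iJ] := boolP (i \in J); first by have := hJ x; rewrite (cyl_mem _ iJ).
apply: cyl_merge (hJ (upd x i 0)) (hJ (upd x i 1)) => //.
rewrite -mulrDr (cyl_split x iJ) measureU; [|exact: measurable_cyl..|exact: cyl_split_disj].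
rewrite fineD//; apply: fin_num_measure; exact: measurable_cyl.
Qed.

(** After the future is summed out only the weight of the past remains; it is common to both
    measures and sums to one because it is the law of [v]. The constant does not depend on the
    window. *)
Lemma window_comparison : (m1 D <= (s * expR (2 / d * S))%:E + s^-1%:E * m2 D)%E.
Proof.
apply: (@claim_cyl (win n.+1 1)) => x.
apply: le_trans (@claim_le n 0 x (add0n n)) _; rewrite leeD2r// lee_fin -mulrA ler_pM2l//.
rewrite stationary_win /= /w /forward_weight big_ord0 mulr1 mulrC ler_pM2r ?stationary_weight_gt0//.
Qed.

End cylinder_set.

Definition wset j : set (set X2) :=
  [set D | forall x y, cyl (win j.+1 j.+1) x y -> D x -> D y].

(** [s] is chosen small first, then an approximating window set of [m2]-measure small relative to
    [s]. The approximation is made for [m1 + m2], so that one set serves both measures. *)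
Lemma comparison_null D : measurable D -> m2 D = 0%E -> m1 D = 0%E.
Proof.
move=> mD D0; pose K := expR (2 / d * S); have K0 : 0 < K := expR_gt0 _.
pose m := measure_add m1 m2.
have approx (t : R) : 0 < t -> exists2 C, exists j, wset j C & (m (symdiff D C) < t%:E)%E.
  move=> t0; suff [j [C [jC h']]] : exists j C, wset j C /\ (m (symdiff D C) < t%:E)%E.
    by exists C => //; exists j.
  apply: measure_approximation mD t0.
  - suff e2 : m setT = (1 + 1)%E by rewrite [ltLHS]e2 -EFinD ltry.
    by apply: etrans (measure_addE _ _ _) _; congr (_ + _)%E; exact: probability_setT.
  - by move=> j C hC; exact: measurable_window hC.
  - by move=> j x y _.
  - by move=> j C hC x y xy nC Cy; apply: nC; apply: hC Cy; exact: cyl_sym.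
  - by move=> j C C' hC hC' x y xy [/(hC _ _ xy)|/(hC' _ _ xy)]; [left|right].
  - move=> j k C jk hC x y xy; apply: hC => i; rewrite mem_win => hi; apply: xy.
    by rewrite mem_win; lia.
  - apply: smallest_sub; first exact: smallest_sigma_algebra.
    move=> _ [i [b ->]]; apply: sub_sigma_algebra; exists (absz i) => // x y xy /= <-.
    by apply: xy; rewrite mem_win; lia.
apply/eqP; rewrite eq_le measure_ge0 andbT; apply/lee_addgt0Pr => t0 t0_gt0; rewrite add0e.
pose t : R := t0; have {}t0_gt0 : 0 < t := t0_gt0; rewrite -[t0]/t.
(* Three contributions of at most [t / 3]: the constant term, the [m2]-term divided by [s], and the
   approximation error for [m1]. *)
pose s : R := t / 3 / K; have s0 : 0 < s by rewrite !divr_gt0.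
pose r : R := Num.min (t / 3) (s * (t / 3)).
have r0 : 0 < r by rewrite lt_min divr_gt0//= mulr_gt0// divr_gt0.
have [C [j jC]] := approx r r0; rewrite /m measure_addE => DC.
have mC : measurable C by exact: measurable_window jC.
have mDC : measurable (symdiff D C) by apply: measurableU; exact: measurableD.
have d1 : (m1 (symdiff D C) <= r%:E)%E.
  by apply: le_trans (ltW DC); rewrite leeDl.
have d2 : (m2 (symdiff D C) <= r%:E)%E.
  by apply: le_trans (ltW DC); rewrite leeDr.
have sub (m' : probability X2 R) (X Y : set X2) : measurable X -> measurable Y ->
    X `\` Y `<=` symdiff D C -> (m' X <= m' Y + m' (symdiff D C))%E.
  move=> mX mY XY; apply: (@le_trans _ _ (m' (Y `|` symdiff D C))).
    apply: le_measure; rewrite ?inE//; first exact: measurableU.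
    by move=> x Xx; have [Yx|Yx] := pselect (Y x); [left|right; apply: XY].
  exact: measureU2.
have C2 : (m2 C <= r%:E)%E.
  apply: le_trans (sub m2 C D mC mD _) _; first by right.
  by rewrite D0 add0e.
apply: le_trans (sub m1 D C mD mC _) _; first by left.
apply: le_trans (leeD (window_comparison jC s0) d1) _.
have h2 : (s^-1%:E * m2 C <= (t / 3)%:E)%E.
  apply: (@le_trans _ _ (s^-1%:E * r%:E)%E); first by rewrite lee_wpmul2l// lee_fin invr_ge0 ltW.
  by rewrite -EFinM lee_fin mulrC ler_pdivrMr// mulrC ge_min lexx orbT.
apply: le_trans (leeD (leeD (lexx _) h2) (lexx _)) _.
rewrite -!EFinD lee_fin -/K /s divfK ?lt0r_neq0//.
have : r <= t / 3 by rewrite ge_min lexx.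
by move: (r) (t) => a b; lra.
Qed.

End window_comparison.

Lemma positive_lower_bound {R : realType} (f : nat -> R) (e : R) (N : nat) :
  (forall n, 0 < f n) -> 0 < e -> (forall n, (N <= n)%N -> e <= f n) ->
  exists2 d : R, 0 < d & forall n, d <= f n.
Proof.
move=> f0; elim: N e => [|N IH] e e0 h; first by exists e => // n; exact: h.
apply: (IH (Num.min e (f N))); first by rewrite lt_min e0 f0.
by move=> n; rewrite leq_eqVlt => /predU1P[<-|/h]; rewrite ge_min ?lexx ?orbT// => ->.
Qed.

(** * The natural extension and the stationary measure *)

Section stationary_comparison.
Context {R : realType}.
Variables (lambda : 'I_2 -> R) (P : nat -> 'M[R]_2)
  (mu : probability X1 R) (tmu tnu : probability X2 R).
Hypotheses (hmu : nonsingular_markov_shift lambda P mu)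
  (htmu : natural_extension_measure lambda P tmu)
  (hstat : forall v : 'I_2, \sum_(u < 2) lambda u * P 0%N u v = lambda v)
  (hsum : (\sum_(u < 2) \sum_(0 <= n <oo) ((P n u 0 - P 0%N u 0) ^+ 2)%:E < +oo)%E)
  (htnu : stationary_markov_measure lambda (P 0%N) tnu).

Let P_sum k a : P k a 0 + P k a 1 = 1.
Proof.
have [_ [hP _] _ _ _] := hmu; have [_ h] := hP k; rewrite -(h a).
by rewrite big_ord_recl big_ord1; congr (_ + P k a _); exact: val_inj.
Qed.

Let lambda_stat j : lambda 0 * P 0%N 0 j + lambda 1 * P 0%N 1 j = lambda j.
Proof.
rewrite -[RHS]hstat big_ord_recl big_ord1; congr (_ + _).
by have -> : lift ord0 ord0 = 1 :> 'I_2 by exact: val_inj.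
Qed.

(** Stationarity turns the backward matrix into the time reversal of [P 0], and the factors [lambda]
    telescope along the past. *)
Lemma stationary_past n x : past_weight lambda P n x (x 1) * lambda (x 1) =
  stationary_weight lambda (P 0%N) n 1 x.
Proof.
have l0 a : lambda a != 0 by rewrite lt0r_neq0// (lambda_gt0 hmu).
have QE i j : backward_matrix lambda P i j = lambda i * P 0%N i j / lambda j.
  by rewrite /backward_matrix lambda_stat.
elim: n => [|n IH].
  by rewrite /past_weight /stationary_weight !big_ord_recl !big_ord0 /= !mulr1 QE divfK.
rewrite /past_weight big_ord_recr /= mulrA -/(past_weight lambda P n x (x 1)) mulrAC IH QE.
rewrite /stationary_weight [in RHS]addSn [in RHS]big_ord_recl /= !addr0.
have -> : - n.+1%:Z + 1 = - n%:Z by lia.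
rewrite [in RHS](eq_bigr (fun k : 'I_(n + 1) => P 0%N (x (- n%:Z + k%:Z)) (x (- n%:Z + k%:Z + 1)))).
  by field; exact: l0.
by move=> k _; congr (P 0%N (x _) (x _)); rewrite /bump leq0n; lia.
Qed.

Lemma tmu_stationary n x : tmu (cyl (win n.+1 n.+1) x) =
  (stationary_weight lambda (P 0%N) n.+1 1 x * forward_weight P n x)%:E.
Proof.
rewrite (tmu_win hmu htmu)// -stationary_past; congr EFin.
by rewrite /path_weight mulrA.
Qed.

Lemma tnu_stationary n x : tnu (cyl (win n.+1 n.+1) x) =
  (stationary_weight lambda (P 0%N) n.+1 1 x * forward_weight (fun=> P 0%N) n x)%:E.
Proof. by rewrite (stationary_win htnu) stationary_weight_forward. Qed.

Lemma stationary_shift : measure_preserving tnu shift2.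
Proof.
split; first exact: measurable_shift2.
apply: (@path_measure_unique _ _ (distribution tnu shift2) tnu (fun k => win k k)).
- by rewrite [ltLHS](_ : _ = 1%E) ?ltry//; exact: probability_setT.
- exact: win_exhaust.
move=> k x; apply/esym; apply: etrans (stationary_win htnu _ _ _) _; apply/esym.
apply: (@etrans _ _
    (tnu [set y | forall i : int, 1 - k%:Z <= i <= 1 - k%:Z + (k + k)%:Z -> y i = unshift2 x i])).
  congr (tnu _); apply/seteqP; split => y h i => [hi|]; last first.
    by rewrite mem_win => hi; have := h (i + 1); rewrite /unshift2 addrK; apply; lia.
  have e : shift2 y (i - 1) = x (i - 1) by apply: h; rewrite mem_win; lia.
  by rewrite /unshift2 -e /shift2 subrK.
rewrite htnu /stationary_weight /unshift2; congr (_ * _)%:E.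
  by congr (lambda (x _)); lia.
by apply: eq_bigr => i _; congr (P 0%N (x _) (x _)); lia.
Qed.

Let deviation k a : R := (P k a 0 - P 0%N a 0) ^+ 2.

Let deviation_fin a : (\sum_(0 <= n <oo) (deviation n a)%:E < +oo)%E.
Proof.
apply: le_lt_trans hsum; rewrite (bigD1 a)//= leeDl// sume_ge0// => b _.
by apply: nneseries_ge0 => n _ _; rewrite lee_fin sqr_ge0.
Qed.

Let deviation_sum : exists S : R, forall n,
  \sum_(0 <= k < n) \sum_(a < 2) deviation k a <= S.
Proof.
exists (\sum_(a < 2) fine (\sum_(0 <= n <oo) (deviation n a)%:E)) => n.
rewrite exchange_big /=; apply: ler_sum => a _.
rewrite -lee_fin -sumEFin fineK; last first.
  rewrite ge0_fin_numE//; apply: nneseries_ge0 => k _ _.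
  by rewrite lee_fin sqr_ge0.
by apply: nneseries_lim_ge => k _; rewrite lee_fin sqr_ge0.
Qed.

Let transition_lower_bound : exists2 d : R, 0 < d & forall k a b, d <= P k a b.
Proof.
have low a b : exists2 d : R, 0 < d & forall k, d <= P k a b.
  (* Summability forces [P n] to tend to [P 0], so all but finitely many entries are at least half
     of the initial one. *)
  pose e : R := P 0%N a b / 2; have e0 : 0 < e by rewrite divr_gt0// (transition_gt0 hmu).
  have [N hN] := nneseries_to0 (fun n => sqr_ge0 (P n a 0 - P 0%N a 0))
    (exprn_gt0 2 e0) (deviation_fin a).
  apply: (@positive_lower_bound _ _ e N) => // [n|n /hN]; first exact: (transition_gt0 hmu).
  rewrite -[X in X <= _]real_normK ?num_real// ler_pXn2r ?nnegrE ?(ltW e0)// => h.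
  have : `|P n a b - P 0%N a b| <= e.
    have [->//|->] := ord2P b; apply: le_trans h.
    have := P_sum n a; have := P_sum 0%N a => h0 h1.
    by rewrite distrC (_ : P 0%N a 1 - P n a 1 = P n a 0 - P 0%N a 0)//; lra.
  by rewrite ler_norml => /andP[+ _]; rewrite /e; lra.
have [d00 p00 h00] := low 0 0; have [d01 p01 h01] := low 0 1.
have [d10 p10 h10] := low 1 0; have [d11 p11 h11] := low 1 1.
exists (Num.min (Num.min d00 d01) (Num.min d10 d11)); first by rewrite !lt_min p00 p01 p10.
by move=> k a b; have [->|->] := ord2P a; have [->|->] := ord2P b;
  rewrite !ge_min ?h00 ?h01 ?h10 ?h11 ?orbT.
Qed.

(** The comparison is applied twice with the transition sequences exchanged. Its lower bound
    concerns the denominator of the likelihood ratio, hence a bound valid for all [P n] at once. *)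
Lemma stationary_isomorphic : isomorphic tmu shift2 tnu shift2.
Proof.
have [S hS] := deviation_sum; have [d d0 hd] := transition_lower_bound.
have l0 := lambda_gt0 hmu; have p0 := transition_gt0 hmu.
have dev k a : deviation k a <= \sum_(b < 2) deviation k b.
  by rewrite (bigD1 a)//= lerDl sumr_ge0// => b _; exact: sqr_ge0.
have nu_null A : measurable A -> tnu A = 0%E -> tmu A = 0%E.
  by apply: (comparison_null htnu l0 (p0 0%N) (A := P) (B := fun=> P 0%N) _ _ _ _
    tmu_stationary tnu_stationary d0 _ _ hS).
have mu_null A : measurable A -> tmu A = 0%E -> tnu A = 0%E.
  apply: (comparison_null htnu l0 (p0 0%N) (A := fun=> P 0%N) (B := P) _ _ _ _
    tnu_stationary tmu_stationary d0 _ _ hS) => //.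
  by move=> k a; rewrite -sqrrN opprB; exact: dev.
exists id, id; split; first by split; [exact: measurable_id|exact: measurable_id|exact: aeW|exact: aeW].
split; first exact: aeW.
by split; apply/null_content_dominatesP.
Qed.

End stationary_comparison.

Theorem theorem9p4 (R : realType) (lambda : 'I_2 -> R) (P : nat -> 'M[R]_2)
    (mu : probability X1 R) (tmu : probability X2 R)
    (hmu : nonsingular_markov_shift lambda P mu)
    (htmu : natural_extension_measure lambda P tmu) :
  ((forall v : 'I_2, \sum_(u < 2) lambda u * P 0%N u v = lambda v) ->
   (\sum_(u < 2) \sum_(0 <= n <oo) ((P n u 0 - P 0%N u 0) ^+ 2)%:E < +oo)%E ->
   forall tnu : probability X2 R,
     stationary_markov_measure lambda (P 0%N) tnu ->
     measure_preserving tnu shift2 /\ isomorphic tmu shift2 tnu shift2) /\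
  (conservative tmu shift2 ->
   forall L : set R,
     ratio_limit_set P mu L -> contains_good_nonzero_point P mu L ->
     maharam_extension_is
       (fun m g => weakly_mixing m g /\ K_automorphism m g) tmu shift2 /\
     type_III1 tmu shift2).

Proof.
split=> [hstat hsum tnu htnu|cons L [_ L0 _] [alpha [La an0 good]]].
  split; first exact: stationary_shift htnu.
  exact: (stationary_isomorphic hmu htmu hstat hsum htnu).
apply: (conservative_maharam hmu htmu cons _ good).
by rewrite lt0r an0; exact: L0.
Qed.
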